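(* Let $k$ be an algebraically closed field of characteristic $5$, let $\Gamma\subset\mathbb{P}^2$ be a $k$-Hermitian curve, and let $D$ be (the vertex set of) a connected component of the graph $G$ on the set $\mathcal{Q}$ of non-singular conics totally tangent to $\Gamma$. Then $$|Q\cap Q'\cap\Gamma|=0$$ for any distinct conics $Q,Q'$ in $D$. Since $|D|\times 6=|\mathcal{P}|$, each connected component $D$ of $G$ gives rise to a decomposition of the set $\mathcal{P}$ of Weierstrass points of $\Gamma$ into a disjoint union of $21$ sets $Q\cap\Gamma$ of six points, where $Q$ runs through $D$.
   Context: Work over an algebraically closed field $k$ of characteristic $5$. A $k$-Hermitian curve is a projective plane curve $\Gamma\subset\mathbb{P}^2$ of degree $6$ that is projectively isomorphic (via $\mathrm{PGL}_3(k)$) to the Fermat curve $\Gamma_5: x^6+y^6+z^6=0$. $\mathcal{P}$ denotes the set of Weierstrass points of $\Gamma$; equivalently, the set of points $P\in\Gamma$ whose tangent line meets $\Gamma$ at $P$ with intersection multiplicity $6$ (for $\Gamma=\Gamma_5$, the $\mathbb{F}_{25}$-rational points). One has $|\mathcal{P}|=126$. A line of $\mathbb{P}^2$ is a special secant line of $\Gamma$ if it passes through two distinct points of $\mathcal{P}$. A non-singular conic $Q\subset\mathbb{P}^2$ is totally tangent to $\Gamma$ if $Q$ meets $\Gamma$ at six distinct points, each with intersection multiplicity $2$. $\mathcal{Q}$ denotes the set of all such conics; one has $|\mathcal{Q}|=3150$ and $Q\cap\Gamma\subset\mathcal{P}$ for $Q\in\mathcal{Q}$. For $Q\in\mathcal{Q}$,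 $\mathcal{S}(Q)$ is the set of the $15$ special secant lines of $\Gamma$ passing through two distinct points of $Q\cap\Gamma$. $G$ is the graph with vertex set $\mathcal{Q}$ in which distinct $Q,Q'$ are adjacent if and only if $|Q\cap Q'|=4$ and $|\mathcal{S}(Q)\cap\mathcal{S}(Q')|=3$. It has exactly $150$ connected components, each with $21$ vertices. *)

(* Defs.v *)
From HB Require Import structures.
From mathcomp Require Import all_boot all_order all_algebra.
From mathcomp Require Import mpoly.
From mathcomp Require Import boolp classical_sets functions cardinality.
From Stdlib Require Import Relation_Operators.
Set Implicit Arguments.
Unset Strict Implicit.
Unset Printing Implicit Defensive.
Import GRing.Theory.
Local Open Scope classical_set_scope.
Local Open Scope card_scope.
Local Open Scope ring_scope.

Definition proj (k : fieldType) (V : vectType k) : Type :=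
  {U : {vspace V} | \dim U == 1%N}.

(* A generator of the line; everything below is insensitive to its choice. *)
Definition proj_rep (k : fieldType) (V : vectType k) (U : proj V) : V :=
  vpick (val U).

Lemma dim_vline_eq1 (k : fieldType) (V : vectType k) (v : V) :
  v != 0 -> \dim <[v]>%VS == 1%N.
Proof. by move=> v0; rewrite dim_vline v0. Qed.

Definition proj_of (k : fieldType) (V : vectType k) (v : V) (v0 : v != 0) :
  proj V := exist _ <[v]>%VS (dim_vline_eq1 v0).

Section PlaneCurves.
Variable k : fieldType.

Definition point : Type := proj 'rV[k]_3.

(* Plane curves of degree d: nonzero ternary forms up to scaling; lines and
   conics are the cases d = 1 and d = 2. *)
Definition curve (d : nat) : Type := proj (dhomog 3 k d).

Definition equation d (C : curve d) : {mpoly k[3]} := proj_rep C.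

Definition value (F : {mpoly k[3]}) (P : point) : k :=
  F.@[fun i => proj_rep P 0 i].

Definition points d (C : curve d) : set point :=
  [set P | value (equation C) P = 0].

Definition nonsingular d (C : curve d) : Prop :=
  forall P, points C P -> exists i : 'I_3, value (mderiv i (equation C)) P <> 0.

(* The equation of C is, up to a scalar, that of C' composed with A; so
   v |-> A v carries C onto C'. *)
Definition proj_isomorphic d (C C' : curve d) : Prop :=
  exists2 A : 'M[k]_3, A \in unitmx &
  exists2 c : k, c != 0 &
    equation C =
    c *: (equation C' \mPo [tuple \sum_(j < 3) A i j *: 'X_j | i < 3]).

(* The local ring of the plane at P, inside the fraction field of k[x,y,z]. *)
Definition local_ring (P : point) : set {fraction {mpoly k[3]}} :=
  [set h | exists d (a b : {mpoly k[3]}),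
     [/\ a \is d.-homog, b \is d.-homog, value b P != 0 &
         h = tofrac a / tofrac b]].

(* The ideal of [local_ring P] generated by the germs at P of C and C'. *)
Definition local_ideal d d' (C : curve d) (C' : curve d') (P : point) :
    set {fraction {mpoly k[3]}} :=
  [set h | exists e (u v b : {mpoly k[3]}),
     let a := u * equation C + v * equation C' in
     [/\ a \is e.-homog, b \is e.-homog, value b P != 0 &
         h = tofrac a / tofrac b]].

(* The intersection multiplicity of C and C' at P is m: the quotient of the
   local ring by the local ideal has a k-basis of m elements. *)
Definition intersection_mult d d' (C : curve d) (C' : curve d') (P : point)
    (m : nat) : Prop :=
  exists2 e : 'I_m -> {fraction {mpoly k[3]}},
    forall i, local_ring P (e i) &
    forall h, local_ring P h ->
      exists! c : 'rV[k]_m,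
        local_ideal C C' P (h - \sum_(i < m) tofrac (c 0 i)%:MP * e i).

Definition tangent_line d (C : curve d) (P : point) (L : curve 1) : Prop :=
  points C P /\
  exists2 c : k, c != 0 &
    \sum_(i < 3) value (mderiv i (equation C)) P *: 'X_i = c *: equation L.

Definition fermat_form : {mpoly k[3]} := \sum_(i < 3) 'X_i ^+ 6.

Lemma fermat_form_homog : fermat_form \is 6.-homog.
Proof.
apply: rpred_sum => i _; rewrite -[6%N]mul1n; apply: dhomogMn.
by rewrite dhomogX /= mdeg1.
Qed.

Definition fermat_dhomog : dhomog 3 k 6 := DHomog fermat_form_homog.

Lemma fermat_dhomog_neq0 : fermat_dhomog != 0.
Proof.
pose m : 'X_{1..3} := (U_(ord0) *+ 6)%MM.
apply/eqP => /(congr1 (fun F : dhomog 3 k 6 => (F : {mpoly k[3]})@_m)).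
rewrite mcoeff0 /= /fermat_form raddf_sum /= (bigD1 ord0) //= big1 => [|i i0].
  by rewrite mpolyXn mcoeffX eqxx addr0 => /eqP; rewrite oner_eq0.
rewrite mpolyXn mcoeffX; case: eqP => // /mnmP /(_ ord0).
by rewrite !mulmnE !mnm1E eqxx (negPf i0).
Qed.

Definition fermat : curve 6 := proj_of fermat_dhomog_neq0.

Definition hermitian_curve (C : curve 6) : Prop := proj_isomorphic C fermat.

Section Hermitian.
Variable Gamma : curve 6.

(* For a Hermitian curve in characteristic 5, the Weierstrass points are the
   points at which the tangent line meets the curve with multiplicity 6. *)
Definition weierstrass : set point :=
  [set P | exists2 L, tangent_line Gamma P L & intersection_mult Gamma L P 6].

Definition secant_of (X : set point) : set (curve 1) :=
  [set L | exists P P', [/\ X P, X P', P <> P', points L P & points L P']].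

Definition special_secant : set (curve 1) := secant_of weierstrass.

Definition totally_tangent_conic : set (curve 2) :=
  [set Q | [/\ nonsingular Q,
               points Q `&` points Gamma #= `I_6 &
               forall P, (points Q `&` points Gamma) P ->
                 intersection_mult Q Gamma P 2]].

Definition special_secants_of (Q : curve 2) : set (curve 1) :=
  special_secant `&` secant_of (points Q `&` points Gamma).

Definition adjacent (Q Q' : curve 2) : Prop :=
  [/\ totally_tangent_conic Q, totally_tangent_conic Q', Q <> Q',
      points Q `&` points Q' #= `I_4 &
      special_secants_of Q `&` special_secants_of Q' #= `I_3].

Definition component (D : set (curve 2)) : Prop :=
  exists2 Q, totally_tangent_conic Q &
    D = [set Q' | clos_refl_trans _ adjacent Q Q'].

End Hermitian.
End PlaneCurves.

(* Main.v *)
(* Relative to a Hermitian form v^(5) H v^T defining Gamma, encode a conic by a frame: an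
   invertible matrix M whose rows carry the standard conic {(1 : t : t^2)} onto it. Choosing the
   first and last rows on Gamma, total tangency says that the restriction of the Hermitian form
   to the conic, a polynomial of degree at most 10 in t once its end coefficients vanish, is a
   square; comparing coefficients, Gram(M) = M^(5) H M^T becomes, after a torus rescaling, a
   multiple of one fixed matrix J, and that polynomial a multiple of (t^5 - t)^2. So the totally
   tangent conics are exactly the conics of frames with Gram(M) = c J; the six contact points are
   the t in P^1(F_5), and the Weierstrass points are the isotropic points with coordinates in
   F_25 relative to any such frame.

   Adjacent conics share a special secant. Frames of both whose end rows lie on that line differ
   by a unitary block matrix, and unitary matrices have entries in F_25; a finite search leaves
   two such matrices up to the conic they define. Hence the neighbours of a conic are obtained by
   these two matrices after each of the symmetric squares permuting P^1(F_5). From the identity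
   this generates an orbit of 21 conics closed under taking neighbours, and its 21 * 6 contact
   points are pairwise distinct and exhaust the isotropic points over F_25. *)
Require Import Defs.
From HB Require Import structures.
From mathcomp Require Import all_boot all_order all_algebra.
From mathcomp Require Import ring zify mpoly.
From mathcomp Require Import boolp classical_sets functions cardinality.
From Stdlib Require Import Relation_Operators.
Set Implicit Arguments.
Unset Strict Implicit.
Unset Printing Implicit Defensive.
Import GRing.Theory.
Local Open Scope classical_set_scope.
Local Open Scope card_scope.
Local Open Scope ring_scope.

(** An intersection multiplicity is the dimension of a quotient of a local ring, so it must first
    become computable. Along a parametrised curve the powers of a local parameter form a basis of
    that quotient, and invariance of dimension turns a prescribed multiplicity into the vanishing
    order of a polynomial. Only a line and the standard conic at parameter 0 are needed, since a
    change of frame brings any contact point there. Rationality over F_25 has one source: applying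
    Frobenius to v^(5) J w^T and transposing gives w^(5) J (v^(25))^T. Hence unitarity fixes a
    matrix under x -> x^25 entry by entry, and the relations at a Weierstrass point fix its
    coordinate vector up to a scalar. The block shape arises because a shared secant is the polar of
    the middle row in both frames. Conics are compared through dual matrices M^T J' M, J' being the
    dual of the standard conic: unlike equations, they involve no inverse of M and can be computed
    over F_25. *)

Lemma card_eq_II_rel (I : eqType) (T : Type) (A : set T) (s : seq I)
    (R : I -> T -> Prop) :
  uniq s ->
  (forall i, i \in s -> exists2 x, A x & R i x) ->
  (forall x, A x -> exists2 i, i \in s & R i x) ->
  (forall i j x, i \in s -> j \in s -> R i x -> R j x -> i = j) ->
  (forall i x y, R i x -> R i y -> x = y) ->
  A #= `I_(size s).
Proof.
move=> us ex1 ex2 inj fun_.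
case: s us ex1 ex2 inj => [|i0 s'] us ex1 ex2 inj.
  suff -> : A = set0 by rewrite II0; exact: card_eq00.
  by rewrite -subset0 => x /ex2 [].
set s := i0 :: s' in us ex1 ex2 inj *.
have [g gP] : exists g : nat -> T, forall n, (n < size s)%N ->
    A (g n) /\ R (nth i0 s n) (g n).
  suff /boolp.choice [g gP] : forall n, exists x,
    (n < size s)%N -> A x /\ R (nth i0 s n) x by exists g.
  move=> n; have [x0 _ _] := ex1 i0 (mem_head _ _).
  case: (ltnP n (size s)) => [lt_n|_]; last by exists x0.
  by have [x Ax Rx] := ex1 _ (mem_nth i0 lt_n); exists x.
have -> : A = g @` `I_(size s).
  apply/seteqP; split=> [x /[dup] Ax /ex2 [i si Rx]|_ [n /= lt_n <-]].
    have lt_i : (index i s < size s)%N by rewrite index_mem.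
    exists (index i s) => //.
    have [_] := gP _ lt_i.
    by rewrite nth_index // => /fun_; apply.
  by have [] := gP n lt_n.
apply: inj_card_eq => m n /set_mem lt_m /set_mem lt_n eg.
rewrite -[_ m]/(is_true (m < size s)%N) in lt_m.
rewrite -[_ n]/(is_true (n < size s)%N) in lt_n.
have [_ Rm] := gP m lt_m; have [_ Rn] := gP n lt_n.
apply/eqP; rewrite -(nth_uniq i0 lt_m lt_n us); apply/eqP.
by apply: inj Rm _; rewrite ?mem_nth // eg.
Qed.

Lemma card_eq_II_fun (T : Type) (A : set T) n :
  A #= `I_n -> exists2 f : 'I_n -> T, forall i, A (f i) & injective f.
Proof.
move=> /card_eq_trans /(_ card_II) /card_esym /card_bijP [f /bij_inj f_inj].
exists (fun i => val (f (SigSub (mem_setT i)))) => [i|i j /val_inj /f_inj []//].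
by apply: set_mem; exact: valP.
Qed.

(** * Projective points through arbitrary spanning vectors *)

Section Span.
Variables (K : fieldType) (V : vectType K).

(** Points and curves are handled through arbitrary generators and equations, via [spans] and
    [defines], so the choice made by [proj_rep] never matters. Counting arguments accordingly use
    relations in place of functions. *)
Definition spans (v : V) (U : proj V) : Prop :=
  exists2 c, c != 0 & proj_rep U = c *: v.

Lemma proj_rep_neq0 (U : proj V) : proj_rep U != 0.
Proof. by case: U => U dU; rewrite /proj_rep vpick0 -dimv_eq0 /= (eqP dU). Qed.

Lemma val_proj (U : proj V) : val U = <[proj_rep U]>%VS.
Proof.
apply/eqP; rewrite eq_sym eqEdim dim_vline proj_rep_neq0.
rewrite -memvE memv_pick /=; case: U => U dU /=; by rewrite (eqP dU).
Qed.

Lemma spans_rep (U : proj V) : spans (proj_rep U) U.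
Proof. by exists 1; rewrite ?oner_eq0 ?scale1r. Qed.

Lemma spans_neq0 v U : spans v U -> v != 0.
Proof.
case=> c _ E; apply: contraNneq (proj_rep_neq0 U) => v0.
by rewrite E v0 scaler0.
Qed.

Lemma spans_val v U : spans v U -> val U = <[v]>%VS.
Proof.
move=> sv; have v0 := spans_neq0 sv; case: sv => c c0 E.
rewrite val_proj; apply/eqP; rewrite eqEdim !dim_vline proj_rep_neq0 v0 leqnn.
by rewrite andbT E -memvE memvZ // memv_line.
Qed.

Lemma spans_uniq v (U U' : proj V) : spans v U -> spans v U' -> U = U'.
Proof. by move=> /spans_val E /spans_val E'; apply: val_inj; rewrite E E'. Qed.

Lemma spans_proj_of v (v0 : v != 0) : spans v (proj_of v0).
Proof.
have : proj_rep (proj_of v0) \in <[v]>%VS by rewrite /proj_rep memv_pick.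
case/vlineP=> c E; exists c => //.
by apply: contraNneq (proj_rep_neq0 (proj_of v0)) => c0; rewrite E c0 scale0r.
Qed.

Lemma spans_exists v : v != 0 -> exists U, spans v U.
Proof.
by move=> v0; exists (proj_of v0); exact: spans_proj_of.
Qed.

Lemma spansZ c v U : c != 0 -> spans (c *: v) U <-> spans v U.
Proof.
move=> c0; split=> -[d d0 E].
  by exists (d * c); rewrite ?mulf_neq0 // -scalerA.
by exists (d / c); rewrite ?mulf_neq0 ?invr_eq0 // scalerA divfK.
Qed.

Lemma spans_scale v w U : spans v U -> spans w U -> exists2 c, c != 0 & w = c *: v.
Proof.
move=> [c c0 E] [d d0]; rewrite E => /(congr1 (fun x => d^-1 *: x)).
rewrite !scalerA mulVf // scale1r => <-.
by exists (d^-1 * c); rewrite ?mulf_neq0 ?invr_eq0.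
Qed.

End Span.

(** * Linear and quadratic forms in three variables *)

Section Forms.
Variable k : fieldType.
Implicit Types (v w : 'rV[k]_3) (P : Defs.point k).

Definition eval (F : {mpoly k[3]}) v : k := F.@[fun i => v 0 i].

Lemma eval_homogZ d F c v : F \is d.-homog -> eval F (c *: v) = c ^+ d * eval F v.
Proof.
move=> /dhomogP hF; rewrite /eval !mevalE mulr_sumr; apply: eq_big_seq => m mF.
have <- : mdeg m = d := hF m mF.
rewrite mulrCA; congr (_ * _); rewrite mdegE -prodrXr -big_split /=.
by apply: eq_bigr => i _; rewrite mxE exprMn.
Qed.

Definition defines d (F : {mpoly k[3]}) (C : curve k d) : Prop :=
  exists2 c, c != 0 & equation C = c *: F.

Lemma equation_homog d (C : curve k d) : equation C \is d.-homog.
Proof. exact: (valP (proj_rep C)). Qed.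

Lemma defines_homog d F (C : curve k d) : defines F C -> F \is d.-homog.
Proof.
case=> c c0 E; have := equation_homog C; rewrite E => /(dhomogZ c^-1).
by rewrite scalerA mulVf // scale1r.
Qed.

Lemma definesP d F (hF : F \is d.-homog) (C : curve k d) :
  defines F C <-> spans (DHomog hF) C.
Proof.
split=> -[c c0 E]; exists c => //; first exact: val_inj.
by rewrite /equation E.
Qed.

Lemma defines_equation d (C : curve k d) : defines (equation C) C.
Proof. by exists 1; rewrite ?oner_eq0 ?scale1r. Qed.

Lemma defines_uniq d F (C C' : curve k d) : defines F C -> defines F C' -> C = C'.
Proof.
move=> h h'; have hF := defines_homog h.
by apply: (@spans_uniq _ _ (DHomog hF)); apply/definesP.
Qed.

Lemma defines_exists d F :
  F \is d.-homog -> F != 0 -> exists C : curve k d, defines F C.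
Proof.
move=> hF F0; have /spans_exists [C /definesP] : DHomog hF != 0.
  by apply: contraNneq F0 => /(congr1 val) /= ->.
by exists C.
Qed.

Lemma definesZ d c F (C : curve k d) : c != 0 -> defines (c *: F) C <-> defines F C.
Proof.
move=> c0; split=> -[e e0 E].
  by exists (e * c); rewrite ?mulf_neq0 // -scalerA.
by exists (e / c); rewrite ?mulf_neq0 ?invr_eq0 // scalerA divfK.
Qed.

Lemma defines_scale d F G (C : curve k d) :
  defines F C -> defines G C -> exists2 c, c != 0 & G = c *: F.
Proof.
move=> [c c0 E] [e e0]; rewrite E => /(congr1 (fun x => e^-1 *: x)).
rewrite !scalerA mulVf // scale1r => <-.
by exists (e^-1 * c); rewrite ?mulf_neq0 ?invr_eq0.
Qed.

Lemma defines_neq0 d F (C : curve k d) : defines F C -> F != 0.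
Proof.
move=> [c c0 E]; have := proj_rep_neq0 C; apply: contraNneq => F0.
by apply/eqP/val_inj; rewrite /= -[LHS]/(equation C) E F0 scaler0.
Qed.

(** Homogeneity makes the vanishing independent of the spanning vector, although the value is
    not. *)
Lemma value_eq0 d F v P : F \is d.-homog -> spans v P ->
  (value F P == 0) = (eval F v == 0).
Proof.
move=> hF [c c0 E]; rewrite /value -/(eval F (proj_rep P)) E (eval_homogZ _ _ hF).
by rewrite mulf_eq0 expf_eq0 (negPf c0) andbF.
Qed.

Lemma points_eval d F (C : curve k d) v P : defines F C -> spans v P ->
  points C P <-> eval F v = 0.
Proof.
move=> hF hP; rewrite /points /=.
have E := value_eq0 (equation_homog C) hP.
have {}E : (value (equation C) P == 0) = (eval F v == 0).
  by rewrite E; case: hF => c c0 ->; rewrite /eval mevalZ mulf_eq0 (negPf c0).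
by split=> /eqP; rewrite ?E => /eqP // /eqP; rewrite -?E => /eqP.
Qed.

Definition linear_form (d : 'cV[k]_3) : {mpoly k[3]} := \sum_i d i 0 *: 'X_i.

Definition quadratic_form (S : 'M[k]_3) : {mpoly k[3]} :=
  \sum_i \sum_j S i j *: ('X_i * 'X_j).

Lemma linear_form_homog d : linear_form d \is 1.-homog.
Proof. by apply: rpred_sum => i _; apply: dhomogZ; rewrite dhomogX /= mdeg1. Qed.

Lemma eval_linear d v : eval (linear_form d) v = (v *m d) 0 0.
Proof.
rewrite /eval /linear_form raddf_sum mxE; apply: eq_bigr => i _ /=.
by rewrite mevalZ mevalXU mulrC.
Qed.

Lemma eval_quadratic S v : eval (quadratic_form S) v = (v *m S *m v^T) 0 0.
Proof.
rewrite /eval /quadratic_form raddf_sum mxE /=.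
transitivity (\sum_i \sum_j S i j * (v 0 i * v 0 j)).
  apply: eq_bigr => i _; rewrite raddf_sum; apply: eq_bigr => j _ /=.
  by rewrite mevalZ mevalM !mevalXU.
rewrite exchange_big /=; apply: eq_bigr => j _.
rewrite mxE [v^T _ _]mxE mulr_suml; apply: eq_bigr => i _ /=.
by rewrite mulrA [S i j * _]mulrC.
Qed.

Lemma linear_formD d e : linear_form (d + e) = linear_form d + linear_form e.
Proof. by rewrite -big_split; apply: eq_bigr => i _; rewrite mxE scalerDl. Qed.

Lemma linear_formZ c d : linear_form (c *: d) = c *: linear_form d.
Proof. by rewrite scaler_sumr; apply: eq_bigr => i _; rewrite mxE scalerA. Qed.

Lemma linear_form0 : linear_form 0 = 0.
Proof. by rewrite -(scale0r 0) linear_formZ scale0r. Qed.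

Lemma linear_form_delta i : linear_form (delta_mx i 0) = 'X_i.
Proof.
rewrite /linear_form (bigD1 i) //= big1 => [|j ji].
  by rewrite mxE !eqxx scale1r addr0.
by rewrite mxE (negPf ji) scale0r.
Qed.

Lemma linear_form_eq0 d : (linear_form d == 0) = (d == 0).
Proof.
apply/eqP/eqP => [h|->]; last exact: linear_form0.
apply/colP => i; have := eval_linear d (delta_mx 0 i).
by rewrite h /eval meval0 -rowE !mxE => <-.
Qed.

Lemma quadratic_formD S T :
  quadratic_form (S + T) = quadratic_form S + quadratic_form T.
Proof.
rewrite -big_split; apply: eq_bigr => i _ /=; rewrite -big_split.
by apply: eq_bigr => j _; rewrite mxE scalerDl.
Qed.

Lemma quadratic_formZ c S : quadratic_form (c *: S) = c *: quadratic_form S.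
Proof.
rewrite scaler_sumr; apply: eq_bigr => i _; rewrite scaler_sumr.
by apply: eq_bigr => j _; rewrite mxE scalerA.
Qed.

Lemma quadratic_form_tr S : quadratic_form S^T = quadratic_form S.
Proof.
rewrite /quadratic_form exchange_big; apply: eq_bigr => i _; apply: eq_bigr => j _.
by rewrite mxE [_ * 'X_i]mulrC.
Qed.

Lemma quadratic_form_delta i j : quadratic_form (delta_mx i j) = 'X_i * 'X_j.
Proof.
rewrite /quadratic_form (bigD1 i) //= [X in _ + X]big1 ?addr0 => [|l li]; last first.
  by rewrite big1 // => j' _; rewrite mxE (negPf li) scale0r.
rewrite (bigD1 j) //= big1 ?addr0 => [|l lj].
  by rewrite mxE !eqxx scale1r.
by rewrite mxE (negPf lj) andbF scale0r.
Qed.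

Lemma homog1_linear_form F : F \is 1.-homog -> exists d, F = linear_form d.
Proof.
move=> /dhomogP hF; rewrite [F]mpolyE big_seq.
elim/big_ind: _ => [|_ _ [d ->] [e ->]|m /hF hm].
- by exists 0; rewrite linear_form0.
- by exists (d + e); rewrite linear_formD.
have /mdeg1P [i /eqP ->] : mdeg m == 1%N by rewrite hm.
by exists (F@_U_(i) *: delta_mx i 0); rewrite linear_formZ linear_form_delta.
Qed.

Lemma homog2_quadratic_form F : 2%:R != 0 :> k -> F \is 2.-homog ->
  exists2 S, S^T = S & F = quadratic_form S.
Proof.
move=> two_neq0 /dhomogP hF.
suff [S FS] : exists S, F = quadratic_form S.
  (* Averaging with the transpose does not change the form; this uses that 2 is invertible. *)
  exists (2%:R^-1 *: (S + S^T)).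
    by rewrite linearZ /= raddfD /= trmxK addrC.
  rewrite quadratic_formZ quadratic_formD quadratic_form_tr -FS -mulr2n.
  by rewrite -scaler_nat scalerA mulVf // scale1r.
rewrite [F]mpolyE big_seq.
elim/big_ind: _ => [|_ _ [d ->] [e ->]|m /hF].
- by exists 0; have := quadratic_formZ 0 0; rewrite !scale0r.
- by exists (d + e); rewrite quadratic_formD.
rewrite -[_ m]/(mdeg m) => hm.
have [i mi] : exists i, (U_(i) <= m)%MM.
  have : m != 0%MM by rewrite -mdeg_eq0 hm.
  move=> m0; have /existsP [i mi] : [exists i, (0 < m i)%N].
    apply: contraNT m0; rewrite negb_exists => /forallP h.
    by apply/eqP/mnmP => i; rewrite mnm0E; have := h i; rewrite lt0n negbK => /eqP.
  by exists i; rewrite lep1mP -lt0n.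
have /mdeg1P [j /eqP mj] : mdeg (m - U_(i))%MM == 1%N.
  by have := mdegD (m - U_(i))%MM U_(i)%MM; rewrite (submK mi) hm mdeg1 addn1 => -[<-].
exists (F@_m *: delta_mx j i); rewrite quadratic_formZ quadratic_form_delta.
by rewrite -mpolyXD -mj submK.
Qed.

End Forms.

(** * Intersection multiplicities *)

Lemma mpolyC_homog n (R : nzRingType) (c : R) : c%:MP_[n] \is 0.-homog.
Proof. by rewrite -[c%:MP]mulr1 mul_mpolyC; apply: dhomogZ; exact: dhomog1. Qed.

Section LocalRing.
(* The fraction field enters through an abstract morphism [tf]: unification in
   the concrete quotient {fraction {mpoly k[3]}} does not terminate in
   reasonable time. *)
Variables (k K : fieldType) (tf : {rmorphism {mpoly k[3]} -> K}).
Hypothesis tf_neq0 : forall b, b != 0 -> tf b != 0.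
Variable P : Defs.point k.

Definition local_fractions : set K :=
  [set h | exists d (a b : {mpoly k[3]}),
     [/\ a \is d.-homog, b \is d.-homog, value b P != 0 & h = tf a / tf b]].

Definition ideal_fractions (E F : {mpoly k[3]}) : set K :=
  [set h | exists e (u v b : {mpoly k[3]}), let a := u * E + v * F in
     [/\ a \is e.-homog, b \is e.-homog, value b P != 0 & h = tf a / tf b]].

Definition quotient_basis (E F : {mpoly k[3]}) m : Prop :=
  exists2 e : 'I_m -> K, forall i, local_fractions (e i) &
    forall h, local_fractions h -> exists! c : 'rV[k]_m,
      ideal_fractions E F (h - \sum_(i < m) tf (c 0 i)%:MP * e i).

Lemma valueM (a b : {mpoly k[3]}) : value (a * b) P = value a P * value b P.
Proof. exact: mevalM. Qed.

Lemma value_neq0_tf b : value b P != 0 -> tf b != 0.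
Proof.
by move=> b0; apply: tf_neq0; apply: contraNneq b0 => ->; rewrite /value meval0.
Qed.

Definition const_frac : k -> K := tf \o @mpolyC 3 k.
HB.instance Definition _ := GRing.RMorphism.on const_frac.

Lemma local_ring_frac d a b : a \is d.-homog -> b \is d.-homog -> value b P != 0 ->
  local_fractions (tf a / tf b).
Proof. by move=> ha hb b0; exists d, a, b. Qed.

Lemma local_ring_const c : local_fractions (const_frac c).
Proof.
exists 0%N, c%:MP, 1; split; last by rewrite rmorph1 divr1.
- exact: mpolyC_homog.
- exact: dhomog1.
- by rewrite /value meval1 oner_eq0.
Qed.

Lemma local_ringM g h : local_fractions g -> local_fractions h -> local_fractions (g * h).
Proof.
move=> [d [a [b [ha hb b0 ->]]]] [e [a' [b' [ha' hb' b'0 ->]]]].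
exists (d + e)%N, (a * a'), (b * b'); split.
- exact: dhomogM.
- exact: dhomogM.
- by rewrite valueM mulf_neq0.
by rewrite !rmorphM /= mulf_div.
Qed.

Lemma local_ring1 : local_fractions 1.
Proof. by rewrite -(rmorph1 const_frac); exact: local_ring_const. Qed.

Lemma local_ringN h : local_fractions h -> local_fractions (- h).
Proof.
move=> hR; rewrite -mulN1r -(rmorphN1 const_frac).
by apply: local_ringM => //; exact: local_ring_const.
Qed.

Section Ideal.
Variables E F : {mpoly k[3]}.
Local Notation I := (ideal_fractions E F).

Lemma local_idealD g h : I g -> I h -> I (g + h).
Proof.
move=> [e [u [v [b [ha hb b0 ->]]]]] [e' [u' [v' [b' [ha' hb' b'0 ->]]]]].
exists (e + e')%N, (u * b' + u' * b), (v * b' + v' * b), (b * b').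
set a := u * _ + _ in ha *; set a' := u' * _ + _ in ha' *.
have aE : (u * b' + u' * b) * E + (v * b' + v' * b) * F =
    a * b' + a' * b.
  by rewrite /a /a' !mulrDl addrACA !(mulrAC _ b') !(mulrAC _ b).
rewrite /= aE; clearbody a a'; split.
- by rewrite rpredD // ?[a' * b]mulrC dhomogM.
- exact: dhomogM.
- by rewrite valueM mulf_neq0.
by rewrite rmorphD !rmorphM /= addf_div ?value_neq0_tf.
Qed.

Lemma local_idealMl g h : local_fractions g -> I h -> I (g * h).
Proof.
move=> [f [a [c [ha hc c0 ->]]]] [e [u [v [b [hu hb b0 ->]]]]].
exists (f + e)%N, (a * u), (a * v), (c * b).
have -> : a * u * E + a * v * F =
    a * (u * E + v * F) by rewrite mulrDr !mulrA.
split.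
- exact: dhomogM.
- exact: dhomogM.
- by rewrite valueM mulf_neq0.
by rewrite !rmorphM /= mulf_div.
Qed.

Lemma local_idealMr g h : local_fractions g -> I h -> I (h * g).
Proof. by move=> gR hI; rewrite mulrC; exact: local_idealMl. Qed.

Lemma local_ideal0 : I 0.
Proof.
exists 0%N, 0, 0, 1; rewrite !mul0r addr0; split.
- exact: dhomog0.
- exact: dhomog1.
- by rewrite /value meval1 oner_eq0.
- by rewrite rmorph0 mul0r.
Qed.

Lemma local_idealN h : I h -> I (- h).
Proof.
by move=> hI; rewrite -mulN1r; apply: local_idealMl => //; apply: local_ringN; exact: local_ring1.
Qed.

Lemma local_idealB g h : I g -> I h -> I (g - h).
Proof. by move=> gI hI; apply: local_idealD => //; exact: local_idealN. Qed.

Lemma local_ideal_sum (T : Type) (r : seq T) (Q : pred T) (f : T -> K) :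
  (forall i, Q i -> I (f i)) -> I (\sum_(i <- r | Q i) f i).
Proof.
move=> hf; apply: (big_ind I) => //; first exact: local_ideal0.
exact: local_idealD.
Qed.

Lemma local_ideal_gen d (l : {mpoly k[3]}) :
  E \is d.-homog -> l \is d.-homog -> value l P != 0 -> I (tf E / tf l).
Proof.
by move=> hE hl l0; exists d, 1, 0, l; rewrite mul0r mul1r addr0.
Qed.

End Ideal.

Lemma ideal_fractionsC E F : ideal_fractions E F = ideal_fractions F E.
Proof.
by apply/seteqP; split=> h [e [u [v [b]]]] /= H; exists e, v, u, b => /=; rewrite addrC.
Qed.

(** Invariance of dimension, carried out modulo the ideal: expressing each basis in the other gives
    matrices whose product is the identity, and the rank bounds the size. *)
Lemma quotient_basis_leq E F m n :
  quotient_basis E F m -> quotient_basis E F n -> (m <= n)%N.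
Proof.
move=> [e eR eP] [e' e'R e'P].
have /boolp.choice [A AP] : forall j, exists c : 'rV[k]_m,
    ideal_fractions E F (e' j - \sum_(i < m) const_frac (c 0 i) * e i).
  by move=> j; have [c [cP _]] := eP _ (e'R j); exists c.
have /boolp.choice [B BP] : forall j, exists c : 'rV[k]_n,
    ideal_fractions E F (e j - \sum_(i < n) const_frac (c 0 i) * e' i).
  by move=> j; have [c [cP _]] := e'P _ (eR j); exists c.
pose MA := \matrix_(j < n, i < m) A j 0 i; pose MB := \matrix_(j < m, i < n) B j 0 i.
(* Row [i] of the product and the [i]-th unit row are both coordinates of [e i]; uniqueness
   identifies them. *)
have BA1 : MB *m MA = 1%:M.
  apply/row_matrixP => i; have [c [_ c_uniq]] := eP _ (eR i).
  have c1 : c = row i 1%:M.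
    apply: c_uniq; rewrite (bigD1 i) //= big1 => [|j ji].
      by rewrite !mxE eqxx mpolyC1 rmorph1 mul1r addr0 subrr; exact: local_ideal0.
    by rewrite !mxE eq_sym (negPf ji) mpolyC0 rmorph0 mul0r.
  rewrite -{}c1; apply/esym/c_uniq.
  have -> : \sum_(j < m) tf ((row i (MB *m MA)) 0 j)%:MP * e j =
      \sum_(l < n) const_frac (B i 0 l) * \sum_(j < m) const_frac (A l 0 j) * e j.
    under [RHS]eq_bigr do rewrite mulr_sumr.
    rewrite exchange_big /=; apply: eq_bigr => j _.
    rewrite 2!mxE -[tf _]/(const_frac _) rmorph_sum mulr_suml /=.
    by apply: eq_bigr => l _; rewrite !mxE rmorphM mulrA.
  set f := \sum_(l < n) _.
  have -> : e i - f = (e i - \sum_(l < n) const_frac (B i 0 l) * e' l) +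
      (\sum_(l < n) const_frac (B i 0 l) * e' l - f) by rewrite addrA subrK.
  apply: local_idealD (BP i) _.
  rewrite /f -sumrB; apply: local_ideal_sum => l _; rewrite -mulrBr.
  by apply: local_idealMl (AP l); exact: local_ring_const.
have := mulmx1_min_rank (M := MB) (A := MA) (N := 1%:M).
rewrite mulmx1 => /(_ BA1) /leq_trans; apply; exact: rank_leq_row.
Qed.

End LocalRing.

Section IntersectionMult.
Variables (k : fieldType) (d d' : nat) (C : curve k d) (C' : curve k d').
Variable P : Defs.point k.

Lemma intersection_mult_sym m :
  intersection_mult C C' P m -> intersection_mult C' C P m.
Proof.
have eqI : local_ideal C C' P = local_ideal C' C P := ideal_fractionsC _ _ _ _.
by rewrite /intersection_mult eqI.
Qed.

Lemma intersection_mult_uniq m n :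
  intersection_mult C C' P m -> intersection_mult C C' P n -> m = n.
Proof.
have tf0 (b : {mpoly k[3]}) : b != 0 -> tofrac b != 0 by rewrite tofrac_eq0.
move=> hm hn; apply/eqP; rewrite eqn_leq.
by rewrite (quotient_basis_leq tf0 hm hn) (quotient_basis_leq tf0 hn hm).
Qed.

End IntersectionMult.

Lemma frac_add (F : fieldType) (a b c l m : F) : b != 0 -> l != 0 ->
  a / b * (m / l) + c = (a * m + c * (b * l)) / (b * l).
Proof. by move=> b0 l0; rewrite mulrDl mulfK ?mulf_neq0 // mulf_div. Qed.

Lemma ideal_mul_sub (R : comNzRingType) (f g f' g' : R) :
  f * g - f' * g' = f * (g - g') + (f - f') * g'.
Proof. by rewrite mulrBr mulrBl addrA subrK. Qed.

Lemma frac_sub (F : fieldType) (a b l h x y : F) : a = b * h ->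
  y * h - x = (a / l - x) - (b / l - y) * h.
Proof. by move=> ->; ring. Qed.

Lemma frac_split (F : fieldType) (a b h t u : F) : b != 0 -> a - t * b = u ->
  h - t = b^-1 * ((b * h - a) + u).
Proof.
by move=> b0 <-; rewrite addrA subrK [t * b]mulrC -mulrBr mulKf.
Qed.

Section Parametrized.
Variables (k K : fieldType) (tf : {rmorphism {mpoly k[3]} -> K}).
Hypothesis tf_inj : injective tf.
Variables (P : Defs.point k) (E F : {mpoly k[3]}) (d : nat).
Hypothesis F_homog : F \is d.-homog.
Local Notation I := (ideal_fractions tf P E F).
Local Notation R := (local_fractions tf P).
Local Notation const_frac := (const_frac tf).
Variables (l0 l1 : {mpoly k[3]}) (psi : 'I_3 -> {poly k}).
(** [along] is the pullback to the parametrised curve t -> [psi] t, and [tau] is a function on the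
    plane whose pullback is the parameter t; [at_tau] goes back from polynomials in t to functions
    near [P]. *)
Let along : {mpoly k[3]} -> {poly k} := mmap (@polyC k) psi.
Let tau : K := tf l1 / tf l0.
Let at_tau : {poly k} -> K := fun p => (map_poly const_frac p).[tau].

Hypothesis l0_homog : l0 \is 1.-homog.
Hypothesis l1_homog : l1 \is 1.-homog.
Hypothesis along_l0 : along l0 = 1.
Hypothesis along_l1 : along l1 = 'X.
Hypothesis along_E : along E = 0.
Hypothesis psi0 : spans (\row_i (psi i).[0]) P.
Hypothesis psi_tau : forall i, I (tf 'X_i / tf l0 - at_tau (psi i)).

HB.instance Definition _ := GRing.RMorphism.on along.
HB.instance Definition _ := GRing.RMorphism.copy at_tau
  (horner_eval tau \o map_poly const_frac).

Let tf_neq0 b : b != 0 -> tf b != 0.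
Proof. by move=> b0; rewrite -(rmorph0 tf) (inj_eq tf_inj). Qed.

Let along0 b : (along b).[0] = eval b (\row_i (psi i).[0]).
Proof.
rewrite /along /mmap /eval mevalE horner_sum; apply: eq_bigr => m _.
rewrite hornerM hornerC horner_prod; congr (_ * _); apply: eq_bigr => i _.
by rewrite horner_exp mxE.
Qed.

Let value_along b e : b \is e.-homog -> (value b P != 0) = ((along b).[0] != 0).
Proof. by move=> hb; rewrite (value_eq0 hb psi0) along0. Qed.

Let l0_neq0 : value l0 P != 0.
Proof. by rewrite (value_along l0_homog) along_l0 hornerC oner_eq0. Qed.

Let tf_l0_neq0 : tf l0 != 0 :> K.
Proof. exact: (value_neq0_tf tf_neq0 l0_neq0). Qed.

(** A polynomial in [tau] is a fraction of forms whose pullbacks have ratio [p]. An identity in the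
    fraction field can thus be cleared of denominators and read on the curve. *)
Let at_tau_frac p : exists e a b, [/\ a \is e.-homog, b \is e.-homog,
  value b P != 0, at_tau p = tf a / tf b & along a = p * along b].
Proof.
elim/poly_ind: p => [|p c [e [a [b [ha hb b0 pE ab]]]]].
  exists 0%N, 0, 1; split; rewrite ?dhomog0 ?dhomog1 //.
  - by rewrite /value meval1 oner_eq0.
  - by rewrite rmorph0 rmorph0 mul0r.
  - by rewrite rmorph0 mul0r.
exists (e + 1)%N, (a * l1 + c *: (b * l0)), (b * l0); split.
- by rewrite rpredD ?dhomogM // dhomogZ ?dhomogM.
- exact: dhomogM.
- by rewrite valueM mulf_neq0.
- have b0' := value_neq0_tf tf_neq0 b0.
  rewrite rmorphD rmorphM /= pE /at_tau map_polyX map_polyC hornerX hornerC /=.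
  rewrite -mul_mpolyC rmorphD !rmorphM.
  rewrite -[tf _%:MP]/(const_frac c) /tau.
  move: (const_frac c) => x.
  exact: (@frac_add K _ _ _ _ _ b0' tf_l0_neq0).
rewrite rmorphD !rmorphM /= along_l0 along_l1 mulr1 ab -mul_mpolyC rmorphM rmorphM /=.
by rewrite along_l0 mulr1 /along mmapC mulrDl -!mulrA [along b * 'X]mulrC.
Qed.

Let at_tau_ring p : R (at_tau p).
Proof.
have [e [a [b [ha hb b0 -> _]]]] := at_tau_frac p; exact: (@local_ring_frac _ _ tf P _ _ _ ha hb b0).
Qed.

Let at_tau_unit p : p.[0] != 0 -> at_tau p != 0 /\ R (at_tau p)^-1.
Proof.
have [e [a [b [ha hb b0 -> ab]]]] := at_tau_frac p => p0.
have a0 : value a P != 0.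
  by rewrite (value_along ha) ab hornerM mulf_neq0 // -(value_along hb).
have [ta tb] := (value_neq0_tf tf_neq0 a0, value_neq0_tf tf_neq0 b0).
split; first by rewrite mulf_neq0 ?invr_eq0.
by rewrite invf_div; exact: (@local_ring_frac _ _ tf P _ _ _ hb ha a0).
Qed.

Let ratio i : R (tf 'X_i / tf l0).
Proof.
by apply: (@local_ring_frac _ _ tf P 1) => //; rewrite dhomogX /= mdeg1.
Qed.

Let congM (f g f' g' : K) : R f -> R g' ->
  I (f - f') -> I (g - g') -> I (f * g - f' * g').
Proof.
move=> fR gR ff gg.
rewrite ideal_mul_sub.
by apply: (local_idealD tf_neq0); [exact: local_idealMl | exact: local_idealMr].
Qed.

(** Modulo the ideal each coordinate ratio may be replaced by its parametrisation at [tau]; this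
    passes to monomials by multiplicativity and then to forms by linearity. *)
Let homog_tau a e : a \is e.-homog ->
  I (tf a / tf (l0 ^+ e) - at_tau (along a)).
Proof.
move=> /dhomogP ha.
rewrite {1}(mpolyE a) /along /mmap !rmorph_sum /= mulr_suml -sumrB big_seq.
apply: (local_ideal_sum tf_neq0) => m ma; have dm : mdeg m = e := ha m ma.
rewrite -mul_mpolyC rmorphM /= -[tf _%:MP]/(const_frac _) -mulrA rmorphM /=.
rewrite {1}/at_tau map_polyC hornerC /= -mulrBr.
apply: local_idealMl; first exact: local_ring_const.
have -> : tf 'X_[m] / tf (l0 ^+ e) =
    \prod_i (tf 'X_i / tf l0 : K) ^+ m i.
  rewrite mpolyXE_id rmorph_prod -dm mdegE rmorphXn /= -prodrXr -prodf_div.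
  by apply: eq_bigr => i _; rewrite rmorphXn expr_div_n.
rewrite /mmap1 rmorph_prod /=.
pose S (x y : K) := [/\ R x, R y & I (x - y)].
have SM x1 x2 y1 y2 : S x1 x2 -> S y1 y2 -> S (x1 * y1) (x2 * y2).
  by move=> [? ? ?] [? ? ?]; split; [exact: local_ringM|exact: local_ringM|exact: congM].
have S1 : S 1 1.
  by split; [exact: local_ring1|exact: local_ring1|rewrite subrr; exact: local_ideal0].
suff [] : S (\prod_i (tf 'X_i / tf l0 : K) ^+ m i)
  (\prod_i at_tau (psi i ^+ m i)) by [].
apply: (big_ind2 S) => // i _; rewrite rmorphXn /=.
elim: (m i) => [|n IH]; first by rewrite !expr0.
by rewrite !exprS; apply: SM => //; split=> //; exact: ratio.
Qed.

(** The multiplicity is the order of vanishing at 0 of the pullback of [F]: the basis is 1, [tau],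
    ..., [tau]^(n-1). Independence is tested by pulling back to the curve, and generation by
    division modulo ['X^n]. *)
Lemma quotient_basis_param n g :
  along F = 'X^n * g -> g.[0] != 0 -> quotient_basis tf P E F n.
Proof.
move=> FE g0.
have l0X e : value (l0 ^+ e) P != 0.
  by rewrite /value rmorphXn expf_neq0.
have l0H e : l0 ^+ e \is e.-homog.
  by have := dhomogMn e l0_homog; rewrite mul1n.
have tauE : at_tau 'X = tau by rewrite /at_tau map_polyX hornerX.
have tau_n : I (at_tau 'X^n).
  have [ug Rg] := at_tau_unit g0.
  (* Modulo the ideal, this is [F] divided by a power of [l0], and [F] is a generator. The unit [g]
     is then cancelled. *)
  have h : I (at_tau (along F)).
    have := homog_tau (F_homog); set x := (X in X - _) => h.
    have xI : I x.
      by rewrite ideal_fractionsC; apply: local_ideal_gen F_homog _ _.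
    by rewrite -[at_tau _](subKr x); apply: (local_idealB tf_neq0).
  rewrite -[at_tau _](mulfK ug); apply: local_idealMr => //.
  by move: h; rewrite FE rmorphM.
have bnz b e : b \is e.-homog -> value b P != 0 -> coprimep 'X^n (along b).
  move=> hb; rewrite (value_along hb) coprimep_sym => b0.
  by apply: coprimep_expr; rewrite coprimepX.
(* Pulling back kills the multiples of [E], so ['X^n] divides [p] times factors that do not vanish
   at 0; the size bound leaves only [p = 0]. *)
have small (p : {poly k}) : (size p <= n)%N -> I (at_tau p) -> p = 0.
  move=> pn [e [u [v [b [hN hb b0]]]]].
  have [e' [a' [b' [ha' hb' b'0 -> a'E]]]] := at_tau_frac p.
  have [tb tb'] := (value_neq0_tf tf_neq0 b0, value_neq0_tf tf_neq0 b'0).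
  move/eqP; rewrite eqr_div // -!rmorphM => /eqP /tf_inj /(congr1 along).
  rewrite !rmorphM rmorphD !rmorphM /= along_E mulr0 add0r FE a'E => pE.
  have : 'X^n %| p * (along b' * along b).
    by rewrite mulrA pE [_ * ('X^n * _)]mulrCA -mulrA dvdp_mulr.
  rewrite Gauss_dvdpl ?coprimepMr ?(bnz _ _ hb b0) ?(bnz _ _ hb' b'0) //.
  by apply: contraTeq => p0; rewrite gtNdvdp // size_polyXn ltnS.
have at_tau_poly (c : 'rV[k]_n) :
    \sum_(i < n) tf (c 0 i)%:MP * at_tau 'X^i = at_tau (rVpoly c).
  rewrite /rVpoly poly_def rmorph_sum; apply: eq_bigr => i _.
  by rewrite -mul_polyC rmorphM /= [in RHS]/at_tau map_polyC hornerC valK.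
exists (fun i => at_tau 'X^i) => [i|h [e [a [b [ha hb b0 hE]]]]]; first exact: at_tau_ring.
have hR : R h by rewrite hE; exact: (@local_ring_frac _ _ tf P _ _ _ ha hb b0).
have qb0 : (along b).[0] != 0 by rewrite -(value_along hb).
have [ub Rb] := at_tau_unit qb0.
have hab : I (at_tau (along b) * h - at_tau (along a)).
  have ab : tf a = tf b * h.
    by rewrite hE mulrC divfK // (value_neq0_tf tf_neq0 b0).
  rewrite (frac_sub (tf (l0 ^+ e)) _ _ ab).
  apply: (local_idealB tf_neq0); first exact: homog_tau.
  by apply: local_idealMr => //; exact: homog_tau.
(* The denominator is invertible modulo ['X^n], so the quotient of the pullbacks has a
   representative of size at most [n]. *)
have [r rn [s rE]] : exists2 r : {poly k}, (size r <= n)%N &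
    exists s, along a - r * along b = 'X^n * s.
  have : coprimep (along b) 'X^n.
    by apply: coprimep_expr; rewrite coprimepX.
  case/Bezout_eq1_coprimepP=> -[u v] /= uv.
  exists ((along a * u) %% 'X^n).
    by rewrite -ltnS; have := ltn_modp (along a * u) 'X^n; rewrite -size_poly_eq0 size_polyXn => ->.
  exists (along a * v + ((along a * u) %/ 'X^n) * along b).
  have -> : (along a * u) %% 'X^n = along a * u - (along a * u) %/ 'X^n * 'X^n.
    by rewrite {2}(divp_eq (along a * u) 'X^n) addrC addKr.
  by rewrite -[X in X - _]mulr1 -{1}uv; ring.
have hr : I (h - at_tau r).
  have aE : at_tau (along a) - at_tau r * at_tau (along b) = at_tau 'X^n * at_tau s.
    by rewrite -!rmorphM -rE rmorphB /= rmorphM.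
  rewrite (frac_split h ub aE).
  apply: local_idealMl => //; apply: (local_idealD tf_neq0) => //.
  by apply: local_idealMr.
exists (poly_rV r); split; first by rewrite at_tau_poly poly_rV_K.
move=> c; rewrite at_tau_poly => hc; rewrite -[RHS]rVpolyK; congr poly_rV.
apply/eqP; rewrite -subr_eq0; apply/eqP/small.
  by rewrite (leq_trans (size_polyD _ _)) // size_polyN geq_max rn size_poly.
have -> : at_tau (r - rVpoly c) = (h - at_tau (rVpoly c)) - (h - at_tau r).
  by rewrite rmorphB opprB [RHS]addrC addrA subrK.
exact: (local_idealB tf_neq0).
Qed.

End Parametrized.

(** * Coordinates, substitution and frames *)

Definition o0 : 'I_3 := @Ordinal 3 0 isT.
Definition o1 : 'I_3 := @Ordinal 3 1 isT.
Definition o2 : 'I_3 := @Ordinal 3 2 isT.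

Lemma sum3E (V : nmodType) (f : 'I_3 -> V) : \sum_i f i = f o0 + f o1 + f o2.
Proof.
rewrite !big_ord_recl big_ord0 addr0 addrA.
by congr (f _ + f _ + f _); apply: val_inj.
Qed.

Lemma ord3_ind (Q : 'I_3 -> Prop) : Q o0 -> Q o1 -> Q o2 -> forall i, Q i.
Proof.
move=> q0 q1 q2 [[|[|[|//]]] lt_i].
- by rewrite (_ : Ordinal _ = o0) //; apply: val_inj.
- by rewrite (_ : Ordinal _ = o1) //; apply: val_inj.
- by rewrite (_ : Ordinal _ = o2) //; apply: val_inj.
Qed.

Definition mx3 (R : nzSemiRingType) (rows : seq (seq R)) : 'M[R]_3 :=
  \matrix_(i, j) (nth [::] rows i)`_j.

Definition row3 (R : nzSemiRingType) (s : seq R) : 'rV[R]_3 := \row_i s`_i.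

Definition frob (A : nzSemiRingType) m n (M : 'M[A]_(m, n)) : 'M[A]_(m, n) :=
  map_mx (fun x => x ^+ 5) M.

Definition hermitian_form (k : fieldType) (H : 'M[k]_3) : {mpoly k[3]} :=
  \sum_i \sum_j H i j *: ('X_i ^+ 5 * 'X_j).

Section Substitution.
Variables (k : fieldType) (A : comNzRingType) (f : {rmorphism k -> A}).
Implicit Type v : 'rV[A]_3.

(** Values may lie in any target of [f]: in [k] this is evaluation, in [{poly k}] restriction to a
    parametrised curve, and at the tuple of variables it returns the form itself. *)
Definition subst v (F : {mpoly k[3]}) : A := mmap f (fun i => v 0 i) F.
Lemma subst_is_zmod_morphism v : zmod_morphism (subst v).
Proof. exact: mmapB. Qed.

Lemma subst_is_monoid_morphism v : monoid_morphism (subst v).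
Proof. by have [? ?] := mmap_is_multiplicative (v 0) f; split. Qed.

HB.instance Definition _ v :=
  GRing.isZmodMorphism.Build {mpoly k[3]} A (subst v) (subst_is_zmod_morphism v).
HB.instance Definition _ v :=
  GRing.isMonoidMorphism.Build {mpoly k[3]} A (subst v) (subst_is_monoid_morphism v).

Lemma substZ v c F : subst v (c *: F) = f c * subst v F.
Proof. exact: mmapZ. Qed.

Lemma substX v i : subst v 'X_i = v 0 i.
Proof. by rewrite /subst mmapX mmap1U. Qed.

Lemma subst_linear v d : subst v (linear_form d) = (v *m map_mx f d) 0 0.
Proof.
rewrite rmorph_sum mxE; apply: eq_bigr => i _ /=.
by rewrite substZ substX mxE mulrC.
Qed.

Lemma subst_quadratic v S :
  subst v (quadratic_form S) = (v *m map_mx f S *m v^T) 0 0.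
Proof.
rewrite rmorph_sum mxE /=.
under eq_bigr do rewrite rmorph_sum.
rewrite exchange_big; apply: eq_bigr => j _ /=.
rewrite mxE [v^T _ _]mxE mulr_suml; apply: eq_bigr => i _ /=.
by rewrite substZ rmorphM /= !substX mxE mulrA [f _ * _]mulrC.
Qed.

Lemma subst_hermitian v H :
  subst v (hermitian_form H) = (frob v *m map_mx f H *m v^T) 0 0.
Proof.
rewrite rmorph_sum mxE /=.
under eq_bigr do rewrite rmorph_sum.
rewrite exchange_big; apply: eq_bigr => j _ /=.
rewrite mxE [v^T _ _]mxE mulr_suml; apply: eq_bigr => i _ /=.
by rewrite substZ rmorphM rmorphXn /= !substX !mxE mulrA [f _ * _]mulrC.
Qed.

End Substitution.

Section Frames.
Variable k : fieldType.

Lemma subst_id (F : {mpoly k[3]}) : subst (@mpolyC 3 k) (\row_i 'X_i) F = F.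
Proof.
rewrite -[RHS]comp_mpoly_id /comp_mpoly /subst /mmap; apply: eq_bigr => m _.
by congr (_ * _); apply: mmap1_eq => i; rewrite mxE tnth_mktuple.
Qed.

Lemma quadratic_form_congr (B S : 'M[k]_3) : quadratic_form (B *m S *m B^T) =
  \sum_a \sum_b S a b *: (linear_form (col a B) * linear_form (col b B)).
Proof.
rewrite -[LHS]subst_id subst_quadratic !map_mxM -matrix.map_trmx !mulmxA -mulmxA -trmx_mul.
set y := _ *m map_mx _ B.
have yE a : y 0 a = linear_form (col a B).
  rewrite -[RHS]subst_id subst_linear /y !mxE.
  by apply: eq_bigr => i _; rewrite !mxE.
rewrite mxE exchange_big; apply: eq_bigr => b _ /=.
rewrite mxE [y^T _ _]mxE mulr_suml; apply: eq_bigr => a _.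
by rewrite [map_mx _ S a b]mxE -!yE -mul_mpolyC mulrA [_ * y 0 a]mulrC.
Qed.

Variable N : 'M[k]_3.
Hypothesis N_unit : N \in unitmx.

Definition frame_form (j : 'I_3) : {mpoly k[3]} := linear_form (col j (invmx N)).

(** The conic serves for total tangency, the line for tangents at Weierstrass points. Each passes
    through the first row of [N] at parameter 0 of [param], so one multiplicity computation covers
    both. *)
Definition frame_curve (conic : bool) : {mpoly k[3]} :=
  if conic then frame_form o1 ^+ 2 - frame_form o0 * frame_form o2
  else frame_form o2.

Definition param (conic : bool) : 'rV[{poly k}]_3 :=
  row3 [:: 1; 'X; if conic then 'X^2 else 0].

Lemma frame_formX i : 'X_i = \sum_j N j i *: frame_form j.
Proof.
rewrite -linear_form_delta /frame_form.
under eq_bigr do rewrite -linear_formZ.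
rewrite -(big_morph _ (@linear_formD k) (@linear_form0 k)); congr linear_form.
apply/colP => r; have := congr1 (fun A : 'M_3 => A r i) (mulVmx N_unit).
rewrite !mxE summxE eqxx andbT => <-.
by apply: eq_bigr => j _; rewrite !mxE mulrC.
Qed.

Lemma subst_frame_form (A : comNzRingType) (f : {rmorphism k -> A}) v j :
  subst f (v *m map_mx f N) (frame_form j) = v 0 j.
Proof.
rewrite /frame_form colE subst_linear -mulmxA -map_mxM mulmxA mulmxV // mul1mx.
by rewrite map_delta_mx -colE mxE.
Qed.

Lemma frame_form_homog j : frame_form j \is 1.-homog.
Proof. exact: linear_form_homog. Qed.

Lemma frame_curve_homog b : frame_curve b \is (if b then 2 else 1)%N.-homog.
Proof.
have h := frame_form_homog; case: b => //=; rewrite rpredB //.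
  exact: (dhomogMn 2 (h o1)).
exact: (dhomogM (h o0) (h o2)).
Qed.

Lemma subst_frame_curve b : subst (@polyC k) (param b *m map_mx (@polyC k) N) (frame_curve b) = 0.
Proof.
case: b => /=; last by rewrite subst_frame_form mxE.
by rewrite rmorphB rmorphXn rmorphM /= !subst_frame_form !mxE mul1r subrr.
Qed.

Section Mult.
Variables (K : fieldType) (tf : {rmorphism {mpoly k[3]} -> K}).
Hypothesis tf_inj : injective tf.
Variables (P : Defs.point k) (E F G : {mpoly k[3]}) (d : nat) (b : bool).
Variables c c' : k.
Hypotheses (c0 : c != 0) (c'0 : c' != 0).
Hypotheses (EE : E = c *: frame_curve b) (FE : F = c' *: G).
Hypothesis F_homog : F \is d.-homog.
Hypothesis NP : spans (row o0 N) P.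

Lemma frame_quotient_basis n g :
  subst (@polyC k) (param b *m map_mx (@polyC k) N) G = 'X^n * g -> g.[0] != 0 ->
  quotient_basis tf P E F n.
Proof.
move=> GE g0.
have l0_neq0 : value (frame_form o0) P != 0.
  rewrite (value_eq0 (frame_form_homog o0) NP) /frame_form colE eval_linear.
  by rewrite mulmxA -row_mul mulmxV // -colE !mxE oner_eq0.
have u0 : tf (frame_form o0) != 0.
  rewrite -(rmorph0 tf) (inj_eq tf_inj).
  by apply: contraNneq l0_neq0 => ->; rewrite /value meval0.
have eqI h : ideal_fractions tf P (frame_curve b) F h -> ideal_fractions tf P E F h.
  move=> [e [u [v [q [ha hq q0 ->]]]]]; exists e, (c^-1 *: u), v, q.
  by rewrite EE -scalerAl -scalerAr scalerA mulVf // scale1r.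
pose psi i := (param b *m map_mx (@polyC k) N) 0 i.
have along_form j : mmap (@polyC k) psi (frame_form j) = param b 0 j.
  exact: subst_frame_form.
apply: (@quotient_basis_param _ _ _ tf_inj P E F _ F_homog _ _ psi
  (frame_form_homog o0) (frame_form_homog o1) _ _ _ _ _ n (c'%:P * g)).
- by rewrite along_form mxE.
- by rewrite along_form mxE.
- by rewrite EE mmapZ -/(subst _ _ _) subst_frame_curve mulr0.
- suff -> : \row_i (psi i).[0] = row o0 N by [].
  apply/rowP => i; rewrite mxE /psi mxE sum3E !mxE /= mul1r !hornerE.
  by case: (b); rewrite ?hornerXn ?hornerC ?expr0n /= !mul0r !addr0.
- move=> i /=.
  (* Only the third frame coordinate can differ from its parametrisation, and that difference is, up
     to sign, the equation of the curve over a power of the first coordinate. *)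
  have -> : tf 'X_i / tf (frame_form o0) -
      (map_poly (const_frac tf) (psi i)).[tf (frame_form o1) / tf (frame_form o0)] = const_frac tf (N o2 i) *
      (tf (frame_form o2) / tf (frame_form o0) -
       (if b then (tf (frame_form o1) / tf (frame_form o0)) ^+ 2 else 0)).
    rewrite frame_formX /psi mxE !sum3E !mxE /= mul1r.
    rewrite -!mul_mpolyC !rmorphD !rmorphM /= !map_polyC /= map_polyX !hornerE.
    rewrite -![tf _%:MP]/(const_frac tf _).
    case: (b) => /=; rewrite ?rmorph0 ?map_polyXn ?hornerE ?hornerXn.
      by field.
    by field.
  apply: local_idealMl; first exact: local_ring_const.
  apply: eqI; rewrite /frame_curve; case: (b).
    have -> : tf (frame_form o2) / tf (frame_form o0) -
        (tf (frame_form o1) / tf (frame_form o0)) ^+ 2 =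
        - (tf (frame_curve true) / tf (frame_form o0 ^+ 2)).
      by rewrite rmorphB !rmorphXn rmorphM /=; field.
    apply: local_idealN; apply: local_ideal_gen (frame_curve_homog true) _ _.
      exact: (dhomogMn 2 (frame_form_homog o0)).
    by rewrite /value rmorphXn expf_neq0.
  rewrite subr0.
  exact: (local_ideal_gen tf _ (frame_form_homog o2) (frame_form_homog o0) l0_neq0).
- by rewrite FE mmapZ -/(subst _ _ _) GE mulrCA.
- by rewrite hornerM hornerC mulf_neq0.
Qed.

End Mult.

Lemma frame_intersection_mult d d' (C : curve k d) (C' : curve k d') P G b n g :
  defines (frame_curve b) C -> defines G C' -> spans (row o0 N) P ->
  subst (@polyC k) (param b *m map_mx (@polyC k) N) G = 'X^n * g -> g.[0] != 0 ->
  intersection_mult C C' P n.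
Proof.
move=> [c c0 CE] [c' c'0 C'E] NP GE g0.
pose tf : {rmorphism {mpoly k[3]} -> {fraction {mpoly k[3]}}} := @tofrac {mpoly k[3]}.
have tf_inj : injective tf by move=> p q /eqP; rewrite tofrac_eq => /eqP.
exact: (frame_quotient_basis tf_inj c0 c'0 CE C'E (equation_homog C') NP GE g0).
Qed.

End Frames.

(** * Cross products and Hermitian forms *)

Ltac by_coords :=
  apply/matrixP; elim/ord3_ind; elim/ord3_ind; rewrite !(mxE, sum3E) /=.

Lemma row3P (T : Type) (u v : 'rV[T]_3) :
  u 0 o0 = v 0 o0 -> u 0 o1 = v 0 o1 -> u 0 o2 = v 0 o2 -> u = v.
Proof. by move=> h0 h1 h2; apply/rowP; elim/ord3_ind. Qed.

Section Cross.
Variable k : fieldType.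
Implicit Types u v w : 'rV[k]_3.

Definition cross u v : 'rV[k]_3 :=
  row3 [:: u 0 o1 * v 0 o2 - u 0 o2 * v 0 o1; u 0 o2 * v 0 o0 - u 0 o0 * v 0 o2;
           u 0 o0 * v 0 o1 - u 0 o1 * v 0 o0].

Lemma row3_neq0 u : u != 0 -> exists i, u 0 i != 0.
Proof.
move=> u0; apply/existsP; apply: contraNT u0; rewrite negb_exists => /forallP h.
by apply/eqP/rowP => i; rewrite mxE; have := h i; rewrite negbK => /eqP.
Qed.

Lemma crossZr c u v : cross u (c *: v) = c *: cross u v.
Proof. by apply: row3P; rewrite !mxE /=; ring. Qed.

Lemma crossC u v : cross v u = - cross u v.
Proof. by apply: row3P; rewrite !mxE /=; ring. Qed.

Lemma cross_self u : cross u u = 0.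
Proof. by apply: row3P; rewrite !mxE /=; ring. Qed.

Lemma cross_eq0 u v : u != 0 -> cross u v = 0 -> exists c, v = c *: u.
Proof.
move=> /row3_neq0 [i ui] uv.
have e0 : u 0 o1 * v 0 o2 = u 0 o2 * v 0 o1.
  by have /rowP /(_ o0) := uv; rewrite !mxE /= => /subr0_eq.
have e1 : u 0 o2 * v 0 o0 = u 0 o0 * v 0 o2.
  by have /rowP /(_ o1) := uv; rewrite !mxE /= => /subr0_eq.
have e2 : u 0 o0 * v 0 o1 = u 0 o1 * v 0 o0.
  by have /rowP /(_ o2) := uv; rewrite !mxE /= => /subr0_eq.
have key j : u 0 i * v 0 j = u 0 j * v 0 i.
  by move: i j {ui}; elim/ord3_ind; elim/ord3_ind; rewrite ?e0 ?e1 ?e2.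
exists (v 0 i / u 0 i); apply/rowP => j; rewrite !mxE; apply: (mulfI ui).
by rewrite key; field.
Qed.

Lemma dot_cross_l u v : u *m (cross u v)^T = 0.
Proof.
by apply/matrixP => i j; rewrite !mxE sum3E !mxE !ord1 /=; ring.
Qed.

Lemma dot_cross_r u v : v *m (cross u v)^T = 0.
Proof.
by apply/matrixP => i j; rewrite !mxE sum3E !mxE !ord1 /=; ring.
Qed.

(** The triple product expansion writes [cross (cross u v) d^T] in terms of the two products assumed
    to vanish. *)
Lemma orthogonal_cross u v (d : 'cV[k]_3) :
  cross u v != 0 -> u *m d = 0 -> v *m d = 0 -> exists c, d = c *: (cross u v)^T.
Proof.
move=> uv ud vd.
have [|c dE] := @cross_eq0 _ d^T uv.
  have E (w : 'rV[k]_3) : w *m d = 0 ->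
      w 0 o0 * d o0 0 + w 0 o1 * d o1 0 + w 0 o2 * d o2 0 = 0.
    by move/matrixP/(_ 0 0); rewrite !mxE sum3E.
  have [eu ev] := (E _ ud, E _ vd).
  have triple i : cross (cross u v) d^T 0 i =
      v 0 i * (u 0 o0 * d o0 0 + u 0 o1 * d o1 0 + u 0 o2 * d o2 0) -
      u 0 i * (v 0 o0 * d o0 0 + v 0 o1 * d o1 0 + v 0 o2 * d o2 0).
    by move: i; elim/ord3_ind; rewrite !mxE /=; ring.
  by apply/rowP => i; rewrite triple eu ev !mulr0 subr0 mxE.
by exists c; rewrite -[d]trmxK dE linearZ.
Qed.

(* Complete u, v by a basis vector on which their cross product is nonzero. *)
Lemma cross_basis u v : cross u v != 0 ->
  exists2 D : 'M[k]_3, D \in unitmx & row o0 D = u /\ row o1 D = v.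
Proof.
move=> uv; have [i ci] := row3_neq0 uv.
pose D := \matrix_(a, b) (if a == o0 then u 0 b else if a == o1 then v 0 b else (b == i)%:R).
exists D; last by split; apply/rowP => j; rewrite !mxE.
rewrite -row_free_unit; apply: inj_row_free => x xD.
have xDj j : x 0 o0 * u 0 j + x 0 o1 * v 0 j + x 0 o2 * (j == i)%:R = 0.
  by have /rowP /(_ j) := xD; rewrite !mxE sum3E !mxE.
have cross_dot0 : \sum_j cross u v 0 j * u 0 j = 0.
  by rewrite sum3E !mxE /=; ring.
have cross_dot1 : \sum_j cross u v 0 j * v 0 j = 0.
  by rewrite sum3E !mxE /=; ring.
have x2 : x 0 o2 = 0.
  have : \sum_j cross u v 0 j *
      (x 0 o0 * u 0 j + x 0 o1 * v 0 j + x 0 o2 * (j == i)%:R) = 0.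
    by rewrite big1 // => j _; rewrite xDj mulr0.
  under eq_bigr do rewrite !mulrDr ![_ * (x 0 _ * _)]mulrCA.
  rewrite !big_split -!mulr_sumr /= cross_dot0 cross_dot1 !mulr0 !add0r.
  rewrite (bigD1 i) //= big1 => [|j ji]; last by rewrite (negPf ji) mulr0.
  by rewrite eqxx mulr1 addr0 => /eqP; rewrite mulf_eq0 (negPf ci) orbF => /eqP.
have x1 : x 0 o1 = 0.
  have : cross u (x 0 o0 *: u + x 0 o1 *: v) 0 i = 0.
    suff -> : x 0 o0 *: u + x 0 o1 *: v = 0.
      by move: (i); elim/ord3_ind; rewrite !mxE /= !mulr0 subrr.
    by apply/rowP => j; have := xDj j; rewrite x2 mul0r addr0 !mxE.
  have -> : cross u (x 0 o0 *: u + x 0 o1 *: v) = x 0 o1 *: cross u v.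
    by apply: row3P; rewrite !mxE /=; ring.
  by rewrite mxE => /eqP; rewrite mulf_eq0 (negPf ci) orbF => /eqP.
have [j uj] : exists j, u 0 j != 0.
  apply: row3_neq0; apply: contraNneq uv => ->.
  by apply/eqP; apply: row3P; rewrite !mxE /= !mul0r subrr.
have x0 : x 0 o0 = 0.
  have := xDj j; rewrite x1 x2 !mul0r !addr0 => /eqP.
  by rewrite mulf_eq0 (negPf uj) orbF => /eqP.
by apply: row3P; rewrite ?x0 ?x1 ?x2 mxE.
Qed.

End Cross.

Section CharFive.
Variable k : fieldType.
Hypothesis char5 : 5%N \in [pchar k].

(** Stated over a general target [A] because matrices of polynomials occur as well; [f] transports
    the characteristic. *)
Lemma frobM (A : comNzRingType) (f : {rmorphism k -> A}) m n p
    (M : 'M[A]_(m, n)) (N : 'M[A]_(n, p)) :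
  frob (M *m N) = frob M *m frob N.
Proof.
have char5A := rmorph_pchar f char5.
have frobE m' n' (X : 'M[A]_(m', n')) : frob X = map_mx (pFrobenius_aut char5A) X.
  by apply/matrixP => i j; rewrite !mxE.
by rewrite !frobE map_mxM.
Qed.

Lemma natr5 : 5%:R = 0 :> k.
Proof. exact: pcharf0. Qed.

Lemma two_neq0 : 2%:R != 0 :> k.
Proof. by rewrite -(dvdn_pcharf char5). Qed.

Lemma frobZ m n (c : k) (M : 'M[k]_(m, n)) : frob (c *: M) = c ^+ 5 *: frob M.
Proof. by apply/matrixP => i j; rewrite !mxE exprMn. Qed.

Lemma frob_tr m n (M : 'M[k]_(m, n)) : frob M^T = (frob M)^T.
Proof. by apply/matrixP => i j; rewrite !mxE. Qed.

Lemma frob_unit (M : 'M[k]_3) : (frob M \in unitmx) = (M \in unitmx).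
Proof.
have frobE : frob M = map_mx (pFrobenius_aut char5) M.
  by apply/matrixP => i j; rewrite !mxE.
by rewrite frobE map_unitmx.
Qed.

(** Fifth powers are additive, so composing the Fermat form with [A] gives the Hermitian form of
    matrix [(frob A)^T *m A]. *)
Lemma hermitian_curveP (C : curve k 6) : hermitian_curve C ->
  exists2 H : 'M[k]_3, H \in unitmx & defines (hermitian_form H) C.
Proof.
move=> [A Au [c c0 CE]].
have [e e0 FE] : defines (fermat_form k) (fermat k).
  by apply/(definesP (fermat_form_homog k)); exact: spans_proj_of.
exists ((frob A)^T *m A); first by rewrite unitmx_mul unitmx_tr frob_unit Au.
exists (c * e); rewrite ?mulf_neq0 //.
rewrite CE FE comp_mpolyZ scalerA; congr (_ *: _).
have char5X := rmorph_pchar (@mpolyC 3 k) char5.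
pose t i := \sum_(j < 3) A i j *: ('X_j : {mpoly k[3]}).
have tX i : t i ^+ 5 = \sum_j A i j ^+ 5 *: 'X_j ^+ 5.
  rewrite -[t i ^+ 5]/(pFrobenius_aut char5X (t i)) rmorph_sum; apply: eq_bigr => j _.
  by rewrite -[LHS]/((A i j *: 'X_j) ^+ 5) exprZn.
rewrite /fermat_form rmorph_sum.
transitivity (\sum_i t i ^+ 5 * t i).
  apply: eq_bigr => i _; rewrite rmorphXn /= comp_mpolyXU -exprSr.
  by rewrite -tnth_nth tnth_mktuple.
under eq_bigr do rewrite tX mulr_suml.
rewrite exchange_big; apply: eq_bigr => m _ /=.
under eq_bigr do rewrite mulr_sumr.
rewrite exchange_big; apply: eq_bigr => j _ /=.
rewrite mxE scaler_suml; apply: eq_bigr => i _.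
by rewrite -scalerAl -scalerAr scalerA !mxE.
Qed.

End CharFive.

(** * Frames of conics *)

Section Derivatives.
Variable k : fieldType.

Lemma mderivXU (i j : 'I_3) : ('X_j : {mpoly k[3]})^`M(i) = (j == i)%:R.
Proof.
rewrite mderivX mnm1E; case: eqP => [->|_]; last by rewrite scale0r.
by rewrite -{1}[U_(i)%MM]add0m addmK scale1r mpolyX0.
Qed.

Lemma mderiv_quadratic (S : 'M[k]_3) i : S^T = S ->
  (quadratic_form S)^`M(i) = 2%:R *: linear_form (col i S).
Proof.
move=> symS; have symE a b : S a b = S b a by rewrite -{1}symS mxE.
rewrite /quadratic_form raddf_sum /=.
transitivity (\sum_a \sum_b (S a b *: ((a == i)%:R * 'X_b : {mpoly k[3]}) +
    S a b *: ('X_a * (b == i)%:R))).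
  apply: eq_bigr => a _; rewrite raddf_sum; apply: eq_bigr => b _ /=.
  by rewrite mderivZ mderivM !mderivXU scalerDr.
under eq_bigr do rewrite big_split /=.
rewrite big_split /= scaler_nat mulr2n /linear_form; congr (_ + _).
  rewrite exchange_big; apply: eq_bigr => b _ /=.
  rewrite (bigD1 i) //= big1 ?eqxx ?mul1r ?addr0 => [|a ai].
    by rewrite mxE symE.
  by rewrite (negPf ai) mul0r scaler0.
apply: eq_bigr => a _; rewrite (bigD1 i) //= big1 ?eqxx ?mulr1 ?addr0 => [|b bi].
  by rewrite mxE.
by rewrite (negPf bi) mulr0 scaler0.
Qed.

(** Fifth powers have zero derivative. The formula gives the coordinates of the tangent line at
    [v]. *)
Lemma mderiv_hermitian (char5 : 5%N \in [pchar k]) (H : 'M[k]_3) i v :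
  eval ((hermitian_form H)^`M(i)) v = (frob v *m H) 0 i.
Proof.
rewrite /hermitian_form raddf_sum /= /eval raddf_sum mxE /=; apply: eq_bigr => a _.
have char5X := rmorph_pchar (@mpolyC 3 k) char5.
have X5 : ('X_a ^+ 5 : {mpoly k[3]})^`M(i) = 0.
  rewrite !exprS expr0 mulr1 !mderivM mderivXU.
  have five0 : 5%:R = 0 :> {mpoly k[3]} by exact: pcharf0 char5X.
  transitivity (5%:R * ('X_a ^+ 4 * (a == i)%:R : {mpoly k[3]})); first by ring.
  by rewrite five0 mul0r.
have -> : (\sum_b H a b *: ('X_a ^+ 5 * 'X_b : {mpoly k[3]}))^`M(i) = H a i *: 'X_a ^+ 5.
  rewrite raddf_sum (bigD1 i) //= big1 ?addr0 => [|b bi].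
    by rewrite mderivZ mderivM X5 mul0r add0r mderivXU eqxx mulr1.
  by rewrite mderivZ mderivM X5 mul0r add0r mderivXU (negPf bi) mulr0 scaler0.
by rewrite mevalZ rmorphXn /= mevalXU mxE mulrC.
Qed.

End Derivatives.

Lemma mul_tr_row (R : comNzRingType) m n (u : 'rV[R]_n) (D : 'M[R]_(m, n)) j :
  (u *m (row j D)^T) 0 0 = (u *m D^T) 0 j.
Proof. by rewrite tr_row colE mulmxA -colE mxE. Qed.

Section ConicFrames.
Variable k : fieldType.
Hypothesis two_neq0 : 2%:R != 0 :> k.

(** The symmetric matrix of y^2 - x z. *)
Definition conic_mx : 'M[k]_3 :=
  mx3 [:: [:: 0; 0; - 2%:R^-1]; [:: 0; 1; 0]; [:: - 2%:R^-1; 0; 0]].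

Definition dual_conic_mx : 'M[k]_3 :=
  mx3 [:: [:: 0; 0; - 2%:R]; [:: 0; 1; 0]; [:: - 2%:R; 0; 0]].

Lemma conic_mx_dual : conic_mx *m dual_conic_mx = 1%:M.
Proof. by_coords; try ring; by field. Qed.

Lemma frame_curve_quadratic N :
  frame_curve N true = quadratic_form (invmx N *m conic_mx *m (invmx N)^T).
Proof.
rewrite quadratic_form_congr !sum3E /frame_curve !mxE /= !scale0r !add0r !addr0 scale1r.
rewrite -!/(frame_form N _).
rewrite [frame_form N o2 * _]mulrC addrAC -scalerDl -opprD.
have -> : 2%:R^-1 + 2%:R^-1 = 1 :> k by field.
by rewrite scaleN1r addrC expr2.
Qed.

(** The matrix of the conic of a frame and [A^T *m dual_conic_mx *m A] are inverse to each other.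
    Testing proportionality on the dual side avoids [invmx], which suits the computations over
    F_25. *)
Lemma frame_curve_dual A B c : A \in unitmx -> B \in unitmx -> c != 0 ->
  A^T *m dual_conic_mx *m A = c *: (B^T *m dual_conic_mx *m B) ->
  frame_curve B true = c *: frame_curve A true.
Proof.
move=> Au Bu c0 AB; rewrite !frame_curve_quadratic -quadratic_formZ; congr quadratic_form.
have inv_l N : N \in unitmx ->
    (invmx N *m conic_mx *m (invmx N)^T) *m (N^T *m dual_conic_mx *m N) = 1%:M.
  move=> Nu; rewrite !mulmxA -[_ *m (invmx N)^T *m _]mulmxA -trmx_mul mulmxV //.
  by rewrite trmx1 mulmx1 -[_ *m conic_mx *m _]mulmxA conic_mx_dual mulmx1 mulVmx.
set X := invmx A *m _ *m _; set Y := invmx B *m _ *m _.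
have XA := inv_l A Au; have /mulmx1C YB := inv_l B Bu.
rewrite -/X AB -scalemxAr -/Y in XA YB *.
by rewrite -[LHS]mul1mx -XA -scalemxAl -(mulmxA X) YB mulmx1.
Qed.

(** The two points become the end rows and the pole of their chord the middle row; scaling one end
    makes the Gram matrix of the conic proportional to [conic_mx]. *)
Lemma nonsingular_conic_frame (Q : curve k 2) P1 P2 : nonsingular Q ->
  points Q P1 -> points Q P2 -> P1 <> P2 ->
  exists N, [/\ N \in unitmx, defines (frame_curve N true) Q,
                spans (row o0 N) P1 & spans (row o2 N) P2].
Proof.
move=> nsQ QP1 QP2 P12.
have [S symS QE] := homog2_quadratic_form two_neq0 (equation_homog Q).
have defQ : defines (quadratic_form S) Q by rewrite -QE; exact: defines_equation.
have Su : S \in unitmx.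
  rewrite -row_free_unit; apply: inj_row_free => v vS; apply/eqP.
  apply: contraT => /spans_exists [P vP].
  have : points Q P by apply/(points_eval defQ vP); rewrite eval_quadratic vS mul0mx mxE.
  case/nsQ=> i; case; case: (vP) => c c0 Pv.
  rewrite /value -/(eval _ (proj_rep P)) QE mderiv_quadratic // /eval mevalZ -/(eval _ _).
  by rewrite eval_linear Pv -scalemxAl colE mulmxA vS mul0mx !mxE mulr0 mulr0.
pose p1 : 'rV[k]_3 := proj_rep P1; pose p2 : 'rV[k]_3 := proj_rep P2.
pose bil (u v : 'rV[k]_3) := (u *m S *m v^T) 0 0.
have bilC u v : bil u v = bil v u.
  rewrite /bil -[u *m S *m v^T]trmxK [in LHS]mxE !trmx_mul trmxK symS.
  by rewrite mulmxA.
have q1 : bil p1 p1 = 0.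
  by have /(points_eval defQ (spans_rep P1)) := QP1; rewrite eval_quadratic.
have q2 : bil p2 p2 = 0.
  by have /(points_eval defQ (spans_rep P2)) := QP2; rewrite eval_quadratic.
have c12 : cross p1 p2 != 0.
  apply/eqP => /(cross_eq0 (proj_rep_neq0 P1)) [c p2E]; apply: P12.
  apply: (@spans_uniq _ _ p1); first exact: spans_rep.
  have c0 : c != 0.
    by apply: contraNneq (proj_rep_neq0 P2) => c0; rewrite -/p2 p2E c0 scale0r.
  by apply/(spansZ _ _ c0); rewrite -p2E; exact: spans_rep.
have [D Du [D1 D2]] := cross_basis c12.
pose w0 := row o2 D.
have gram N i j : (N *m S *m N^T) i j = bil (row i N) (row j N).
  by rewrite /bil mul_tr_row -!row_mul [RHS]mxE.
have SDu : S *m D^T \in unitmx by rewrite unitmx_mul Su unitmx_tr.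
(* Otherwise the nondegenerate form would vanish on the plane spanned by [p1] and [p2], which is
   impossible in dimension 3. *)
have b0 : bil p1 p2 != 0.
  apply/eqP => b0; pose G := D *m S *m D^T.
  have Gu : G \in unitmx by rewrite /G -mulmxA unitmx_mul Du SDu.
  have G00 : G o0 o0 = 0 by rewrite /G gram D1.
  have G01 : G o0 o1 = 0 by rewrite /G gram D1 D2.
  have G10 : G o1 o0 = 0 by rewrite /G gram D1 D2 bilC.
  have G11 : G o1 o1 = 0 by rewrite /G gram D2.
  have kerG x : x *m G = 0 -> x = 0.
    by move=> xG; rewrite -[x]mulmx1 -(mulmxV Gu) mulmxA xG mul0mx.
  clearbody G.
  have G02 : G o0 o2 = 0.
    have /kerG /rowP /(_ o1) : row3 [:: G o1 o2; - G o0 o2; 0] *m G = 0.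
      by apply: row3P; rewrite !(mxE, sum3E) /= ?G00 ?G01 ?G10 ?G11; ring.
    by rewrite !mxE /= => /eqP; rewrite oppr_eq0 => /eqP.
  have /kerG /rowP /(_ o0) : row3 [:: 1; 0; 0] *m G = 0.
    by apply: row3P; rewrite !(mxE, sum3E) /= ?G00 ?G01 ?G02; ring.
  by rewrite !mxE => /eqP; rewrite oner_eq0.
have bilD u v x : bil (u + v) x = bil u x + bil v x.
  by rewrite /bil !mulmxDl mxE.
have bilZ c u x : bil (c *: u) x = c * bil u x.
  by rewrite /bil -!scalemxAl mxE.
(* The pole of the chord, obtained by removing from [w0] its components along the hyperbolic pair
   [p1], [p2]. *)
have [w wE] : exists w, w =
    w0 + (- (bil w0 p2 / bil p1 p2)) *: p1 + (- (bil w0 p1 / bil p1 p2)) *: p2.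
  by eexists.
have wp1 : bil w p1 = 0.
  by rewrite wE !bilD !bilZ q1 [bil p2 p1]bilC; field.
have wp2 : bil w p2 = 0.
  by rewrite wE !bilD !bilZ q2; field.
have q0 : bil w w != 0.
  apply/eqP => q0.
  have ww0 : bil w w0 = 0.
    have -> : w0 = w + (bil w0 p2 / bil p1 p2) *: p1 + (bil w0 p1 / bil p1 p2) *: p2.
      by rewrite wE; apply/rowP => j; rewrite !mxE; ring.
    by rewrite (bilC w) !bilD !bilZ (bilC p1 w) (bilC p2 w) q0 wp1 wp2 !mulr0 !addr0.
  have wSD : w *m (S *m D^T) = 0.
    apply/rowP => j; rewrite mulmxA.
    have -> : (w *m S *m D^T) 0 j = bil w (row j D).
      by rewrite /bil mul_tr_row.
    by move: j; elim/ord3_ind; rewrite ?D1 ?D2 mxE.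
  have w_eq0 : w = 0.
    by rewrite -[w]mulmx1 -(mulmxV SDu) mulmxA wSD mul0mx.
  pose x := row3 [:: - (bil w0 p2 / bil p1 p2); - (bil w0 p1 / bil p1 p2); 1].
  have xD : x *m D = 0.
    have D1E j : D o0 j = p1 0 j by rewrite -D1 mxE.
    have D2E j : D o1 j = p2 0 j by rewrite -D2 mxE.
    rewrite -[RHS]w_eq0 wE; apply/rowP => j.
    by rewrite !(mxE, sum3E) /= D1E D2E; ring.
  have /rowP /(_ o2) : x = 0.
    by rewrite -[x]mulmx1 -(mulmxV Du) mulmxA xD mul0mx.
  by rewrite !mxE /= => /eqP; rewrite oner_eq0.
(* Chosen so that [p1] and [lam *: p2] pair to - [bil w w] / 2, the corner entry required by
   [conic_mx]. *)
pose lam := - bil w w / (2%:R * bil p1 p2).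
pose N := \matrix_(i, j) (if i == o0 then p1 0 j else if i == o1 then w 0 j else lam * p2 0 j).
have N0 : row o0 N = p1 by apply/rowP => j; rewrite !mxE.
have N1 : row o1 N = w by apply/rowP => j; rewrite !mxE.
have N2 : row o2 N = lam *: p2 by apply/rowP => j; rewrite !mxE.
have NSN : N *m S *m N^T = bil w w *: conic_mx.
  apply/matrixP; elim/ord3_ind; elim/ord3_ind; rewrite gram ?N0 ?N1 ?N2 !mxE /=.
  - by rewrite q1 mulr0.
  - by rewrite bilC wp1 mulr0.
  - by rewrite bilC bilZ [bil p2 p1]bilC /lam; field; rewrite two_neq0.
  - by rewrite wp1 mulr0.
  - by rewrite mulr1.
  - by rewrite bilC bilZ bilC wp2 !mulr0.
  - by rewrite bilZ [bil p2 p1]bilC /lam; field; rewrite two_neq0.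
  - by rewrite bilZ bilC wp2 !mulr0.
  - by rewrite bilZ bilC bilZ q2 !mulr0.
have conic_u : conic_mx \in unitmx by have [] := mulmx1_unit conic_mx_dual.
have Nu : N \in unitmx.
  have : N *m S *m N^T \in unitmx by rewrite NSN unitmxZ ?unitfE.
  by rewrite -mulmxA unitmx_mul => /andP [].
exists N; split=> //; last first.
- rewrite N2; apply/spansZ; last exact: spans_rep.
  by rewrite /lam mulf_neq0 ?oppr_eq0 ?invr_eq0 ?mulf_neq0.
- by rewrite N0; exact: spans_rep.
apply/(definesZ _ _ q0); rewrite frame_curve_quadratic -quadratic_formZ.
rewrite scalemxAl scalemxAr -NSN trmx_inv !mulmxA mulVmx // mul1mx -mulmxA mulmxV ?unitmx_tr //.
by rewrite mulmx1.
Qed.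

End ConicFrames.

(** Induction on the size, splitting off one double root at a time; constants have square roots in a
    closed field. The exactness [q.[z] != 0] separates the remaining roots from [z], so the
    hypothesis passes to the cofactor. *)
Lemma poly_square (k : closedFieldType) (p : {poly k}) : p != 0 ->
  (forall z, root p z -> exists2 q, p = ('X - z%:P) ^+ 2 * q & q.[z] != 0) ->
  exists s, p = s ^+ 2.
Proof.
have [n] := ubnP (size p); elim: n p => // n IH p; rewrite ltnS => pn p0 dbl.
have [/size_poly1P [c c0 ->]|sp1] := boolP (size p == 1%N).
  have [r /eqP rE] := @solve_monicpoly k 2 (fun i => if i == 0%N then c else 0) isT.
  exists r%:P; rewrite -rmorphXn /=; congr _%:P; apply/eqP.
  by move: rE; rewrite !big_ord_recl big_ord0 /= expr0 mulr1 mul0r !addr0 eq_sym.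
have /closed_rootP [z pz] := sp1.
have [q pE qz] := dbl z pz.
have q0 : q != 0 by apply: contraNneq qz => ->; rewrite horner0.
have [||s qE] := IH q _ q0.
- apply: leq_trans pn; rewrite pE size_proper_mul; last first.
    by rewrite mulf_neq0 // lead_coef_eq0 // expf_neq0 // polyXsubC_eq0.
  by rewrite size_exp_XsubC.
- move=> y qy; have yz : y != z by apply: contraTneq qy => ->.
  have [|r rE ry] := dbl y; first by rewrite pE rootM qy orbT.
  have : ('X - y%:P) ^+ 2 %| ('X - z%:P) ^+ 2 * q.
    by rewrite -pE rE dvdp_mulr.
  rewrite Gauss_dvdpr; last first.
    by apply: coprimep_expl; apply: coprimep_expr; rewrite coprimep_XsubC root_XsubC eq_sym.
  case/dvdpP=> u uE; exists u; first by rewrite mulrC.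
  apply: contraNneq ry => uy.
  have : ('X - y%:P) ^+ 2 * r = ('X - y%:P) ^+ 2 * (('X - z%:P) ^+ 2 * u).
    by rewrite -rE pE uE; ring.
  move/mulfI => -> //; first by rewrite !hornerE uy mulr0.
  by rewrite expf_neq0 // polyXsubC_eq0.
by exists (('X - z%:P) * s); rewrite pE qE exprMn.
Qed.

(** * Gram matrices of frames and the meaning of total tangency *)

Section HermitianFrames.
Variable k : closedFieldType.
Hypothesis char5 : 5%N \in [pchar k].
Variables (H : 'M[k]_3) (Gamma : curve k 6).
Hypothesis H_unit : H \in unitmx.
Hypothesis GammaE : defines (hermitian_form H) Gamma.

(** Entry (i, j) is the coefficient of t^(5 i + j) in (t^5 - t)^2 = t^2 - 2 t^6 + t^10. *)
Definition herm_mx : 'M[k]_3 :=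
  mx3 [:: [:: 0; 0; 1]; [:: 0; - 2%:R; 0]; [:: 1; 0; 0]].

Definition gram (N : 'M[k]_3) : 'M[k]_3 := frob N *m H *m N^T.

Definition hermitian_frame N : Prop :=
  N \in unitmx /\ exists2 c, c != 0 & gram N = c *: herm_mx.

Lemma gramM B N : gram (B *m N) = frob B *m gram N *m B^T.
Proof. by rewrite /gram (frobM char5 idfun) trmx_mul !mulmxA. Qed.

Lemma gram_unit N : N \in unitmx -> gram N \in unitmx.
Proof.
by move=> Nu; rewrite !unitmx_mul (frob_unit char5) unitmx_tr Nu H_unit.
Qed.

Lemma eval_gram N v :
  eval (hermitian_form H) (v *m N) = (frob v *m gram N *m v^T) 0 0.
Proof.
rewrite -[LHS]/(subst idfun (v *m N) (hermitian_form H)) subst_hermitian.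
by rewrite (frobM char5 idfun) map_mx_id // trmx_mul /gram !mulmxA.
Qed.

(** The Hermitian form of matrix [h] restricted to the vectors (1, t, t^2). *)
Definition conic_poly (h : 'M[k]_3) : {poly k} :=
  \sum_i \sum_j h i j *: 'X^(5 * i + j).

Lemma subst_gram N (v : 'rV[{poly k}]_3) :
  subst (@polyC k) (v *m map_mx (@polyC k) N) (hermitian_form H) =
  (frob v *m map_mx (@polyC k) (gram N) *m v^T) 0 0.
Proof.
have frobN : frob (map_mx (@polyC k) N) = map_mx (@polyC k) (frob N).
  by apply/matrixP => i j; rewrite !mxE rmorphXn.
rewrite subst_hermitian (frobM char5 (@polyC k)) frobN trmx_mul /gram !map_mxM.
by rewrite -[map_mx _ N^T]matrix.map_trmx !mulmxA.
Qed.

Lemma conic_poly_comp h (q : {poly k}) (v := row3 [:: 1; q; q ^+ 2]) :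
  (frob v *m map_mx (@polyC k) h *m v^T) 0 0 = conic_poly h \Po q.
Proof.
rewrite /conic_poly !sum3E !rmorphD /= !comp_polyZ !comp_Xn_poly.
rewrite !(mxE, sum3E) /= -!mul_polyC.
by ring.
Qed.

Lemma conic_polyE N :
  subst (@polyC k) (param k true *m map_mx (@polyC k) N) (hermitian_form H) =
  conic_poly (gram N).
Proof.
by rewrite subst_gram -[RHS]comp_polyXr -conic_poly_comp /param.
Qed.

Lemma coef_conic_poly h n : (conic_poly h)`_n =
  \sum_i \sum_j h i j * (n == 5 * i + j)%N%:R.
Proof.
rewrite /conic_poly coef_sum; apply: eq_bigr => i _.
by rewrite coef_sum; apply: eq_bigr => j _; rewrite coefZ coefXn.
Qed.

(** The exponents 5 i + j with i, j < 3 are pairwise distinct, so the polynomial determines [h]. *)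
Lemma conic_poly_neq0 h : h != 0 -> conic_poly h != 0.
Proof.
move=> h0; apply: contraNneq h0 => fh; apply/eqP/matrixP => i j.
have := coef_conic_poly h (5 * i + j)%N; rewrite fh coef0 !sum3E.
by move: i j; elim/ord3_ind; elim/ord3_ind => /=; rewrite mxE ?mulr1 ?mulr0 ?addr0 ?add0r => <-.
Qed.

Lemma frame_row_neq0 (N : 'M[k]_3) i : N \in unitmx -> row i N != 0.
Proof.
move=> Nu; apply/eqP => Ni.
have /rowP /(_ i) : delta_mx 0 i = 0 :> 'rV[k]_3.
  by rewrite -[delta_mx 0 i]mulmx1 -(mulmxV Nu) mulmxA -rowE Ni mul0mx.
by rewrite !mxE !eqxx => /eqP; rewrite oner_eq0.
Qed.

Lemma poly_order0 (f : {poly k}) : f != 0 -> exists n g, f = 'X^n * g /\ g.[0] != 0.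
Proof.
move=> f0; have [n [g g0 fE]] := multiplicity_XsubC f 0.
by exists n, g; rewrite f0 in g0; rewrite fE subr0 mulrC.
Qed.

Section Tangent.
Variable Q : curve k 2.
Hypothesis tangent : forall P, (points Q `&` points Gamma) P ->
  intersection_mult Q Gamma P 2.

(** The vanishing order at 0 is an intersection multiplicity by [frame_intersection_mult], and such
    a multiplicity is unique; tangency says that it is 2. *)
Lemma tangent_order N : N \in unitmx -> defines (frame_curve N true) Q ->
  (conic_poly (gram N)).[0] = 0 ->
  exists2 g, conic_poly (gram N) = 'X^2 * g & g.[0] != 0.
Proof.
move=> Nu NQ f0; have /spans_exists [P NP] := frame_row_neq0 o0 Nu.
have rowE0 : row o0 N = delta_mx 0 o0 *m N by rewrite -rowE.
have eval_frame : eval (frame_curve N true) (row o0 N) = 0.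
  have e j : eval (frame_form N j) (delta_mx 0 o0 *m N) = (delta_mx 0 o0 : 'rV_3) 0 j.
    have := subst_frame_form Nu idfun (delta_mx 0 o0) j.
    by rewrite map_mx_id.
  rewrite rowE0 /frame_curve expr2 /eval mevalB !mevalM -!/(eval _ _) !e !mxE /=.
  by rewrite !mulr0 subrr.
have QP : points Q P by apply/(points_eval NQ NP).
have GP : points Gamma P.
  apply/(points_eval GammaE NP); rewrite rowE0 eval_gram.
  move: f0; rewrite horner_coef0 coef_conic_poly; move: (gram N) => G.
  by rewrite !(mxE, sum3E) /= => f0; rewrite -[RHS]f0; ring.
have gram0 : gram N != 0.
  by apply: contraTneq (gram_unit Nu) => ->; rewrite unitmxE det0 unitr0.
have [n [g [fE g0]]] := poly_order0 (conic_poly_neq0 gram0).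
have := frame_intersection_mult Nu NQ GammaE NP (etrans (conic_polyE N) fE) g0.
move=> /intersection_mult_uniq /(_ (tangent (conj QP GP))) n2.
by exists g; rewrite // fE n2.
Qed.

Lemma frame_reparam B N c : B \in unitmx -> N \in unitmx -> c != 0 ->
  B^T *m dual_conic_mx k *m B = c *: dual_conic_mx k ->
  defines (frame_curve N true) Q -> defines (frame_curve (B *m N) true) Q.
Proof.
move=> Bu Nu c0 BE NQ; have BNu : B *m N \in unitmx by rewrite unitmx_mul Bu.
apply/(definesZ _ _ c0).
suff <- : frame_curve N true = c *: frame_curve (B *m N) true by [].
apply: frame_curve_dual => //; first exact: two_neq0 char5.
transitivity (N^T *m (B^T *m dual_conic_mx k *m B) *m N).
  by rewrite trmx_mul !mulmxA.
by rewrite BE -scalemxAr -scalemxAl.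
Qed.

(** The symmetric square of a translation of the parameter line. Likewise [flip_mx] comes from
    inversion of the parameter and [torus_mx] from scaling it. *)
Definition shift_mx (t : k) : 'M[k]_3 :=
  mx3 [:: [:: 1; t; t ^+ 2]; [:: 0; 1; t *+ 2]; [:: 0; 0; 1]].

Lemma shift_mxN t : shift_mx t *m shift_mx (- t) = 1%:M.
Proof. by by_coords; ring. Qed.

Lemma shift_mx_dual t :
  (shift_mx t)^T *m dual_conic_mx k *m shift_mx t = dual_conic_mx k.
Proof. by by_coords; ring. Qed.

(** Shifting the parameter by [z] gives another frame of the same conic and moves the root to 0,
    where [tangent_order] applies. *)
Lemma tangent_root N z : N \in unitmx -> defines (frame_curve N true) Q ->
  root (conic_poly (gram N)) z ->
  exists2 q, conic_poly (gram N) = ('X - z%:P) ^+ 2 * q & q.[z] != 0.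
Proof.
move=> Nu NQ fz; have [Bu _] := mulmx1_unit (shift_mxN z).
have BNu : shift_mx z *m N \in unitmx by rewrite unitmx_mul Bu.
have BNQ : defines (frame_curve (shift_mx z *m N) true) Q.
  apply: (@frame_reparam _ _ 1) => //; rewrite ?oner_eq0 // scale1r.
  exact: shift_mx_dual.
have shiftE : conic_poly (gram (shift_mx z *m N)) =
    conic_poly (gram N) \Po ('X + z%:P).
  rewrite -conic_polyE map_mxM mulmxA subst_gram -conic_poly_comp.
  suff -> : param k true *m map_mx (@polyC k) (shift_mx z) =
      row3 [:: 1; 'X + z%:P; ('X + z%:P) ^+ 2] by [].
  apply: row3P; rewrite !(mxE, sum3E) /= ?polyC0 ?polyC1 ?polyC_exp ?polyCMn; ring.
have [|g gE g0] := tangent_order BNu BNQ.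
  by rewrite shiftE horner_comp !hornerE (rootP fz).
exists (g \Po ('X - z%:P)); last by rewrite horner_comp !hornerE subrr.
have -> : conic_poly (gram N) =
    (conic_poly (gram N) \Po ('X + z%:P)) \Po ('X - z%:P).
  by rewrite -comp_polyA comp_polyD comp_polyX comp_polyC subrK comp_polyXr.
by rewrite -shiftE gE comp_polyM comp_Xn_poly.
Qed.

Definition flip_mx : 'M[k]_3 :=
  mx3 [:: [:: 0; 0; 1]; [:: 0; 1; 0]; [:: 1; 0; 0]].

Lemma flip_mxK : flip_mx *m flip_mx = 1%:M.
Proof. by by_coords; ring. Qed.

Lemma flip_mx_dual : flip_mx^T *m dual_conic_mx k *m flip_mx = dual_conic_mx k.
Proof. by by_coords; ring. Qed.

Lemma gram_flip N i j : gram (flip_mx *m N) i j = gram N (rev_ord i) (rev_ord j).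
Proof.
rewrite gramM; move: i j.
have r0 : rev_ord o0 = o2 by apply: val_inj.
have r1 : rev_ord o1 = o1 by apply: val_inj.
have r2 : rev_ord o2 = o0 by apply: val_inj.
elim/ord3_ind; elim/ord3_ind; rewrite ?r0 ?r1 ?r2; set G := gram N; clearbody G;
  by rewrite !(mxE, sum3E) /= ?expr0n ?expr1n /=; ring.
Qed.

End Tangent.
End HermitianFrames.

(** * Normal form of the frames of totally tangent conics *)

Section Classification.
Variable k : closedFieldType.
Hypothesis char5 : 5%N \in [pchar k].

(** The exponents 5 i + j omit 3, 4, 8 and 9. The zero coefficients at 0, 3, 4 and 9 successively
    remove all terms of [s] other than a t and b t^5. *)
Lemma conic_poly_square (h : 'M[k]_3) (s : {poly k}) :
  conic_poly h = s ^+ 2 -> h o0 o2 != 0 -> h o2 o0 != 0 ->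
  h o0 o0 = 0 -> h o0 o1 = 0 -> h o2 o1 = 0 -> h o2 o2 = 0 ->
  exists a b, [/\ a != 0, b != 0 & h = mx3 [:: [:: 0; 0; a ^+ 2];
    [:: 0; a * b *+ 2; 0]; [:: b ^+ 2; 0; 0]]].
Proof.
move=> hs h02 h20 h00 h01 h21 h22.
have two0 := two_neq0 char5.
(* With [h o2 o1] and [h o2 o2] zero the polynomial has degree at most 10, so its square root has
   degree at most 5. *)
have s_size : (size s <= 6)%N.
  have fsize : (size (conic_poly h) <= 11)%N.
    apply/leq_sizeP => j lt_j; rewrite coef_conic_poly !sum3E h21 h22 !mul0r !addr0 /=.
    by rewrite !(gtn_eqF _) ?mulr0 ?addr0 //; apply: leq_trans lt_j.
  have [->|s0] := eqVneq s 0; first by rewrite size_poly0.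
  move: fsize; rewrite hs expr2 size_mul //.
  by case: (size s) => [|n] //; rewrite addnS /= -ltnS; lia.
have s_big n : (6 <= n)%N -> s`_n = 0.
  by move=> n6; rewrite nth_default // (leq_trans s_size).
have bigE := (s_big 6 isT, s_big 7 isT, s_big 8 isT, s_big 9 isT, s_big 10 isT).
have coefE n : \sum_(j < n.+1) s`_j * s`_(n - j) = (conic_poly h)`_n.
  by rewrite hs expr2 coefM.
have simplE := (mulr0, mul0r, addr0, add0r, mulr1).
have s0 : s`_0 = 0.
  have := coefE 0%N; rewrite big_ord_recl big_ord0 coef_conic_poly !sum3E h00 /=.
  by rewrite !simplE => /eqP; rewrite mulf_eq0 orbb => /eqP.
have e2 : s`_1 ^+ 2 = h o0 o2.
  have := coefE 2%N; rewrite !big_ord_recl big_ord0 coef_conic_poly !sum3E /= /bump /=.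
  by rewrite !subSS !subn0 s0 !simplE.
have s1 : s`_1 != 0 by apply: contraNneq h02 => s1; rewrite -e2 s1 expr0n.
have double0 (x : k) : x + x = 0 -> x = 0.
  by rewrite -mulr2n -mulr_natr => /eqP; rewrite mulf_eq0 (negPf two0) orbF => /eqP.
have s2 : s`_2 = 0.
  have := coefE 3%N; rewrite !big_ord_recl big_ord0 coef_conic_poly !sum3E /= /bump /=.
  rewrite !subSS !subn0 s0 !simplE [s`_2 * _]mulrC => /double0 /eqP.
  by rewrite mulf_eq0 (negPf s1) => /eqP.
have s3 : s`_3 = 0.
  have := coefE 4%N; rewrite !big_ord_recl big_ord0 coef_conic_poly !sum3E /= /bump /=.
  rewrite !subSS !subn0 s0 s2 !simplE [s`_3 * _]mulrC => /double0 /eqP.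
  by rewrite mulf_eq0 (negPf s1) => /eqP.
have e10 : s`_5 ^+ 2 = h o2 o0.
  have := coefE 10%N; rewrite !big_ord_recl big_ord0 coef_conic_poly !sum3E /= /bump /=.
  by rewrite !subSS !subn0 s0 s2 s3 !bigE !simplE.
have s5 : s`_5 != 0 by apply: contraNneq h20 => s5; rewrite -e10 s5 expr0n.
have s4 : s`_4 = 0.
  have := coefE 9%N; rewrite !big_ord_recl big_ord0 coef_conic_poly !sum3E /= /bump /=.
  rewrite !subSS !subn0 s0 s2 s3 !bigE !simplE [s`_5 * _]mulrC => /double0 /eqP.
  by rewrite mulf_eq0 (negPf s5) orbF => /eqP.
have h10 : h o1 o0 = 0.
  have := coefE 5%N; rewrite !big_ord_recl big_ord0 coef_conic_poly !sum3E /= /bump /=.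
  by rewrite !subSS !subn0 s0 s2 s3 s4 !simplE.
have h11 : h o1 o1 = s`_1 * s`_5 *+ 2.
  have := coefE 6%N; rewrite !big_ord_recl big_ord0 coef_conic_poly !sum3E /= /bump /=.
  by rewrite !subSS !subn0 s0 s2 s3 s4 !simplE [s`_5 * _]mulrC -mulr2n.
have h12 : h o1 o2 = 0.
  have := coefE 7%N; rewrite !big_ord_recl big_ord0 coef_conic_poly !sum3E /= /bump /=.
  by rewrite !subSS !subn0 s0 s2 s3 s4 !bigE !simplE.
exists s`_1, s`_5; split=> //; apply/matrixP.
by elim/ord3_ind; elim/ord3_ind; rewrite !mxE /= ?e2 ?e10.
Qed.

Variables (H : 'M[k]_3) (Gamma : curve k 6).
Hypothesis H_unit : H \in unitmx.
Hypothesis GammaE : defines (hermitian_form H) Gamma.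
Local Notation gram := (gram H).

Lemma frob_delta m n i j : frob (delta_mx i j : 'M[k]_(m, n)) = delta_mx i j.
Proof.
by apply/matrixP => a b; rewrite !mxE; case: (_ && _); rewrite ?expr1n ?expr0n.
Qed.

Definition torus_mx (u : k) : 'M[k]_3 :=
  mx3 [:: [:: 1; 0; 0]; [:: 0; u; 0]; [:: 0; 0; u ^+ 2]].

Lemma torus_mx_unit u : u != 0 -> torus_mx u \in unitmx.
Proof.
move=> u0; suff /mulmx1_unit [] : torus_mx u *m torus_mx u^-1 = 1%:M by [].
by by_coords; try ring; field.
Qed.

Lemma totally_tangent_frame (Q : curve k 2) P1 P2 :
  totally_tangent_conic Gamma Q ->
  (points Q `&` points Gamma) P1 -> (points Q `&` points Gamma) P2 -> P1 <> P2 ->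
  exists N, [/\ hermitian_frame H N, defines (frame_curve N true) Q,
                spans (row o0 N) P1 & spans (row o2 N) P2].
Proof.
move=> [nsQ _ tgQ] [QP1 GP1] [QP2 GP2] P12.
have two0 := two_neq0 char5.
have [N [Nu NQ N1 N2]] := nonsingular_conic_frame two0 nsQ QP1 QP2 P12.
have row_gram i P : spans (row i N) P -> points Gamma P -> gram N i i = 0.
  move=> NP /(points_eval GammaE NP); rewrite rowE (eval_gram char5) frob_delta.
  by rewrite -rowE trmx_delta -colE [LHS]mxE [LHS]mxE.
have h00 := row_gram _ _ N1 GP1; have h22 := row_gram _ _ N2 GP2.
have [|g gE g0] := tangent_order char5 H_unit GammaE tgQ Nu NQ.
  by rewrite horner_coef0 coef_conic_poly !sum3E h00 /= !mulr0 !addr0 mul0r.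
(* The flipped frame moves the other end to parameter 0, so that tangency there controls the last
   row of the Gram matrix. *)
have [Fu _] := mulmx1_unit (flip_mxK k).
have FNu : flip_mx k *m N \in unitmx by rewrite unitmx_mul Fu.
have FNQ : defines (frame_curve (flip_mx k *m N) true) Q.
  apply: (frame_reparam char5 (c := 1)) => //; rewrite ?oner_eq0 // scale1r.
  exact: flip_mx_dual.
have gramF i j : gram (flip_mx k *m N) i j = gram N (rev_ord i) (rev_ord j).
  exact: gram_flip.
have r0 : rev_ord o0 = o2 by apply: val_inj.
have r1 : rev_ord o1 = o1 by apply: val_inj.
have r2 : rev_ord o2 = o0 by apply: val_inj.
have [|g' gE' g'0] := tangent_order char5 H_unit GammaE tgQ FNu FNQ.
  rewrite horner_coef0 coef_conic_poly !sum3E !gramF r0 h22 /=.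
  by rewrite !mulr0 !addr0 mul0r.
have simplE := (mulr0, mul0r, addr0, add0r, mulr1).
have h01 : gram N o0 o1 = 0.
  have := congr1 (fun p : {poly k} => p`_1) gE.
  by rewrite coef_conic_poly coefXnM !sum3E /= !simplE.
have h02 : gram N o0 o2 != 0.
  have := congr1 (fun p : {poly k} => p`_2) gE.
  by rewrite coef_conic_poly coefXnM !sum3E /= !simplE => ->; rewrite -horner_coef0.
have h21 : gram N o2 o1 = 0.
  have := congr1 (fun p : {poly k} => p`_1) gE'.
  by rewrite coef_conic_poly coefXnM !sum3E !gramF r0 r1 r2 /= !simplE.
have h20 : gram N o2 o0 != 0.
  have := congr1 (fun p : {poly k} => p`_2) gE'.
  rewrite coef_conic_poly coefXnM !sum3E !gramF r0 r1 r2 /= !simplE => ->.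
  by rewrite -horner_coef0.
have gram0 : gram N != 0 by apply: contraNneq h20 => ->; rewrite mxE.
have [s sE] : exists s, conic_poly (gram N) = s ^+ 2.
  apply: poly_square; first exact: conic_poly_neq0.
  by move=> z; exact: (tangent_root char5 H_unit GammaE tgQ).
have [a [b [a0 b0 hE]]] := conic_poly_square sE h02 h20 h00 h01 h21 h22.
(* The square root a t + b t^5 becomes u (a t + b u^4 t^5) after t -> u t; this choice makes it a
   multiple of t - t^5. *)
have [u uE] : exists u, u ^+ 4 = - a / b.
  have [u] := @solve_monicpoly k 4 (fun i => if i == 0%N then - a / b else 0) isT.
  by rewrite !big_ord_recl big_ord0 /= expr0 mulr1 !mul0r !addr0; exists u.
have u0 : u != 0.
  apply/eqP => u0; move: uE; rewrite u0 expr0n /= => /eqP.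
  by rewrite eq_sym mulf_eq0 oppr_eq0 invr_eq0 (negPf a0) (negPf b0).
have bE : b * u ^+ 4 = - a by rewrite uE mulrC divfK.
have Tu := torus_mx_unit u0.
exists (torus_mx u *m N); split.
- split; first by rewrite unitmx_mul Tu.
  exists (a ^+ 2 * u ^+ 2); first by rewrite mulf_neq0 // expf_neq0.
  rewrite (gramM char5).
  have -> : frob (torus_mx u) *m gram N *m (torus_mx u)^T =
      mx3 [:: [:: 0; 0; a ^+ 2 * u ^+ 2]; [:: 0; a * u ^+ 2 * (b * u ^+ 4) *+ 2; 0];
              [:: (b * u ^+ 4) ^+ 2 * u ^+ 2; 0; 0]].
    by rewrite hE; by_coords; ring.
  by rewrite bE; by_coords; ring.
- apply: (frame_reparam char5 (c := u ^+ 2)) => //; first by rewrite expf_neq0.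
  by by_coords; ring.
- suff -> : row o0 (torus_mx u *m N) = row o0 N by [].
  by apply/rowP => j; rewrite !(mxE, sum3E) /=; ring.
suff -> : row o2 (torus_mx u *m N) = u ^+ 2 *: row o2 N.
  by apply/spansZ => //; rewrite expf_neq0.
by apply/rowP => j; rewrite !(mxE, sum3E) /=; ring.
Qed.

End Classification.

(** * The finite model over F_25 *)

(** Five constructors with operations defined by cases, so that the searches below run by
    [vm_compute]. *)
Inductive f5 : predArgType := N0 | N1 | N2 | N3 | N4.

Definition eq5 x y :=
  match x, y with
  | N0, N0 | N1, N1 | N2, N2 | N3, N3 | N4, N4 => true
  | _, _ => false
  end.

Lemma eq5P : Equality.axiom eq5.
Proof. by case; case; constructor. Qed.

HB.instance Definition _ := hasDecEq.Build f5 eq5P.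

Definition succ5 x :=
  match x with N0 => N1 | N1 => N2 | N2 => N3 | N3 => N4 | N4 => N0 end.

Definition opp5 x :=
  match x with N0 => N0 | N1 => N4 | N2 => N3 | N3 => N2 | N4 => N1 end.

Definition add5 x y :=
  match x with
  | N0 => y
  | N1 => succ5 y
  | N2 => succ5 (succ5 y)
  | N3 => succ5 (succ5 (succ5 y))
  | N4 => succ5 (succ5 (succ5 (succ5 y)))
  end.

Definition mul5 x y :=
  match x with
  | N0 => N0
  | N1 => y
  | N2 => add5 y y
  | N3 => opp5 (add5 y y)
  | N4 => opp5 y
  end.

Definition inv5 x :=
  match x with N0 => N0 | N1 => N1 | N2 => N3 | N3 => N2 | N4 => N4 end.

(* The pair (a, b) stands for a + b r, where r is a square root of 2. *)
Definition f25 : Type := f5 * f5.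

Definition zero25 : f25 := (N0, N0).
Definition one25 : f25 := (N1, N0).
Definition int25 (x : f5) : f25 := (x, N0).
Definition add25 (x y : f25) : f25 := (add5 x.1 y.1, add5 x.2 y.2).
Definition opp25 (x : f25) : f25 := (opp5 x.1, opp5 x.2).
Definition mul25 (x y : f25) : f25 :=
  (add5 (mul5 x.1 y.1) (mul5 N2 (mul5 x.2 y.2)),
   add5 (mul5 x.1 y.2) (mul5 x.2 y.1)).
(** The Frobenius x -> x^5, because r^5 = 4 r = - r. *)
Definition conj25 (x : f25) : f25 := (x.1, opp5 x.2).
(** The conjugate over the norm a^2 - 2 b^2, where -2 is [N3]. *)
Definition inv25 (x : f25) : f25 :=
  let n := inv5 (add5 (mul5 x.1 x.1) (mul5 N3 (mul5 x.2 x.2))) in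
  (mul5 n x.1, mul5 n (opp5 x.2)).
Definition enum5 := [:: N0; N1; N2; N3; N4].
Definition enum25 : seq f25 := [seq (x, y) | x <- enum5, y <- enum5].

Definition vec25 : Type := f25 * f25 * f25.
Definition mat25 : Type := vec25 * vec25 * vec25.

Definition map_vec25 (f : f25 -> f25) (v : vec25) : vec25 :=
  (f v.1.1, f v.1.2, f v.2).
Definition scale25 (a : f25) : vec25 -> vec25 := map_vec25 (mul25 a).
Definition addv25 (u v : vec25) : vec25 :=
  (add25 u.1.1 v.1.1, add25 u.1.2 v.1.2, add25 u.2 v.2).
Definition dot25 (u v : vec25) : f25 :=
  add25 (add25 (mul25 u.1.1 v.1.1) (mul25 u.1.2 v.1.2)) (mul25 u.2 v.2).
Definition cross25 (u v : vec25) : vec25 :=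
  let minor a b c d := add25 (mul25 a d) (opp25 (mul25 b c)) in
  (minor u.1.2 u.2 v.1.2 v.2, minor u.2 u.1.1 v.2 v.1.1,
   minor u.1.1 u.1.2 v.1.1 v.1.2).
Definition vecmul25 (v : vec25) (A : mat25) : vec25 :=
  addv25 (addv25 (scale25 v.1.1 A.1.1) (scale25 v.1.2 A.1.2)) (scale25 v.2 A.2).
Definition mul_mat25 (A B : mat25) : mat25 :=
  (vecmul25 A.1.1 B, vecmul25 A.1.2 B, vecmul25 A.2 B).
Definition tr25 (A : mat25) : mat25 :=
  ((A.1.1.1.1, A.1.2.1.1, A.2.1.1), (A.1.1.1.2, A.1.2.1.2, A.2.1.2),
   (A.1.1.2, A.1.2.2, A.2.2)).
Definition conj_mat25 (A : mat25) : mat25 :=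
  (map_vec25 conj25 A.1.1, map_vec25 conj25 A.1.2, map_vec25 conj25 A.2).
Definition mulmv25 (A : mat25) (v : vec25) : vec25 :=
  (dot25 A.1.1 v, dot25 A.1.2 v, dot25 A.2 v).
Definition collinear25 (u v : vec25) : bool := cross25 u v == (zero25, zero25, zero25).

Definition mx5 a b c d e f g h i : mat25 :=
  ((int25 a, int25 b, int25 c), (int25 d, int25 e, int25 f),
   (int25 g, int25 h, int25 i)).
Definition scale_mat25 (a : f25) (A : mat25) : mat25 :=
  (scale25 a A.1.1, scale25 a A.1.2, scale25 a A.2).
Definition unit25 := mx5 N1 N0 N0 N0 N1 N0 N0 N0 N1.
Definition herm25 := mx5 N0 N0 N1 N0 N3 N0 N1 N0 N0.
Definition dual_conic25 := mx5 N0 N0 N3 N0 N1 N0 N3 N0 N0.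

Definition gram25 (A : mat25) : mat25 :=
  mul_mat25 (mul_mat25 (conj_mat25 A) herm25) (tr25 A).
Definition conic25 (A : mat25) : mat25 :=
  mul_mat25 (mul_mat25 (tr25 A) dual_conic25) A.
Definition form25 (v : vec25) : f25 :=
  add25 (add25 (mul25 (conj25 v.1.1) v.2) (mul25 (conj25 v.2) v.1.1))
    (mul25 (int25 N3) (mul25 (conj25 v.1.2) v.1.2)).

(* (s, t) stands for the point (s : t) of the projective line over F_5. *)
Definition line5 : seq (f5 * f5) := rcons [seq (N1, t) | t <- enum5] (N0, N1).
Definition veronese25 (p : f5 * f5) : vec25 :=
  (int25 (mul5 p.1 p.1), int25 (mul5 p.1 p.2), int25 (mul5 p.2 p.2)).

Definition ordered_pairs5 : seq ((f5 * f5) * (f5 * f5)) :=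
  [seq (p, q) | p <- line5, q <- [seq q <- line5 | q != p]].
Definition pairs5 : seq ((f5 * f5) * (f5 * f5)) :=
  [seq w <- ordered_pairs5 | (index w.1 line5 < index w.2 line5)%N].

(* The symmetric square of the linear map sending the basis of k^2 to p, q. *)
Definition sym25 (w : (f5 * f5) * (f5 * f5)) : mat25 :=
  let: ((s1, t1), (s2, t2)) := w in
  (veronese25 (s1, t1),
   (int25 (mul5 N2 (mul5 s1 s2)), int25 (add5 (mul5 s1 t2) (mul5 s2 t1)),
    int25 (mul5 N2 (mul5 t1 t2))),
   veronese25 (s2, t2)).

Definition secant25 (w : (f5 * f5) * (f5 * f5)) : vec25 :=
  cross25 (veronese25 w.1) (veronese25 w.2).
Definition secants25 : seq vec25 := [seq secant25 w | w <- pairs5].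

(** A line with coordinates [l] in a frame M has coordinates [mulmv25 A l] in the frame A M; it is
    common when these are again proportional to those of a secant. *)
Definition is_common25 (A : mat25) (l : vec25) : bool :=
  has (collinear25 (mulmv25 A l)) secants25.
Definition common25 (A : mat25) : seq vec25 := filter (is_common25 A) secants25.

Definition block25 (a b c d : f25) : mat25 :=
  ((a, zero25, b), (zero25, one25, zero25), (c, zero25, d)).
Definition nbr25 (e : bool) : mat25 :=
  if e then block25 (N4, N0) (N0, N1) (N0, N4) (N1, N0)
  else block25 (N2, N0) (N0, N2) (N0, N2) (N2, N0).

(* Coefficients of the even quartic in t that vanishes where the point (1, t, t^2) of the
   standard conic lies on the conic with frame [block25 a b c d]. *)
Definition quartic25 (a b c d : f25) : f25 * f25 * f25 :=
  let ad := mul25 a d in let bc := mul25 b c in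
  let delta := add25 ad (opp25 bc) in
  (mul25 b d, add25 (mul25 delta delta) (opp25 (add25 ad bc)), mul25 a c).
(** Nonzero outer coefficients and nonzero discriminant of the quadratic in t^2. *)
Definition four_roots25 (q : f25 * f25 * f25) : bool :=
  let n := mul25 q.1.1 q.2 in
  (n != zero25) && (mul25 q.1.2 q.1.2 != mul25 (int25 N4) n).

Definition isotropic_pairs25 : seq (f25 * f25) :=
  [seq x <- [seq (a, b) | a <- enum25, b <- enum25] |
    add25 (mul25 (conj25 x.1) x.2) (mul25 (conj25 x.2) x.1) == zero25].

(** The pairs [x] and [y] are the outer rows of a candidate unitary block. A zero quartic means that
    the two conics coincide; this case is ruled out by its number of common secants. *)
Definition block_check25 (x y : f25 * f25) : bool :=
  if add25 (mul25 (conj25 x.1) y.2) (mul25 (conj25 x.2) y.1) == one25 then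
    let A := block25 x.1 x.2 y.1 y.2 in
    let q := quartic25 x.1 x.2 y.1 y.2 in
    if four_roots25 q then
      if size (common25 A) == 3%N then
        has (fun e => conic25 (nbr25 e) == conic25 A) [:: true; false]
      else true
    else if q == (zero25, zero25, zero25) then size (common25 A) != 3%N else true
  else true.

(** Unfolded so that the conditions can be rewritten one by one on symbolic entries. *)
Lemma block_check25E a b c d : block_check25 (a, b) (c, d) =
  if add25 (mul25 (conj25 a) d) (mul25 (conj25 b) c) == one25 then
    if four_roots25 (quartic25 a b c d) then
      if size (common25 (block25 a b c d)) == 3%N then
        has (fun e => conic25 (nbr25 e) == conic25 (block25 a b c d)) [:: true; false]
      else true
    else if quartic25 a b c d == (zero25, zero25, zero25) then
      size (common25 (block25 a b c d)) != 3%N else true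
  else true.
Proof. by []. Qed.

Lemma block_classification25 :
  all (fun x => all (block_check25 x) isotropic_pairs25) isotropic_pairs25.
Proof. by vm_compute. Qed.

Lemma nbr25_spec e : [&& gram25 (nbr25 e) == herm25, size (common25 (nbr25 e)) == 3%N &
  four_roots25 (if e then quartic25 (N4, N0) (N0, N1) (N0, N4) (N1, N0)
                else quartic25 (N2, N0) (N0, N2) (N0, N2) (N2, N0))].
Proof. by case: e; vm_compute. Qed.

(** An element g of GL_2(F_5) multiplies s t^5 - s^5 t by det g. Its symmetric square therefore
    scales the Hermitian form and the dual conic by the same factor (det g)^2, which is 1 or -1. *)
Lemma sym25_spec w : w \in ordered_pairs5 ->
  has (fun c => (gram25 (sym25 w) == scale_mat25 c herm25) &&
                (conic25 (sym25 w) == scale_mat25 c dual_conic25))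
      [:: one25; (N4, N0)].
Proof.
move: w; apply/allP; by vm_compute.
Qed.

Lemma veronese25_noncollinear : pairwise (fun p q =>
  ~~ collinear25 (veronese25 p) (veronese25 q)) line5.
Proof. by vm_compute. Qed.

Lemma secants25_noncollinear : pairwise (fun l m => ~~ collinear25 l m) secants25.
Proof. by vm_compute. Qed.

Lemma secants25_uniq : uniq secants25.
Proof. by vm_compute. Qed.

(** Reversing a pair negates the cross product, and [secants25] keeps one order of each pair. *)
Lemma secant25_mem w : w \in ordered_pairs5 ->
  has (fun l => (secant25 w == l) || (secant25 w == scale25 (N4, N0) l)) secants25.
Proof. by move: w; apply/allP; vm_compute. Qed.

Lemma mem_ordered_pairs5 p q :
  p \in line5 -> q \in line5 -> p != q -> (p, q) \in ordered_pairs5.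
Proof.
move=> p5 q5; apply/implyP; move: q q5; apply/allP; move: p p5; apply/allP.
by vm_compute.
Qed.

Lemma ordered_pairs5_mem w : w \in ordered_pairs5 ->
  [&& w.1 \in line5, w.2 \in line5 & w.1 != w.2].
Proof. by move: w; apply/allP; vm_compute. Qed.

Lemma secants25_neq0 l : l \in secants25 -> l != (zero25, zero25, zero25).
Proof. by move: l; apply/allP; vm_compute. Qed.

Lemma size_common_unit25 : size (common25 unit25) = 15%N.
Proof. by vm_compute. Qed.

Definition neighbours25 (A : mat25) : seq mat25 :=
  [seq mul_mat25 (nbr25 e) (mul_mat25 (sym25 w) A) | w <- ordered_pairs5, e <- [:: true; false]].

(* The dual conic of a frame, normalised at its first nonzero coordinate. *)
Definition normal_conic25 (A : mat25) : mat25 :=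
  let C := conic25 A in
  let a := nth one25 [seq x <- [:: C.1.1.1.1; C.1.1.1.2; C.1.1.2; C.1.2.1.2] | x != zero25] 0%N in
  scale_mat25 (inv25 a) C.

(** One round of closure under [neighbours25], keeping a single frame for each new conic. *)
Definition extend25 (s : seq (mat25 * mat25)) : seq (mat25 * mat25) :=
  foldl (fun s A => let C := normal_conic25 A in
      if has (fun x => x.2 == C) s then s else rcons s (A, C))
    s (flatten [seq neighbours25 x.1 | x <- s]).

(** Two rounds already reach everything, as [orbit25_closed] confirms. *)
Definition orbit25 : seq mat25 :=
  map fst (extend25 (extend25 [:: (unit25, normal_conic25 unit25)])).

Lemma orbit25_closed : let cs := [seq normal_conic25 A | A <- orbit25] in
  all (fun A => all (fun B => has (eq_op (normal_conic25 B)) cs) (neighbours25 A)) orbit25.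
Proof. by vm_compute. Qed.

Lemma size_orbit25 : size orbit25 = 21%N.
Proof. by vm_compute. Qed.

Lemma uniq_orbit25 : uniq orbit25.
Proof. by vm_compute. Qed.

Lemma unit25_orbit25 : unit25 \in orbit25.
Proof. by vm_compute. Qed.

Definition flags25 : seq (mat25 * (f5 * f5)) :=
  [seq (A, p) | A <- orbit25, p <- line5].
Definition flag_point25 (x : mat25 * (f5 * f5)) : vec25 :=
  vecmul25 (veronese25 x.2) x.1.

Lemma size_flags25 : size flags25 = (21 * 6)%N.
Proof. by vm_compute. Qed.

Lemma uniq_flags25 : uniq flags25.
Proof. by vm_compute. Qed.

(** This one check contains both the distinctness of the six contact points on each conic and the
    disjointness of the contact sets of different conics. *)
Lemma flags25_noncollinear : pairwise (fun x y =>
  ~~ collinear25 (flag_point25 x) (flag_point25 y)) flags25.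
Proof. by vm_compute. Qed.

(** One vector for each point of the projective plane over F_25, with first nonzero coordinate 1. *)
Definition normal_vecs25 : seq vec25 :=
  (zero25, zero25, one25) :: [seq (zero25, one25, z) | z <- enum25] ++
  [seq (one25, y, z) | y <- enum25, z <- enum25].

Lemma flags25_complete :
  all (fun v => (form25 v == zero25) ==> has (collinear25 v) (map flag_point25 flags25)) normal_vecs25.
Proof. by vm_compute. Qed.

(** * From the finite model to k *)

Section Evaluation.
Variable k : closedFieldType.
Hypothesis char5 : 5%N \in [pchar k].
Variable r : k.
Hypothesis r2 : r ^+ 2 = 2%:R.

Definition nat5 (x : f5) : nat :=
  match x with N0 => 0 | N1 => 1 | N2 => 2 | N3 => 3 | N4 => 4 end.

Definition ev5 (x : f5) : k := (nat5 x)%:R.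
Definition ev (x : f25) : k := ev5 x.1 + ev5 x.2 * r.
Definition evv (v : vec25) : 'rV[k]_3 := row3 [:: ev v.1.1; ev v.1.2; ev v.2].
Definition evm (A : mat25) : 'M[k]_3 :=
  mx3 [:: [:: ev A.1.1.1.1; ev A.1.1.1.2; ev A.1.1.2];
          [:: ev A.1.2.1.1; ev A.1.2.1.2; ev A.1.2.2];
          [:: ev A.2.1.1; ev A.2.1.2; ev A.2.2]].

Lemma ev5D x y : ev5 (add5 x y) = ev5 x + ev5 y.
Proof.
(* Reducing the integer modulo 5 leaves a finite check on constructors. *)
rewrite /ev5 -natrD -(GRing.natr_mod_pchar char5 (nat5 x + nat5 y)).
by move: x y; do 2!case.
Qed.

Lemma ev5M x y : ev5 (mul5 x y) = ev5 x * ev5 y.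
Proof.
rewrite /ev5 -natrM -(GRing.natr_mod_pchar char5 (nat5 x * nat5 y)).
by move: x y; do 2!case.
Qed.

Lemma ev5N x : ev5 (opp5 x) = - ev5 x.
Proof. by apply/eqP; rewrite -addr_eq0 -ev5D; case: x. Qed.

Lemma evD x y : ev (add25 x y) = ev x + ev y.
Proof. by rewrite /ev !ev5D; ring. Qed.

Lemma evN x : ev (opp25 x) = - ev x.
Proof. by rewrite /ev !ev5N; ring. Qed.

Lemma evM x y : ev (mul25 x y) = ev x * ev y.
Proof.
have two : ev5 N2 = r ^+ 2 by rewrite r2.
by rewrite /ev !(ev5D, ev5M) two; ring.
Qed.

Lemma ev0 : ev zero25 = 0. Proof. by rewrite /ev mul0r addr0. Qed.
Lemma ev1 : ev one25 = 1. Proof. by rewrite /ev mul0r addr0. Qed.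
Lemma ev_int x : ev (int25 x) = ev5 x. Proof. by rewrite /ev mul0r addr0. Qed.

Lemma ev5X5 x : ev5 x ^+ 5 = ev5 x.
Proof. by case: x; rewrite !exprS expr0 mulr1 -!ev5M. Qed.

Lemma ev_conj x : ev (conj25 x) = ev x ^+ 5.
Proof.
have frobD (a b : k) : (a + b) ^+ 5 = a ^+ 5 + b ^+ 5.
  by rewrite exprDn_pchar // pnatE.
rewrite /ev frobD exprMn !ev5X5 ev5N.
have -> : r ^+ 5 = - r.
  have -> : r ^+ 5 = r ^+ 2 ^+ 2 * r by ring.
  have four : 2%:R ^+ 2 = - 1 :> k.
    by apply/eqP; rewrite -addr_eq0 -natrX natr1 (natr5 char5).
  by rewrite r2 four mulN1r.
by rewrite mulNr mulrN.
Qed.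

Lemma ev_eq0 x : (ev x == 0) = (x == zero25).
Proof.
apply/eqP/eqP => [e|->]; last exact: ev0.
apply/eqP; apply: contraT => x0.
have : mul25 x (inv25 x) = one25 by case: x x0 {e}; do 2!case.
by move/(congr1 ev); rewrite evM e mul0r ev1 => /esym /eqP; rewrite oner_eq0.
Qed.

Lemma ev_inj : injective ev.
Proof.
move=> x y /eqP; rewrite -subr_eq0 -evN -evD ev_eq0 => /eqP.
have sub0 a b : add5 a (opp5 b) = N0 -> a = b by move: a b; do 2!case.
case: x y => a b [c d] e; have [/sub0 -> /sub0 -> //] : (add5 a (opp5 c), add5 b (opp5 d)) = (N0, N0) := e.
Qed.

(** The image of [ev] already supplies 25 distinct roots of X^25 - X; one more would exceed its
    degree. *)
Lemma ev_surj x : x ^+ 25 = x -> exists y, ev y = x.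
Proof.
move=> x25; pose p : {poly k} := 'X^25 - 'X.
have evX25 y : ev y ^+ 25 = ev y.
  by rewrite (exprM _ 5 5) -!ev_conj /conj25 /=; case: y => a [].
have p0 : p != 0.
  apply/eqP => /(congr1 (fun q : {poly k} => q`_25)).
  by rewrite coefB coefXn coefX coef0 subr0 => /eqP; rewrite oner_eq0.
have psize : (size p <= 26)%N.
  by rewrite (leq_trans (size_polyD _ _)) // size_polyN size_polyXn size_polyX.
have [/mapP [y _ ->]|x_notin] := boolP (x \in map ev enum25); first by exists y.
have root_x : root p x by rewrite rootE !hornerE x25 subrr.
have root_ev : all (root p) (map ev enum25).
  by rewrite all_map; apply/allP => y _ /=; rewrite rootE !hornerE evX25 subrr.
have roots_p : all (root p) (x :: map ev enum25).
  by apply/andP; split; [exact: root_x | exact: root_ev].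
have u25 : uniq (map ev enum25).
  by rewrite (map_inj_uniq ev_inj); have -> : uniq enum25 by [].
have uniq_ev : uniq (x :: map ev enum25).
  by apply/andP; split; [exact: x_notin | exact: u25].
have := max_poly_roots p0 roots_p uniq_ev.
by rewrite ltnNge (leq_trans psize) // [size (_ :: _)]/= size_map.
Qed.

Lemma evv_eq0 v : (evv v == 0) = (v == (zero25, zero25, zero25)).
Proof.
apply/eqP/eqP => [/rowP e|->]; last by apply: row3P; rewrite !mxE ev0.
move: (e o0) (e o1) (e o2); rewrite !mxE /=.
by move=> /eqP + /eqP + /eqP; rewrite !ev_eq0; case: v {e} => -[x y] z /= /eqP -> /eqP -> /eqP ->.
Qed.

Lemma evv_cross u v : evv (cross25 u v) = cross (evv u) (evv v).
Proof. by apply: row3P; rewrite !mxE /= evD evN !evM. Qed.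

Lemma collinear25P u v : collinear25 u v = (cross (evv u) (evv v) == 0).
Proof. by rewrite -evv_cross evv_eq0. Qed.

Lemma evv_vecmul v A : evv (vecmul25 v A) = evv v *m evm A.
Proof. by apply: row3P; rewrite !(mxE, sum3E) /= !(evD, evM). Qed.

Lemma evm_mul A B : evm (mul_mat25 A B) = evm A *m evm B.
Proof. by by_coords; rewrite !(evD, evM). Qed.

Lemma evm_tr A : evm (tr25 A) = (evm A)^T.
Proof. by by_coords. Qed.

Lemma evm_conj A : evm (conj_mat25 A) = frob (evm A).
Proof. by by_coords; rewrite ev_conj. Qed.

Lemma evm_scale c A : evm (scale_mat25 c A) = ev c *: evm A.
Proof. by by_coords; rewrite evM. Qed.

Lemma evm_unit : evm unit25 = 1%:M.
Proof. by by_coords; rewrite ?ev0 ?ev1. Qed.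

Lemma natr3 : 3%:R = - 2%:R :> k.
Proof. by apply/eqP; rewrite -addr_eq0 -natrD (natr5 char5). Qed.

Lemma evm_herm : evm herm25 = herm_mx k.
Proof. by by_coords; rewrite ev_int /ev5 /= ?natr3. Qed.

Lemma evm_dual_conic : evm dual_conic25 = dual_conic_mx k.
Proof. by by_coords; rewrite ev_int /ev5 /= ?natr3. Qed.

Lemma evv_mulmv A v : (evv (mulmv25 A v))^T = evm A *m (evv v)^T.
Proof.
by apply/colP; elim/ord3_ind; rewrite !(mxE, sum3E) /= !(evD, evM).
Qed.

Lemma evm_gram A : evm (gram25 A) = gram (herm_mx k) (evm A).
Proof. by rewrite /gram25 !evm_mul evm_conj evm_tr evm_herm. Qed.

Lemma evm_conic A : evm (conic25 A) = (evm A)^T *m dual_conic_mx k *m evm A.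
Proof. by rewrite /conic25 !evm_mul evm_tr evm_dual_conic. Qed.

Lemma ev_form v : ev (form25 v) = (frob (evv v) *m herm_mx k *m (evv v)^T) 0 0.
Proof.
have e3 : ev5 N3 = - 2%:R by exact: natr3.
by rewrite !(mxE, sum3E) /= !(evD, evM, ev_conj) ev_int e3; ring.
Qed.

End Evaluation.

(** * Frames and totally tangent conics *)

Lemma pairwise_rel (T : eqType) (e : rel T) (s : seq T) x y :
  (forall a b, e a b = e b a) -> pairwise e s -> x \in s -> y \in s -> x != y -> e x y.
Proof.
move=> sym_e; elim: s => //= z s IH /andP [/allP ez es].
rewrite !inE => /orP [/eqP -> | xs] /orP [/eqP -> | ys] xy; rewrite ?eqxx // in xy *.
- exact: ez.
- by rewrite sym_e; exact: ez.
exact: IH.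
Qed.

Section Converse.
Variable k : closedFieldType.
Hypothesis char5 : 5%N \in [pchar k].
Variable r : k.
Hypothesis r2 : r ^+ 2 = 2%:R.
Local Notation ev := (ev r).
Local Notation evv := (evv r).
Local Notation evm := (evm r).
Variables (H : 'M[k]_3) (Gamma : curve k 6).
Hypothesis H_unit : H \in unitmx.
Hypothesis GammaE : defines (hermitian_form H) Gamma.
Local Notation hframe := (hermitian_frame H).

Lemma herm_unit : herm_mx k \in unitmx.
Proof.
suff /mulmx1_unit [] : herm_mx k *m mx3 [:: [:: 0; 0; 1]; [:: 0; - 2%:R^-1; 0]; [:: 1; 0; 0]] = 1%:M by [].
have two0 := two_neq0 char5.
by by_coords; try ring; field.
Qed.

Lemma similitude_unit B c : c != 0 -> gram (herm_mx k) B = c *: herm_mx k ->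
  B \in unitmx.
Proof.
move=> c0 BE; have : gram (herm_mx k) B \in unitmx.
  by rewrite BE unitmxZ ?unitfE // herm_unit.
by rewrite unitmx_mul unitmx_tr => /andP [].
Qed.

Lemma similitude_frame B c M : c != 0 -> gram (herm_mx k) B = c *: herm_mx k ->
  hframe M -> hframe (B *m M).
Proof.
move=> c0 BE [Mu [lam lam0 ME]]; split.
  by rewrite unitmx_mul (similitude_unit c0 BE).
exists (lam * c); first by rewrite mulf_neq0.
by rewrite (gramM char5) ME -scalemxAr -scalemxAl -[frob B *m _ *m _]/(gram _ B) BE scalerA.
Qed.

Lemma frame_coords (M : 'M[k]_3) (P : Defs.point k) : M \in unitmx ->
  exists2 p, p != 0 & spans (p *m M) P.
Proof.
move=> Mu; exists (proj_rep P *m invmx M).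
  apply: contraNneq (proj_rep_neq0 P) => p0.
  by rewrite -[proj_rep P]mulmx1 -(mulVmx Mu) mulmxA p0 mul0mx.
by rewrite -mulmxA mulVmx // mulmx1; exact: spans_rep.
Qed.

Lemma eval_frame_form (M : 'M[k]_3) p j : M \in unitmx ->
  eval (frame_form M j) (p *m M) = p 0 j.
Proof. by move=> Mu; have := subst_frame_form Mu idfun p j; rewrite map_mx_id. Qed.

Lemma conic_point M (Q : curve k 2) p P : M \in unitmx ->
  defines (frame_curve M true) Q -> spans (p *m M) P ->
  points Q P <-> p 0 o1 ^+ 2 = p 0 o0 * p 0 o2.
Proof.
move=> Mu MQ MP; have -> := points_eval MQ MP.
rewrite /frame_curve expr2 /eval mevalB !mevalM -!/(eval _ _) !eval_frame_form //.
by rewrite [in X in _ <-> X]expr2; split=> [/subr0_eq|->]; rewrite ?subrr.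
Qed.

Lemma gamma_point M p P : hframe M -> spans (p *m M) P ->
  points Gamma P <-> (frob p *m herm_mx k *m p^T) 0 0 = 0.
Proof.
move=> [Mu [c c0 ME]] MP; have -> := points_eval GammaE MP.
rewrite (eval_gram char5) ME -scalemxAr -scalemxAl mxE.
split=> [/eqP|->]; last by rewrite mulr0.
by rewrite mulf_eq0 (negPf c0) => /eqP.
Qed.

Lemma fixed_ev5 x : x ^+ 5 = x -> exists y, ev5 k y = x.
Proof.
move=> x5; have x25 : x ^+ 25 = x by rewrite (exprM _ 5 5) !x5.
have [y yE] := ev_surj char5 r2 x25.
have : conj25 y = y by apply: (ev_inj char5 r2); rewrite (ev_conj char5 r2) yE.
case: y yE => a b /= <- [b0]; exists a.
have -> : b = N0 by case: b b0.
by rewrite /ev /= [ev5 _ N0]/(0%:R) mul0r addr0.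
Qed.

(** On (1, t, t^2) the form is a multiple of (t^5 - t)^2, so the contact parameters are the elements
    of F_5 together with infinity. *)
Lemma conic_gamma_points M (Q : curve k 2) P : hframe M ->
  defines (frame_curve M true) Q ->
  (points Q `&` points Gamma) P <->
  exists2 w, w \in line5 & spans (evv (veronese25 w) *m M) P.
Proof.
move=> hM MQ; have [Mu _] := hM; split; last first.
  move=> [w w5 MP]; split.
    by apply/(conic_point Mu MQ MP); rewrite !mxE /= !ev_int !(ev5M char5); ring.
  apply/(gamma_point hM MP); rewrite -(ev_form char5 r2).
  have -> : form25 (veronese25 w) = zero25 by case: w w5 {MP}; do 2!case.
  by rewrite ev0.
move=> [QP GP]; have [p p0 MP] := frame_coords P Mu.
have := proj1 (conic_point Mu MQ MP) QP; have := proj1 (gamma_point hM MP) GP.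
rewrite !(mxE, sum3E) /= => Jp qp.
have [p00|p00] := eqVneq (p 0 o0) 0.
  have p01 : p 0 o1 = 0.
    by apply/eqP; move/eqP: qp; rewrite p00 mul0r expf_eq0 => /andP [].
  have p02 : p 0 o2 != 0.
    by apply: contraNneq p0 => p02; apply/eqP/row3P; rewrite ?p00 ?p01 ?p02 mxE.
  exists (N0, N1); first by rewrite mem_rcons mem_head.
  apply/(spansZ _ _ p02); rewrite scalemxAl.
  suff -> : p 0 o2 *: evv (veronese25 (N0, N1)) = p by [].
  by apply: row3P; rewrite !mxE /= ?ev_int ?p00 ?p01 ?mulr0 ?mulr1.
pose t := p 0 o1 / p 0 o0.
have p2E : p 0 o2 = t ^+ 2 * p 0 o0.
  by apply: (mulfI p00); rewrite -qp /t; field.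
have p1E : p 0 o1 = t * p 0 o0 by rewrite /t divfK.
have t5 : t ^+ 5 = t.
  (* The Hermitian equation after substituting the two coordinates expressed through [t]; the factor
     [p 0 o0 ^+ 6] comes from homogeneity. *)
  have /eqP : (t ^+ 5 - t) ^+ 2 * p 0 o0 ^+ 6 = 0.
    by rewrite -[RHS]Jp p2E p1E; ring.
  rewrite mulf_eq0 !expf_eq0 (negPf p00) orbF /= subr_eq0.
  by move/eqP.
have [y yE] := fixed_ev5 t5.
exists (N1, y).
  by rewrite mem_rcons inE; apply/orP; right; apply: map_f; case: y {yE}.
apply/(spansZ _ _ p00); rewrite scalemxAl.
suff -> : p 0 o0 *: evv (veronese25 (N1, y)) = p by [].
have e1 : ev5 k N1 = 1 by [].
by apply: row3P; rewrite !mxE /= ?ev_int ?(ev5M char5) ?yE ?e1 ?p2E ?p1E; ring.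
Qed.

Lemma collinear25C u v : collinear25 u v = collinear25 v u.
Proof. by rewrite !(collinear25P char5 r2) crossC oppr_eq0. Qed.

Lemma pairwise_collinear (T : eqType) (s : seq T) (f : T -> vec25) x y :
  pairwise (fun x y => ~~ collinear25 (f x) (f y)) s -> x \in s -> y \in s ->
  collinear25 (f x) (f y) -> x = y.
Proof.
move=> ps xs ys cxy; apply/eqP; apply: contraTT cxy => xy.
by apply: (pairwise_rel _ ps) => // a b; rewrite collinear25C.
Qed.

Lemma spans_collinear M u v (P : Defs.point k) : M \in unitmx ->
  spans (evv u *m M) P -> spans (evv v *m M) P -> collinear25 u v.
Proof.
move=> Mu uP vP; have [c c0 /(congr1 (mulmx^~ (invmx M)))] := spans_scale uP vP.
rewrite -scalemxAl -!mulmxA !mulmxV // !mulmx1 (collinear25P char5 r2) => ->.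
by rewrite crossZr cross_self scaler0.
Qed.

Lemma ev_row_neq0 M v : M \in unitmx -> v != (zero25, zero25, zero25) ->
  evv v *m M != 0.
Proof.
move=> Mu v0; have : evv v != 0 by rewrite (evv_eq0 char5 r2).
apply: contraNneq => vM; apply/eqP.
by rewrite -[evv v]mulmx1 -(mulmxV Mu) mulmxA vM mul0mx.
Qed.

Lemma veronese25_neq0 w : w \in line5 -> veronese25 w != (zero25, zero25, zero25).
Proof. by move: w; apply/allP. Qed.

Lemma card_conic_gamma M (Q : curve k 2) : hframe M ->
  defines (frame_curve M true) Q -> points Q `&` points Gamma #= `I_6.
Proof.
move=> hM MQ; have [Mu _] := hM.
apply: (@card_eq_II_rel _ _ _ line5 (fun w P => spans (evv (veronese25 w) *m M) P)) => //.
- move=> w w5.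
  have [|P MP] := @spans_exists _ _ (evv (veronese25 w) *m M).
    by apply: ev_row_neq0 => //; exact: veronese25_neq0.
  by exists P => //; apply/(conic_gamma_points _ hM MQ); exists w.
- by move=> P /(conic_gamma_points _ hM MQ).
- move=> p q P p5 q5 pP qP; apply: (pairwise_collinear veronese25_noncollinear) => //.
  exact: spans_collinear pP qP.
- by move=> w P P'; exact: spans_uniq.
Qed.

(** Any ordered pair of contact points can be made the end rows of a frame of the same conic, so
    local statements need proof only at the first row. *)
Lemma sym25_frame M (Q : curve k 2) w : w \in ordered_pairs5 -> hframe M ->
  defines (frame_curve M true) Q ->
  [/\ hframe (evm (sym25 w) *m M), defines (frame_curve (evm (sym25 w) *m M) true) Q,
      row o0 (evm (sym25 w) *m M) = evv (veronese25 w.1) *m M &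
      row o2 (evm (sym25 w) *m M) = evv (veronese25 w.2) *m M].
Proof.
move=> /sym25_spec /hasP [c c1 /andP [/eqP gE /eqP cE]] hM MQ.
have c0 : ev c != 0.
  by move: c1; rewrite (ev_eq0 char5 r2) !inE => /orP [] /eqP ->.
have {}gE : gram (herm_mx k) (evm (sym25 w)) = ev c *: herm_mx k.
  by rewrite -(evm_gram char5 r2) gE (evm_scale char5 r2) (evm_herm char5).
have {}cE : (evm (sym25 w))^T *m dual_conic_mx k *m evm (sym25 w) = ev c *: dual_conic_mx k.
  by rewrite -(evm_conic char5 r2) cE (evm_scale char5 r2) (evm_dual_conic char5).
have [Mu _] := hM; split.
- exact: similitude_frame gE hM.
- by apply: (frame_reparam char5 (c := ev c)) => //; exact: similitude_unit gE.
- case: w {gE cE} => -[s1 t1] [s2 t2]; rewrite row_mul; congr (_ *m _).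
  by apply/rowP; elim/ord3_ind; rewrite !mxE.
- case: w {gE cE} => -[s1 t1] [s2 t2]; rewrite row_mul; congr (_ *m _).
  by apply/rowP; elim/ord3_ind; rewrite !mxE.
Qed.

Lemma line5_pair w (w5 : w \in line5) : exists w', (w, w') \in ordered_pairs5.
Proof.
by exists (if w == (N0, N1) then (N1, N0) else (N0, N1)); move: w w5; apply/allP.
Qed.

Lemma frame_tangent_mult M (Q : curve k 2) P : hframe M ->
  defines (frame_curve M true) Q -> spans (row o0 M) P ->
  intersection_mult Q Gamma P 2.
Proof.
move=> [Mu [c c0 ME]] MQ MP.
(* The cofactor comes from t^2 - 2 t^6 + t^10 = t^2 (1 - t^4)^2. *)
apply: (frame_intersection_mult Mu MQ GammaE MP (g := c *: (1 - 'X^4) ^+ 2)).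
  rewrite (conic_polyE char5) ME /conic_poly !sum3E !mxE /= -!mul_polyC.
  by rewrite !polyCM !polyCN !polyC0 !polyC1; ring.
by rewrite hornerZ horner_exp hornerD hornerN hornerC hornerXn expr0n subr0 expr1n mulr1.
Qed.

(** The first row of [herm_mx] is the third unit vector, so the tangent is the frame line z = 0; on
    its points (1, t, 0) the form reduces to -2 c t^6. *)
Lemma frame_weierstrass M P : hframe M -> spans (row o0 M) P -> weierstrass Gamma P.
Proof.
move=> [Mu [c c0 ME]] MP.
have GP : points Gamma P.
  apply/(points_eval GammaE MP); rewrite rowE (eval_gram char5) frob_delta ME.
  by rewrite -rowE trmx_delta -colE !mxE mulr0.
have l2 : frame_form M o2 != 0.
  rewrite linear_form_eq0 colE; apply: contraTneq isT => e.
  have /colP /(_ o2) : delta_mx o2 0 = 0 :> 'cV[k]_3.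
    by rewrite -[delta_mx o2 0]mul1mx -(mulmxV Mu) -mulmxA e mulmx0.
  by rewrite !mxE => /eqP; rewrite oner_eq0.
have [L ML] := defines_exists (frame_form_homog M o2) l2.
exists L.
  split=> //; case: (GammaE) => e e0 GE; case: (MP) => f f0 PE; case: (ML) => g g0 LE.
  exists (e * f ^+ 5 * c / g).
    by rewrite !mulf_neq0 ?invr_eq0 ?expf_neq0.
  rewrite LE scalerA divfK // /frame_form -linear_formZ.
  apply: eq_bigr => i _; congr (_ *: _).
  rewrite GE mderivZ /value mevalZ -/(eval _ (proj_rep P)) mderiv_hermitian // PE.
  have fH : frob M *m H = c *: (herm_mx k *m (invmx M)^T).
    by rewrite scalemxAl -ME /gram -!mulmxA -trmx_mul mulVmx // trmx1 mulmx1.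
  have rowH : frob (row o0 M) *m H = c *: (row o0 (herm_mx k) *m (invmx M)^T).
    have -> : frob (row o0 M) = row o0 (frob M) by apply/rowP => j; rewrite !mxE.
    by rewrite -row_mul fH linearZ /= row_mul.
  have JE : row o0 (herm_mx k) = delta_mx 0 o2.
    by apply/rowP; elim/ord3_ind; rewrite !mxE.
  rewrite (frobZ _ (row o0 M)) -scalemxAl rowH JE -rowE !mxE.
  by rewrite !mulrA.
apply: intersection_mult_sym.
apply: (frame_intersection_mult (b := false) Mu ML GammaE MP (g := - (c *+ 2)%:P)).
  rewrite (subst_gram char5) ME !(mxE, sum3E) /=.
  by rewrite !polyCM !polyCN !polyC0 !polyC1 polyCMn; ring.
rewrite hornerN hornerC oppr_eq0 -mulr_natr mulf_neq0 //.
exact: two_neq0 char5.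
Qed.

Lemma hframe_totally_tangent M (Q : curve k 2) : hframe M ->
  defines (frame_curve M true) Q -> totally_tangent_conic Gamma Q.
Proof.
move=> hM MQ; have [Mu _] := hM; split; last first.
- move=> P /(conic_gamma_points _ hM MQ) [w /line5_pair [w' ww'] MP].
  have [hN NQ N0 _] := sym25_frame ww' hM MQ.
  by apply: frame_tangent_mult hN NQ _; rewrite N0.
- exact: card_conic_gamma MQ.
move=> P QP; case: (MQ) => e e0 QE; pose S := invmx M *m conic_mx k *m (invmx M)^T.
have two0 := two_neq0 char5.
have Su : S \in unitmx.
  have [cu _] := mulmx1_unit (conic_mx_dual two0).
  by rewrite !unitmx_mul unitmx_tr unitmx_inv Mu cu.
have symS : S^T = S.
  rewrite /S !trmx_mul trmxK !mulmxA; congr (_ *m _ *m _).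
  by by_coords.
(* The gradient of the conic at [P] is, up to a nonzero scalar, the vector of [P] times the
   invertible matrix [S]. *)
have /row3_neq0 [i vSi] : proj_rep P *m S != 0.
  apply: contraNneq (proj_rep_neq0 P) => vS; apply/eqP.
  by rewrite -[proj_rep P]mulmx1 -(mulmxV Su) mulmxA vS mul0mx.
exists i; rewrite QE frame_curve_quadratic // mderivZ mderiv_quadratic //.
rewrite /value !mevalZ -/(eval _ _) eval_linear colE mulmxA -colE mxE.
by apply/eqP; rewrite !mulf_neq0.
Qed.

Lemma conic_gamma_weierstrass M (Q : curve k 2) : hframe M ->
  defines (frame_curve M true) Q -> points Q `&` points Gamma `<=` weierstrass Gamma.
Proof.
move=> hM MQ P /(conic_gamma_points _ hM MQ) [w /line5_pair [w' ww'] MP].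
have [hN NQ N0 _] := sym25_frame ww' hM MQ.
by apply: frame_weierstrass hN _; rewrite N0.
Qed.

End Converse.

Lemma mem_enum25 x : x \in enum25.
Proof. by case: x; do 2!case. Qed.

Lemma mem_normal_vecs25 y z :
  ((one25, y, z) \in normal_vecs25) && ((zero25, one25, z) \in normal_vecs25).
Proof.
have h1 : (one25, y, z) \in [seq (one25, y, z) | y <- enum25, z <- enum25].
  by apply: allpairs_f; exact: mem_enum25.
have h2 : (zero25, one25, z) \in [seq (zero25, one25, z) | z <- enum25].
  by apply: map_f; exact: mem_enum25.
move: h1 h2; rewrite /normal_vecs25.
move: [seq (zero25, one25, z) | z <- enum25] (flatten _) => A B hB hA.
by rewrite !in_cons !mem_cat hA hB !orbT.
Qed.

(** * Rationality of the Weierstrass points *)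

Section Weierstrass.
Variable k : closedFieldType.
Hypothesis char5 : 5%N \in [pchar k].
Variable r : k.
Hypothesis r2 : r ^+ 2 = 2%:R.
Local Notation ev := (ev r).
Local Notation evv := (evv r).
Local Notation evm := (evm r).
Variables (H : 'M[k]_3) (Gamma : curve k 6).
Hypothesis H_unit : H \in unitmx.
Hypothesis GammaE : defines (hermitian_form H) Gamma.
Local Notation hframe := (hermitian_frame H).

(** The kernel of [d] has rank at least 2, so it is not contained in the line spanned by [v]. *)
Lemma orthogonal_row (v : 'rV[k]_3) (d : 'cV[k]_3) : v != 0 ->
  exists2 w, w *m d = 0 & cross v w != 0.
Proof.
move=> v0; have [i Ki] : exists i, ~~ (row i (kermx d) <= v)%MS.
  apply/existsP; apply: contraT; rewrite negb_exists => /forallP h.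
  have /mxrankS : (kermx d <= v)%MS.
    by apply/row_subP => i; have := h i; rewrite negbK.
  rewrite mxrank_ker; have := rank_leq_col d; have := rank_leq_row v; lia.
exists (row i (kermx d)); first by rewrite -row_mul mulmx_ker row0.
apply: contraNneq Ki => /(cross_eq0 v0) [c ->]; exact: scalemx_sub.
Qed.

(** Here [w] is a second point of the tangent, which gives the first two relations. The third
    records that the multiplicity is 6: if it failed, the multiplicity would be 5. *)
Lemma weierstrass_isotropic P : weierstrass Gamma P ->
  exists v w : 'rV[k]_3, [/\ spans v P, cross v w != 0, frob v *m H *m v^T = 0,
     frob v *m H *m w^T = 0 & frob w *m H *m v^T = 0].
Proof.
move=> [L [GP [c c0 LE]] mult6]; pose v : 'rV[k]_3 := proj_rep P.
have vP : spans v P by exact: spans_rep.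
pose d := (frob v *m H)^T.
have [e e0 GE] := GammaE.
have Ld : defines (linear_form d) L.
  have E : e *: linear_form d = c *: equation L.
    rewrite -LE -linear_formZ; apply: eq_bigr => i _; congr (_ *: _).
    by rewrite GE mderivZ /value mevalZ -/(eval _ (proj_rep P)) mderiv_hermitian // !mxE.
  apply/(definesZ _ _ e0); rewrite E; apply/(definesZ _ _ c0).
  exact: defines_equation.
have vv : frob v *m H *m v^T = 0.
  apply/matrixP => i j; rewrite !ord1 [RHS]mxE.
  have := proj1 (points_eval GammaE vP) GP.
  by rewrite -[eval _ v]/(subst idfun v (hermitian_form H)) subst_hermitian map_mx_id.
have [w wd vw] := orthogonal_row d (proj_rep_neq0 P).
have [N Nu [N0 N1]] := cross_basis vw.
have vHw : frob v *m H *m w^T = 0.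
  by rewrite -[LHS]trmxK trmx_mul trmxK wd trmx0.
exists v, w; split=> //; apply/eqP; apply: contraT => wHv.
pose h10 := (frob w *m H *m v^T) 0 0.
have h10_neq0 : h10 != 0.
  by apply: contraNneq wHv => h; apply/eqP/matrixP => i j; rewrite !ord1 [RHS]mxE.
have NP : spans (row o0 N) P by rewrite N0.
have NL : defines (frame_curve N false) L.
  have rowNd i : (N *m d) i 0 = (row i N *m d) 0 0 by rewrite -row_mul [RHS]mxE.
  have Nd : N *m d = (N *m d) o2 0 *: delta_mx o2 0.
    apply/colP; elim/ord3_ind; rewrite [RHS]mxE [delta_mx _ _ _ _]mxE /=.
    - by rewrite rowNd N0 -[v *m d]trmxK trmx_mul trmxK vv trmx0 mxE mulr0.
    - by rewrite rowNd N1 wd mxE mulr0.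
    by rewrite mulr1.
  have dE : d = (N *m d) o2 0 *: col o2 (invmx N).
    by rewrite colE scalemxAr -Nd mulmxA mulVmx // mul1mx.
  have d0 : (N *m d) o2 0 != 0.
    apply: contraTneq (defines_neq0 Ld) => d0; rewrite dE d0 scale0r.
    by rewrite linear_form0 eqxx.
  by apply/(definesZ _ _ d0); rewrite -linear_formZ -dE.
have gramE i j : gram H N i j = (frob (row i N) *m H *m (row j N)^T) 0 0.
  have -> : frob (row i N) = row i (frob N) by apply/rowP => a; rewrite !mxE.
  by rewrite mul_tr_row -!row_mul [RHS]mxE.
(* On v + t w the constant and linear terms vanish, leaving terms in t^5 and t^6; a nonzero [h10]
   makes the order exactly 5. *)
have fE : subst (@polyC k) (param k false *m map_mx (@polyC k) N) (hermitian_form H) =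
    'X^5 * (h10%:P + (gram H N o1 o1)%:P * 'X).
  rewrite (subst_gram char5).
  have g00 : gram H N o0 o0 = 0 by rewrite gramE N0 vv mxE.
  have g01 : gram H N o0 o1 = 0 by rewrite gramE N0 N1 vHw mxE.
  have g10 : gram H N o1 o0 = h10 by rewrite gramE N0 N1.
  move: (gram H N) g00 g01 g10 => G g00 g01 g10.
  by rewrite !(mxE, sum3E) /= g00 g01 g10 !polyC0; ring.
have := frame_intersection_mult Nu NL GammaE NP fE.
rewrite hornerD hornerM hornerX mulr0 addr0 hornerC => /(_ h10_neq0).
by move/intersection_mult_sym/(intersection_mult_uniq mult6).
Qed.

(** The three relations force p^(25) to be proportional to p, for the coordinates p of the point in
    the frame; ratios of coordinates then lie in F_25. *)
Lemma weierstrass_rational M P : hframe M -> weierstrass Gamma P ->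
  exists u, [/\ u \in normal_vecs25, form25 u = zero25 & spans (evv u *m M) P].
Proof.
move=> [Mu [c c0 ME]] /weierstrass_isotropic [v [w [vP vw vv vHw wHv]]].
pose p := v *m invmx M; pose q := w *m invmx M.
have vE : v = p *m M by rewrite -mulmxA mulVmx // mulmx1.
have wE : w = q *m M by rewrite -mulmxA mulVmx // mulmx1.
clearbody p q.
have form x y : frob (x *m M) *m H *m (y *m M)^T = 0 ->
    frob x *m herm_mx k *m y^T = 0.
  move=> xy; have : c *: (frob x *m herm_mx k *m y^T) = 0.
    by rewrite -xy scalemxAl scalemxAr -ME (frobM char5 idfun) trmx_mul /gram !mulmxA.
  by move/(congr1 ( *:%R c^-1)); rewrite scalerA mulVf // scale1r scaler0.
have pp : frob p *m herm_mx k *m p^T = 0 by apply: form; rewrite -vE.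
have pq : frob p *m herm_mx k *m q^T = 0 by apply: form; rewrite -vE -wE.
have qp : frob q *m herm_mx k *m p^T = 0 by apply: form; rewrite -vE -wE.
have frobJ : frob (herm_mx k) = herm_mx k.
  by rewrite -(evm_herm char5 r) -(evm_conj char5 r2).
have trJ : (herm_mx k)^T = herm_mx k by by_coords.
(* Frobenius followed by transposition, [herm_mx] being symmetric with entries in F_5. *)
have twist x y : frob x *m herm_mx k *m y^T = 0 ->
    frob y *m herm_mx k *m (frob (frob x))^T = 0.
  move=> /(congr1 (fun A => (frob A)^T)).
  rewrite !(frobM char5 idfun) frobJ !trmx_mul frob_tr !trmxK trJ mulmxA => ->.
  by apply/matrixP => i j; rewrite !mxE expr0n.
have p_neq0 : p != 0.
  apply: contraNneq vw => p0; rewrite vE p0 mul0mx.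
  by apply/eqP/row3P; rewrite !mxE /= ?mul0r ?subrr.
have cpq : cross (frob p) (frob q) != 0.
  have -> : cross (frob p) (frob q) = frob (cross p q).
    have frobB x y : (x - y) ^+ 5 = x ^+ 5 - y ^+ 5 :> k.
      exact: (rmorphB (pFrobenius_aut char5)).
    by apply: row3P; rewrite !mxE /= frobB !exprMn.
  have : cross p q != 0.
    apply: contraNneq vw => /(cross_eq0 p_neq0) [e qE].
    by rewrite wE qE -scalemxAl -vE crossZr cross_self scaler0.
  move=> /row3_neq0 [i ci]; apply: contraNneq ci => /rowP /(_ i).
  by rewrite !mxE => /eqP; rewrite expf_eq0.
(* Both J p^T and J (p^(25))^T are orthogonal to [frob p] and [frob q], hence are multiples of the
   same cross product. *)
have [a aE] := orthogonal_cross cpq (etrans (mulmxA _ _ _) pp) (etrans (mulmxA _ _ _) qp).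
have [b bE] := orthogonal_cross cpq (etrans (mulmxA _ _ _) (twist _ _ _ _ pp)) (etrans (mulmxA _ _ _) (twist _ _ _ _ pq)).
have Ju := herm_unit char5.
have cancelJ (x y : 'rV[k]_3) : herm_mx k *m x^T = herm_mx k *m y^T -> x = y.
  move=> /(congr1 (mulmx (invmx (herm_mx k)))).
  by rewrite !mulmxA mulVmx // !mul1mx => /trmx_inj.
have a0 : a != 0.
  apply: contraNneq p_neq0 => a0; apply/eqP/cancelJ.
  by rewrite aE a0 scale0r trmx0 mulmx0.
have ppE : frob (frob p) = (b / a) *: p.
  apply: cancelJ; rewrite bE linearZ /= -scalemxAr aE scalerA.
  by rewrite divfK.
(* All coordinates acquire the same factor [b / a] under the 25th power, so it cancels in ratios. *)
have rational i j : p 0 i != 0 -> exists y, ev y = p 0 j / p 0 i.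
  move=> pi; apply: (ev_surj char5 r2).
  have pX25 l : p 0 l ^+ 25 = b / a * p 0 l.
    by have /rowP /(_ l) := ppE; rewrite !mxE -exprM.
  have : b / a * p 0 i != 0 by rewrite -pX25 expf_neq0.
  rewrite mulf_eq0 negb_or => /andP [ba0 _].
  by rewrite expr_div_n !pX25 -mulf_div divff // mul1r.
have pP : spans (p *m M) P by rewrite -vE.
have form_u u c' : c' != 0 -> p = c' *: evv u -> form25 u = zero25.
  move=> c'0 pE; apply/eqP; rewrite -(ev_eq0 char5 r2) (ev_form char5 r2).
  have : (c' ^+ 5 * c') *: (frob (evv u) *m herm_mx k *m (evv u)^T) = 0.
    rewrite -[RHS]pp pE (frobZ _ (evv u)) linearZ /= -!scalemxAl -scalemxAr scalerA.
    by rewrite mulrC.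
  move/matrixP/(_ 0 0); rewrite mxE [RHS]mxE => /eqP.
  by rewrite mulf_eq0 mulf_eq0 expf_eq0 (negPf c'0).
suff [u [c' [u25 c'0 pE]]] : exists u c', [/\ u \in normal_vecs25, c' != 0 & p = c' *: evv u].
  exists u; split=> //; first exact: form_u pE.
  by apply/(spansZ _ _ c'0); rewrite scalemxAl -pE.
have [p0|p0] := eqVneq (p 0 o0) 0; last first.
  have [y yE] := rational o0 o1 p0; have [z zE] := rational o0 o2 p0.
  exists (one25, y, z), (p 0 o0); split=> //.
    by have /andP [] := mem_normal_vecs25 y z.
  by apply: row3P; rewrite !mxE /= ?ev1 ?yE ?zE ?mulr1 //; rewrite mulrC divfK.
have [p1|p1] := eqVneq (p 0 o1) 0; last first.
  have [z zE] := rational o1 o2 p1.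
  exists (zero25, one25, z), (p 0 o1); split=> //.
    by have /andP [] := mem_normal_vecs25 z z.
  by apply: row3P; rewrite !mxE /= ?ev0 ?ev1 ?zE ?p0 ?mulr0 ?mulr1 //; rewrite mulrC divfK.
have p2 : p 0 o2 != 0.
  by apply: contraNneq p_neq0 => p2; apply/eqP/row3P; rewrite ?p0 ?p1 ?p2 mxE.
exists (zero25, zero25, one25), (p 0 o2); split=> //.
by apply: row3P; rewrite !mxE /= ?ev0 ?ev1 ?p0 ?p1 ?mulr0 ?mulr1.
Qed.

End Weierstrass.

(** * Special secants in frame coordinates *)

Section Secants.
Variable k : closedFieldType.
Hypothesis char5 : 5%N \in [pchar k].
Variable r : k.
Hypothesis r2 : r ^+ 2 = 2%:R.
Local Notation ev := (ev r).
Local Notation evv := (evv r).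
Local Notation evm := (evm r).
Variables (H : 'M[k]_3) (Gamma : curve k 6).
Hypothesis H_unit : H \in unitmx.
Hypothesis GammaE : defines (hermitian_form H) Gamma.
Local Notation hframe := (hermitian_frame H).

Lemma linear_form_inj : injective (@linear_form k).
Proof.
move=> d e /eqP; rewrite -subr_eq0 -scaleN1r -linear_formZ -linear_formD.
by rewrite linear_form_eq0 scaleN1r subr_eq0 => /eqP.
Qed.

Lemma line_point d (L : curve k 1) v P : defines (linear_form d) L -> spans v P ->
  points L P <-> v *m d = 0.
Proof.
move=> Ld vP; have -> := points_eval Ld vP; rewrite eval_linear.
by split=> [h|->]; [apply/matrixP => i j; rewrite !ord1 h mxE | rewrite mxE].
Qed.

(** The line with coordinates [l] in the frame: its linear form takes the value x . l at the point
    with frame coordinates x. *)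
Definition frame_line M (l : vec25) : 'cV[k]_3 := invmx M *m (evv l)^T.

Lemma special_secants_of_frame M (Q : curve k 2) L : hframe M ->
  defines (frame_curve M true) Q ->
  special_secants_of Gamma Q L <->
  exists2 l, l \in secants25 & defines (linear_form (frame_line M l)) L.
Proof.
move=> hM MQ; have [Mu _] := hM; split.
  move=> [_ [P [P' [PQ P'Q PP' LP LP']]]].
  have [w w5 wP] := proj1 (conic_gamma_points char5 r2 GammaE _ hM MQ) PQ.
  have [w' w'5 w'P] := proj1 (conic_gamma_points char5 r2 GammaE _ hM MQ) P'Q.
  have ww' : w != w'.
    by apply/eqP => ww; apply: PP'; rewrite -ww in w'P; exact: spans_uniq wP w'P.
  have [d LE] := homog1_linear_form (equation_homog L).
  have Ld : defines (linear_form d) L by rewrite -LE; exact: defines_equation.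
  have wd : evv (veronese25 w) *m (M *m d) = 0.
    by rewrite mulmxA; apply/(line_point Ld wP).
  have w'd : evv (veronese25 w') *m (M *m d) = 0.
    by rewrite mulmxA; apply/(line_point Ld w'P).
  have ww'5 := mem_ordered_pairs5 w5 w'5 ww'.
  have cr : cross (evv (veronese25 w)) (evv (veronese25 w')) != 0.
    rewrite -(collinear25P char5 r2); apply: contraNN ww' => cl; apply/eqP.
    exact: (pairwise_collinear char5 r2 veronese25_noncollinear).
  have [c dE] := orthogonal_cross cr wd w'd.
  have {}dE : d = c *: frame_line M (secant25 (w, w')).
    by rewrite /frame_line (evv_cross char5 r2) scalemxAr -dE mulmxA mulVmx // mul1mx.
  have c0 : c != 0.
    by apply: contraNneq (defines_neq0 Ld) => c0; rewrite dE c0 scale0r linear_form0.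
  have {}Ld : defines (linear_form (frame_line M (secant25 (w, w')))) L.
    by apply/(definesZ _ _ c0); rewrite -linear_formZ -dE.
  have /hasP [l l25 /orP [] /eqP lE] := secant25_mem ww'5; exists l => //.
    by rewrite -lE.
  move: Ld; rewrite lE.
  have -> : frame_line M (scale25 (N4, N0) l) = ev (N4, N0) *: frame_line M l.
    rewrite /frame_line scalemxAr -linearZ; congr (_ *m _^T).
    by apply: row3P; rewrite !mxE /= (evM char5 r2).
  by rewrite linear_formZ => /definesZ; apply; rewrite (ev_eq0 char5 r2).
move=> [_ /mapP [w w5 ->] Lw].
have /ordered_pairs5_mem /and3P [w1 w2 w12] : w \in ordered_pairs5.
  by move: w5; rewrite mem_filter => /andP [].
have pt w' : w' \in line5 -> exists2 P, (points Q `&` points Gamma) P &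
    spans (evv (veronese25 w') *m M) P.
  move=> w'5; have [|P MP] := @spans_exists _ _ (evv (veronese25 w') *m M).
    exact: ev_row_neq0 (veronese25_neq0 w'5).
  by exists P => //; apply/(conic_gamma_points char5 r2 GammaE _ hM MQ); exists w'.
have [P PQ P1] := pt _ w1; have [P' P'Q P2] := pt _ w2.
have PP' : P <> P'.
  move=> PP; rewrite -PP in P2; move/eqP: w12; apply.
  apply: (pairwise_collinear char5 r2 veronese25_noncollinear) => //.
  exact: (spans_collinear char5 r2 Mu P1 P2).
have LP : points L P.
  apply/(line_point Lw P1); rewrite /frame_line -mulmxA (mulmxA M) mulmxV // mul1mx.
  by rewrite (evv_cross char5 r2) dot_cross_l.
have LP' : points L P'.
  apply/(line_point Lw P2); rewrite /frame_line -mulmxA (mulmxA M) mulmxV // mul1mx.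
  by rewrite (evv_cross char5 r2) dot_cross_r.
have sub := conic_gamma_weierstrass char5 r2 GammaE hM MQ.
split; exists P, P'; split=> //; exact: sub.
Qed.

(** This turns the geometric count in the definition of adjacency into a number computed over F_25,
    for any two frames that differ by a matrix over F_25. *)
Lemma card_common_secants U M (Q Q' : curve k 2) : hframe M -> hframe (evm U *m M) ->
  defines (frame_curve M true) Q -> defines (frame_curve (evm U *m M) true) Q' ->
  special_secants_of Gamma Q `&` special_secants_of Gamma Q' #= `I_(size (common25 U)).
Proof.
move=> hM hN MQ NQ; have [Mu _] := hM; have [Nu _] := hN.
have Uu : evm U \in unitmx by move: Nu; rewrite unitmx_mul => /andP [].
have lineN l l' c : evm U *m (evv l)^T = c *: (evv l')^T <->
    frame_line M l = c *: frame_line (evm U *m M) l'.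
  split=> [e|]; rewrite /frame_line.
    rewrite scalemxAr -e -[LHS]mul1mx -(mulVmx Nu) -mulmxA; congr (_ *m _).
    by rewrite mulmxA -(mulmxA _ M) mulmxV // mulmx1.
  move/(congr1 (mulmx (evm U *m M))).
  by rewrite -scalemxAr !mulmxA mulmxV // mul1mx -(mulmxA _ M) mulmxV // mulmx1.
apply: (@card_eq_II_rel _ _ _ (common25 U)
  (fun l L => defines (linear_form (frame_line M l)) L)).
- by rewrite filter_uniq // secants25_uniq.
- move=> l; rewrite mem_filter => /andP [/hasP [l' l'25 cl] l25].
  have l0 := secants25_neq0 l25; have l'0 := secants25_neq0 l'25.
  have [|L Ll] := @defines_exists _ _ _ (linear_form_homog (frame_line M l)).
    rewrite linear_form_eq0; apply: contraNneq l0 => e; rewrite -(evv_eq0 char5 r2).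
    apply/eqP/trmx_inj; rewrite trmx0 -[LHS]mul1mx -(mulmxV Mu) -mulmxA.
    by rewrite -/(frame_line M l) e mulmx0.
  exists L => //; split; first by apply/(special_secants_of_frame _ hM MQ); exists l.
  have evl'0 : evv l' != 0 by rewrite (evv_eq0 char5 r2).
  have [|c cE] := @cross_eq0 _ (evv l') (evv (mulmv25 U l)) evl'0.
    by apply/eqP; rewrite -(collinear25P char5 r2) (collinear25C char5 r2).
  have {}cE : frame_line M l = c *: frame_line (evm U *m M) l'.
    by apply/lineN; rewrite -(evv_mulmv char5 r2) cE linearZ.
  apply/(special_secants_of_frame _ hN NQ); exists l' => //.
  have c0 : c != 0.
    by apply: contraNneq (defines_neq0 Ll) => c0; rewrite cE c0 scale0r linear_form0.
  by apply/(definesZ _ _ c0); rewrite -linear_formZ -cE.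
- move=> L [/(special_secants_of_frame _ hM MQ) [l l25 Ll]].
  move=> /(special_secants_of_frame _ hN NQ) [l' l'25 Ll'].
  have [c c0] := defines_scale Ll' Ll; rewrite -linear_formZ => /linear_form_inj /lineN e.
  exists l => //; rewrite mem_filter l25 andbT; apply/hasP; exists l' => //.
  rewrite (collinear25C char5 r2) (collinear25P char5 r2).
  have -> : evv (mulmv25 U l) = c *: evv l'.
    by apply: trmx_inj; rewrite (evv_mulmv char5 r2) e linearZ.
  by rewrite crossZr cross_self scaler0.
- move=> l m L; rewrite !mem_filter => /andP [_ l25] /andP [_ m25] Ll Lm.
  apply: (pairwise_collinear char5 r2 (f := id) secants25_noncollinear l25 m25).
  have [c c0] := defines_scale Ll Lm; rewrite -linear_formZ => /linear_form_inj.
  rewrite /frame_line scalemxAr => /(congr1 (mulmx M)).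
  rewrite !mulmxA !mulmxV // !mul1mx -linearZ => /trmx_inj mE.
  by rewrite (collinear25P char5 r2) /= mE crossZr cross_self scaler0 eqxx.
- by move=> l L L'; exact: defines_uniq.
Qed.

End Secants.

(** * Adjacent conics *)

Lemma sqr_exists (k : closedFieldType) (x : k) : exists y, y ^+ 2 = x.
Proof.
have [y yE] := @solve_monicpoly k 2 (fun i => if i == 0%N then x else 0) isT.
by exists y; rewrite yE !big_ord_recl big_ord0 /= expr0 mulr1 mul0r !addr0.
Qed.

Section Block.
Variable k : closedFieldType.
Hypothesis two_neq0 : 2%:R != 0 :> k.

(** [None] is the parameter at infinity. *)
Definition conic_param (o : option k) : 'rV[k]_3 :=
  if o is Some t then row3 [:: 1; t; t ^+ 2] else row3 [:: 0; 0; 1].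

Lemma conic_param_neq0 o : conic_param o != 0.
Proof.
case: o => [t|]; apply/eqP => /rowP e.
  by have /eqP := e o0; rewrite !mxE oner_eq0.
by have /eqP := e o2; rewrite !mxE oner_eq0.
Qed.

Lemma conic_param_surj M (Q : curve k 2) P : M \in unitmx ->
  defines (frame_curve M true) Q ->
  points Q P <-> exists o, spans (conic_param o *m M) P.
Proof.
move=> Mu MQ; split=> [QP|[o oP]]; last first.
  by apply/(conic_point Mu MQ oP); case: o {oP} => [t|]; rewrite !mxE /=; ring.
have [p p0 MP] := frame_coords P Mu.
have qp := proj1 (conic_point Mu MQ MP) QP.
have [p00|p00] := eqVneq (p 0 o0) 0.
  have p01 : p 0 o1 = 0.
    by apply/eqP; move/eqP: qp; rewrite p00 mul0r expf_eq0 => /andP [].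
  have p02 : p 0 o2 != 0.
    by apply: contraNneq p0 => p02; apply/eqP/row3P; rewrite ?p00 ?p01 ?p02 mxE.
  exists None; apply/(spansZ _ _ p02); rewrite scalemxAl.
  suff -> : p 0 o2 *: conic_param None = p by [].
  by apply: row3P; rewrite !mxE /= ?p00 ?p01 ?mulr0 ?mulr1.
exists (Some (p 0 o1 / p 0 o0)); apply/(spansZ _ _ p00); rewrite scalemxAl.
suff -> : p 0 o0 *: conic_param (Some (p 0 o1 / p 0 o0)) = p by [].
apply: row3P; rewrite !mxE /= ?mulr1 //; first by rewrite mulrC divfK.
by apply: (mulfI p00); rewrite -qp; field.
Qed.

Lemma conic_param_inj M o o' P : M \in unitmx ->
  spans (conic_param o *m M) P -> spans (conic_param o' *m M) P -> o = o'.
Proof.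
move=> Mu oP o'P; have [c c0 /(congr1 (mulmx^~ (invmx M)))] := spans_scale oP o'P.
rewrite -scalemxAl -!mulmxA !mulmxV // !mulmx1 => /rowP e.
move: (e o0) (e o1) (e o2) => {e}; case: o {oP} => [t|]; case: o' {o'P} => [t'|] //;
  rewrite !mxE /= ?mulr0 ?mulr1.
- by move=> <-; rewrite mul1r => ->.
- by move=> c1; rewrite -c1 eqxx in c0.
by move=> /eqP; rewrite oner_eq0.
Qed.

Variables a b c d : k.
Hypothesis delta_neq0 : a * d - b * c != 0.

Definition block_mx3 : 'M[k]_3 := mx3 [:: [:: a; 0; b]; [:: 0; 1; 0]; [:: c; 0; d]].

Let alpha := b * d.
Let beta := (a * d - b * c) ^+ 2 - (a * d + b * c).
Let gamma := a * c.

(** At infinity, a root of the binary quartic amounts to the vanishing of the leading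
    coefficient. *)
Definition quartic_root (o : option k) : Prop :=
  if o is Some t then gamma * t ^+ 4 + beta * t ^+ 2 + alpha = 0 else gamma = 0.

Lemma block_mx3_unit : block_mx3 \in unitmx.
Proof.
suff /mulmx1_unit [] : block_mx3 *m mx3 [:: [:: d / (a * d - b * c); 0; - b / (a * d - b * c)];
   [:: 0; 1; 0]; [:: - c / (a * d - b * c); 0; a / (a * d - b * c)]] = 1%:M by [].
by by_coords; try ring; field.
Qed.

Section Pair.
Variables (M : 'M[k]_3) (Q Q' : curve k 2).
Hypothesis Mu : M \in unitmx.
Hypothesis MQ : defines (frame_curve M true) Q.
Hypothesis MQ' : defines (frame_curve (block_mx3 *m M) true) Q'.

Lemma block_conic_points P : (points Q `&` points Q') P <->
  exists2 o, quartic_root o & spans (conic_param o *m M) P.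
Proof.
have BMu : block_mx3 *m M \in unitmx by rewrite unitmx_mul block_mx3_unit.
have key o : spans (conic_param o *m M) P -> points Q' P <-> quartic_root o.
  set p := conic_param o => oP.
  pose delta := a * d - b * c.
  (* The coordinates of the point in the second frame, that is [p] times the inverse block; only
     even powers of t survive in its conic equation. *)
  pose p' := row3 [:: (d * p 0 o0 - c * p 0 o2) / delta; p 0 o1;
                      (a * p 0 o2 - b * p 0 o0) / delta].
  have pE : p = p' *m block_mx3.
    clearbody p; apply: row3P; rewrite !(mxE, sum3E) /= /delta; try ring; by field.
  have -> := conic_point BMu MQ' (p := p') (P := P); last first.
    by rewrite mulmxA -pE.
  have d0 : delta != 0 by [].
  have -> : (p' 0 o1 ^+ 2 = p' 0 o0 * p' 0 o2) <->
     delta ^+ 2 * p 0 o1 ^+ 2 = (d * p 0 o0 - c * p 0 o2) * (a * p 0 o2 - b * p 0 o0).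
    rewrite !mxE /=; split=> [->|e]; first by field.
    by apply: (mulfI (expf_neq0 2 d0)); rewrite e; field.
  rewrite /p /quartic_root; case: (o) => [t|]; rewrite !mxE /=.
    split=> /eqP e; apply/eqP; move: e; rewrite -subr_eq0 => /eqP e.
      by rewrite -e /alpha /beta /gamma /delta; apply/eqP; ring.
    by rewrite -subr_eq0 -[X in _ == X]e /alpha /beta /gamma /delta; apply/eqP; ring.
  split=> e.
    have -> : gamma = - ((d * 0 - c * 1) * (a * 1 - b * 0)) by rewrite /gamma; ring.
    by rewrite -e; ring.
  have -> : (d * 0 - c * 1) * (a * 1 - b * 0) = - gamma by rewrite /gamma; ring.
  by rewrite e; ring.
split=> [[QP Q'P]|[o oroot oP]].
  by have [o oP] := proj1 (conic_param_surj P Mu MQ) QP; exists o => //; apply/key.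
split; first by apply/(conic_param_surj P Mu MQ); exists o.
exact/(key o oP).
Qed.

Lemma block_conic_card4 : alpha * gamma != 0 -> beta ^+ 2 != 4%:R * (alpha * gamma) ->
  points Q `&` points Q' #= `I_4.
Proof.
rewrite mulf_eq0 negb_or => /andP [al0 ga0] disc.
(* [e] is a square root of the discriminant of the quadratic in t^2, whose roots are [u ^+ 2] and
   [v ^+ 2]. *)
have [e eE] := sqr_exists (beta ^+ 2 - 4%:R * (alpha * gamma)).
have e0 : e != 0 by apply: contraNneq disc => e0; rewrite -subr_eq0 -eE e0 expr0n.
have [u uE] := sqr_exists ((e - beta) / (2%:R * gamma)).
have [v vE] := sqr_exists ((- e - beta) / (2%:R * gamma)).
have den0 : 2%:R * gamma != 0 by rewrite mulf_neq0.
have uv : gamma * (u ^+ 2 * v ^+ 2) = alpha.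
  rewrite uE vE; apply: (mulfI (expf_neq0 2 den0)).
  transitivity (gamma * (beta ^+ 2 - e ^+ 2)); first by field; rewrite ?two_neq0 ?ga0.
  by rewrite eE; ring.
have quarticE t : gamma * t ^+ 4 + beta * t ^+ 2 + alpha =
    gamma * (t ^+ 2 - u ^+ 2) * (t ^+ 2 - v ^+ 2).
  have sum_uv : gamma * (u ^+ 2 + v ^+ 2) = - beta by rewrite uE vE; field; rewrite ?two_neq0 ?ga0 .
  transitivity (gamma * t ^+ 4 - gamma * (u ^+ 2 + v ^+ 2) * t ^+ 2 + gamma * (u ^+ 2 * v ^+ 2)).
    by rewrite uv sum_uv; ring.
  by ring.
have uv2 : u ^+ 2 != v ^+ 2.
  rewrite -subr_eq0; have -> : u ^+ 2 - v ^+ 2 = e / gamma.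
    by rewrite uE vE; field; rewrite ?two_neq0 ?ga0 .
  by rewrite mulf_neq0 ?invr_eq0.
have uv0 : u ^+ 2 * v ^+ 2 != 0.
  by apply: contraNneq al0 => e1; rewrite -uv e1 mulr0.
move: uv0; rewrite mulf_eq0 !expf_eq0 negb_or /= => /andP [u0 v0].
have opp_neq (x : k) : x != 0 -> x != - x.
  move=> x0; rewrite -subr_eq0 opprK -mulr2n -mulr_natr mulf_neq0 //.
apply: (@card_eq_II_rel _ _ _ [:: u; - u; v; - v] (fun t P => spans (conic_param (Some t) *m M) P)).
- have sq (x y : k) : x ^+ 2 != y ^+ 2 -> x != y by apply: contraNneq => ->.
  have n1 : u != v by apply: sq.
  have n2 : u != - v by apply: sq; rewrite sqrrN.
  have n3 : - u != v by apply: sq; rewrite sqrrN.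
  have n4 : - u != - v by apply: sq; rewrite !sqrrN.
  by rewrite /= !inE !negb_or (opp_neq u u0) (opp_neq v v0) n1 n2 n3 n4.
- move=> t tuv; have [|P tP] := @spans_exists _ _ (conic_param (Some t) *m M).
    apply: contraNneq (conic_param_neq0 (Some t)) => tM.
    by rewrite -[conic_param _]mulmx1 -(mulmxV Mu) mulmxA tM mul0mx.
  exists P => //; apply/block_conic_points; exists (Some t) => //=.
  rewrite quarticE; move: tuv; rewrite !inE => /or4P [] /eqP ->; rewrite ?sqrrN subrr ?mulr0 ?mul0r //.
- move=> P /block_conic_points [[t|] /= root tP]; last by rewrite root eqxx in ga0.
  exists t => //; move/eqP: root; rewrite quarticE -mulrA mulf_eq0 (negPf ga0) /= mulf_eq0 !subr_eq0 !eqf_sqr.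
  by rewrite !inE -orbA.
- by move=> t t' P _ _ tP t'P; have [] := conic_param_inj Mu tP t'P.
- by move=> t P P'; exact: spans_uniq.
Qed.

(** If the condition fails, a nonzero even quartic has at most three roots on the projective line,
    since some coincide at 0, at infinity or in pairs. *)
Lemma block_conic_card4_inv : points Q `&` points Q' #= `I_4 ->
  (alpha, beta, gamma) != (0, 0, 0) ->
  (alpha * gamma != 0) && (beta ^+ 2 != 4%:R * (alpha * gamma)).
Proof.
move=> /card_eq_II_fun [f fQ f_inj] abc; apply: contraT => bad.
have [s s3 roots] : exists2 s : seq (option k), (size s <= 3)%N &
    forall o, quartic_root o -> o \in s.
  have [ga0|ga0] := eqVneq gamma 0.
    have [be0|be0] := eqVneq beta 0.
      exists [:: None] => // -[t|] //=; rewrite ga0 be0 !mul0r !add0r => al0.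
      by move: abc; rewrite ga0 be0 al0 eqxx.
    have [u uE] := sqr_exists (- alpha / beta).
    exists [:: None; Some u; Some (- u)] => // -[t|] //=.
    rewrite ga0 mul0r add0r => e.
    have : t ^+ 2 == u ^+ 2.
      apply/eqP; rewrite uE; apply: (mulfI be0); transitivity (- alpha).
        by apply/eqP; rewrite -addr_eq0 e.
      by field.
    by rewrite eqf_sqr !inE /= => /orP [] /eqP ->; rewrite eqxx ?orbT.
  have [al0|al0] := eqVneq alpha 0.
    have [u uE] := sqr_exists (- beta / gamma).
    exists [:: Some 0; Some u; Some (- u)] => // -[t|] //=; last by move/eqP; rewrite (negPf ga0).
    rewrite al0 addr0 => e; have /eqP : t ^+ 2 * (t ^+ 2 - u ^+ 2) = 0.
      apply: (mulfI ga0); rewrite mulr0 -e uE; field.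
      by [].
    rewrite mulf_eq0 expf_eq0 /= subr_eq0 eqf_sqr !inE /=.
    by move=> /or3P [] /eqP ->; rewrite eqxx ?orbT.
  have disc : beta ^+ 2 = 4%:R * (alpha * gamma).
    by move: bad; rewrite mulf_neq0 //= negbK => /eqP.
  have four0 : 4%:R != 0 :> k by rewrite (natrM _ 2 2) mulf_neq0.
  have [u uE] := sqr_exists (- beta / (2%:R * gamma)).
  exists [:: Some u; Some (- u)] => // -[t|] //=; last by move/eqP; rewrite (negPf ga0).
  move=> e; have : (t ^+ 2 - u ^+ 2) ^+ 2 == 0.
    apply/eqP; apply: (mulfI ga0); rewrite mulr0 -e uE.
    have -> : alpha = beta ^+ 2 / (4%:R * gamma).
      by rewrite disc; field; rewrite ?ga0 ?four0.
    by field; rewrite ?ga0 ?two_neq0 ?four0.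
  rewrite expf_eq0 /= subr_eq0 eqf_sqr !inE /=.
  by move=> /orP [] /eqP ->; rewrite eqxx ?orbT.
have /boolp.choice [g gP] : forall i, exists o,
    quartic_root o /\ spans (conic_param o *m M) (f i).
  by move=> i; have /block_conic_points [o ? ?] := fQ i; exists o.
have g_inj : injective g.
  move=> i j gij; apply: f_inj; have [_ iP] := gP i; have [_ jP] := gP j.
  by apply: spans_uniq iP _; rewrite gij.
have : (size (map g (enum 'I_4)) <= size s)%N.
  apply: uniq_leq_size; first by rewrite (map_inj_uniq g_inj) enum_uniq.
  by move=> _ /mapP [i _ ->]; apply: roots; have [] := gP i.
by rewrite size_map size_enum_ord leqNgt (leq_ltn_trans s3).
Qed.

End Pair.
End Block.

Section Adjacency.
Variable k : closedFieldType.
Hypothesis char5 : 5%N \in [pchar k].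
Variable r : k.
Hypothesis r2 : r ^+ 2 = 2%:R.
Local Notation ev := (ev r).
Local Notation evv := (evv r).
Local Notation evm := (evm r).
Variables (H : 'M[k]_3) (Gamma : curve k 6).
Hypothesis H_unit : H \in unitmx.
Hypothesis GammaE : defines (hermitian_form H) Gamma.
Local Notation hframe := (hermitian_frame H).

Lemma evm_block a b c d :
  evm (block25 a b c d) = block_mx3 (ev a) (ev b) (ev c) (ev d).
Proof. by by_coords; rewrite ?ev0 ?ev1. Qed.

Lemma quartic25E a b c d (q := quartic25 a b c d) :
  [/\ ev q.1.1 = ev b * ev d,
      ev q.1.2 = (ev a * ev d - ev b * ev c) ^+ 2 - (ev a * ev d + ev b * ev c) &
      ev q.2 = ev a * ev c].
Proof.
have evE := (evD char5, evN char5, evM char5 r2).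
by split; rewrite /= !evE // expr2.
Qed.

Lemma four_roots25P a b c d : four_roots25 (quartic25 a b c d) =
  (ev b * ev d * (ev a * ev c) != 0) &&
  (((ev a * ev d - ev b * ev c) ^+ 2 - (ev a * ev d + ev b * ev c)) ^+ 2 !=
     4%:R * (ev b * ev d * (ev a * ev c))).
Proof.
have [<- <- <-] := quartic25E a b c d.
rewrite /four_roots25 -(ev_eq0 char5 r2) (evM char5 r2); congr (_ && ~~ _).
rewrite -(inj_eq (ev_inj char5 r2)) !(evM char5 r2) ev_int expr2.
by [].
Qed.

(** Frobenius and transposition turn V^(5) J V^T = J into V^(5) J (V^(25))^T = J; cancelling V^(5) J
    compares the two. *)
Lemma unitary_rational (V : 'M[k]_3) : gram (herm_mx k) V = herm_mx k ->
  frob (frob V) = V.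
Proof.
move=> VE; have Vu : V \in unitmx.
  by apply: (similitude_unit char5 (oner_neq0 k)); rewrite VE scale1r.
have frobJ : frob (herm_mx k) = herm_mx k.
  by rewrite -(evm_herm char5 r) -(evm_conj char5 r2).
have trJ : (herm_mx k)^T = herm_mx k by by_coords.
have /(congr1 (fun A => (frob A)^T)) := VE.
rewrite /gram !(frobM char5 idfun) frobJ !trmx_mul !frob_tr !trmxK trJ mulmxA.
rewrite -{2}VE /gram => e.
have FJu : frob V *m herm_mx k \in unitmx.
  by rewrite unitmx_mul (frob_unit char5) Vu herm_unit.
exact/trmx_inj/(can_inj (mulKmx FJu)).
Qed.

Lemma block_frame_classification M (Q Q' : curve k 2) (V : 'M[k]_3) :
  hframe M -> defines (frame_curve M true) Q ->
  gram (herm_mx k) V = herm_mx k -> V = block_mx3 (V o0 o0) (V o0 o2) (V o2 o0) (V o2 o2) ->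
  defines (frame_curve (V *m M) true) Q' ->
  points Q `&` points Q' #= `I_4 ->
  special_secants_of Gamma Q `&` special_secants_of Gamma Q' #= `I_3 ->
  exists e, defines (frame_curve (evm (nbr25 e) *m M) true) Q'.
Proof.
move=> hM MQ VE Vblock VQ' card4 card3; have [Mu _] := hM.
have V1E : gram (herm_mx k) V = 1 *: herm_mx k by rewrite scale1r.
have Vu := similitude_unit char5 (oner_neq0 k) V1E.
have rat i j : exists x, ev x = V i j.
  apply: (ev_surj char5 r2).
  by have /matrixP /(_ i j) := unitary_rational VE; rewrite !mxE -exprM.
have [a aE] := rat o0 o0; have [b bE] := rat o0 o2.
have [c cE] := rat o2 o0; have [d dE] := rat o2 o2.
have VA : V = evm (block25 a b c d) by rewrite evm_block aE bE cE dE.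
have evE := (evD char5, evM char5 r2, ev_conj char5 r2).
have entry i j : (frob V *m herm_mx k *m V^T) i j = herm_mx k i j by rewrite -[in RHS]VE.
have xE i j : V i j = evm (block25 a b c d) i j by rewrite {1}VA.
have iso1 : (a, b) \in isotropic_pairs25.
  rewrite mem_filter (allpairs_f (fun x y => (x, y))) ?mem_enum25 // andbT /=.
  apply/eqP/(ev_inj char5 r2); rewrite ev0 !evE.
  have := entry o0 o0; rewrite !(mxE, sum3E) /= !xE !mxE /= ev0 => <-; ring.
have iso2 : (c, d) \in isotropic_pairs25.
  rewrite mem_filter (allpairs_f (fun x y => (x, y))) ?mem_enum25 // andbT /=.
  apply/eqP/(ev_inj char5 r2); rewrite ev0 !evE.
  have := entry o2 o2; rewrite !(mxE, sum3E) /= !xE !mxE /= ev0 => <-; ring.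
have pair1 : add25 (mul25 (conj25 a) d) (mul25 (conj25 b) c) = one25.
  apply/(ev_inj char5 r2); rewrite ev1 !evE.
  have := entry o0 o2; rewrite !(mxE, sum3E) /= !xE !mxE /= ev0 => <-; ring.
have hVM : hframe (evm (block25 a b c d) *m M).
  by rewrite -VA; apply: similitude_frame (oner_neq0 k) V1E hM.
have VAQ : defines (frame_curve (evm (block25 a b c d) *m M) true) Q' by rewrite -VA.
have common3 : size (common25 (block25 a b c d)) = 3.
  have := card_common_secants char5 r2 GammaE hM hVM MQ VAQ.
  by move/card_esym/card_eq_trans => /(_ _ _ card3) /card_eq_II.
have det0 : ev a * ev d - ev b * ev c != 0.
  apply/eqP => det0; have kerV x : x *m V = 0 -> x = 0.
    by move=> xV; rewrite -[x]mulmx1 -(mulmxV Vu) mulmxA xV mul0mx.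
  have /kerV /rowP x0 : row3 [:: ev d; 0; - ev b] *m V = 0.
    apply: row3P; rewrite VA !(mxE, sum3E) /= ?ev0 ?ev1; try ring.
    by rewrite -[RHS]det0; ring.
  have d0 : ev d = 0 by have := x0 o0; rewrite !mxE.
  have /kerV /rowP y0 : row3 [:: ev c; 0; - ev a] *m V = 0.
    apply: row3P; rewrite VA !(mxE, sum3E) /= ?ev0 ?ev1; try ring.
    by transitivity (- (ev a * ev d - ev b * ev c)); [ring | rewrite det0 oppr0].
  have c0 : ev c = 0 by have := y0 o0; rewrite !mxE.
  move/(congr1 ev): pair1; rewrite !evE c0 d0 !mulr0 addr0 ev1.
  by move/eqP; rewrite eq_sym oner_eq0.
have check := allP (allP block_classification25 _ iso1) _ iso2.
rewrite block_check25E pair1 eqxx common3 eqxx in check.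
(* On a zero quartic the finite check asserts that the number of common secants is not three. *)
have nz : quartic25 a b c d != (zero25, zero25, zero25).
  apply: contraTneq check => q0.
  have f0 : four_roots25 (zero25, zero25, zero25) = false by [].
  by rewrite q0 f0 eqxx.
have four : four_roots25 (quartic25 a b c d).
  rewrite four_roots25P.
  rewrite evm_block in VAQ.
  apply: (block_conic_card4_inv (two_neq0 char5) det0 Mu MQ VAQ card4).
  have [<- <- <-] := quartic25E a b c d.
  move: nz; case: (quartic25 a b c d) => -[x y] z /=.
  by rewrite !xpair_eqE !(ev_eq0 char5 r2).
move: check; rewrite four => /hasP [e _ /eqP conicE].
exists e; have Nu : evm (nbr25 e) *m M \in unitmx.
  rewrite unitmx_mul Mu andbT.
  have /and3P [/eqP gE _ _] := nbr25_spec e.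
  apply: (similitude_unit char5 (oner_neq0 k)).
  by rewrite -(evm_gram char5 r2) gE (evm_herm char5) scale1r.
rewrite -[frame_curve (evm (nbr25 e) *m M) true]scale1r.
suff <- : frame_curve (evm (block25 a b c d) *m M) true =
    1 *: frame_curve (evm (nbr25 e) *m M) true by [].
apply: frame_curve_dual => //; rewrite ?oner_neq0 //; first exact: two_neq0 char5.
  by have [] := hVM.
have dualM B : (B *m M)^T *m dual_conic_mx k *m (B *m M) =
    M^T *m (B^T *m dual_conic_mx k *m B) *m M by rewrite trmx_mul !mulmxA.
by rewrite scale1r !dualM -!(evm_conic char5 r2) conicE.
Qed.

(** A common secant supplies end rows for frames of both conics; the transition matrix then
    preserves the middle direction, both as column and as row. *)
Lemma adjacent_frame M (Q Q' : curve k 2) : hframe M ->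
  defines (frame_curve M true) Q -> adjacent Gamma Q Q' ->
  exists w e, w \in ordered_pairs5 /\
    defines (frame_curve (evm (nbr25 e) *m (evm (sym25 w) *m M)) true) Q'.
Proof.
move=> hM MQ [_ tgQ' _ card4 card3]; have [Mu _] := hM.
have [f fS _] := card_eq_II_fun card3; have [[_ secL] [_ secL']] := fS ord0.
move: (f ord0) secL secL' => L.
move=> [P1 [P2 [QP1 QP2 P12 LP1 LP2]]] [P1' [P2' [QP1' QP2' P12' LP1' LP2']]].
have [w1 w15 MP1] := proj1 (conic_gamma_points char5 r2 GammaE _ hM MQ) QP1.
have [w2 w25 MP2] := proj1 (conic_gamma_points char5 r2 GammaE _ hM MQ) QP2.
have w12 : w1 != w2.
  by apply/eqP => ww; apply: P12; rewrite -ww in MP2; exact: spans_uniq MP1 MP2.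
have ww := mem_ordered_pairs5 w15 w25 w12.
have [hN NQ N0 N2] := sym25_frame char5 r2 ww hM MQ.
set N := evm (sym25 (w1, w2)) *m M in hN NQ N0 N2.
have [N' [hN' N'Q' N'0 N'2]] :=
  totally_tangent_frame char5 H_unit GammaE tgQ' QP1' QP2' P12'.
have [Nu [lam lam0 NE]] := hN; have [N'u [lam' lam'0 N'E]] := hN'.
have [d LE] := homog1_linear_form (equation_homog L).
have Ld : defines (linear_form d) L by rewrite -LE; exact: defines_equation.
(* The line passes through both end rows, so in frame coordinates it is the middle coordinate
   line. *)
have line_mid A : A \in unitmx -> row o0 A *m d = 0 -> row o2 A *m d = 0 ->
    exists2 x, x != 0 & A *m d = x *: delta_mx o1 0.
  move=> Au A0 A2; have rowAd i : (A *m d) i 0 = (row i A *m d) 0 0.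
    by rewrite -row_mul [RHS]mxE.
  have Ad : A *m d = (A *m d) o1 0 *: delta_mx o1 0.
    apply/colP; elim/ord3_ind; rewrite [RHS]mxE [delta_mx _ _ _ _]mxE /=.
    - by rewrite rowAd A0 mxE mulr0.
    - by rewrite mulr1.
    by rewrite rowAd A2 mxE mulr0.
  exists ((A *m d) o1 0) => //; apply: contraNneq (defines_neq0 Ld) => x0.
  by rewrite -[d]mul1mx -(mulVmx Au) -mulmxA Ad x0 scale0r mulmx0 linear_form0.
have [x x0 Nd] : exists2 x, x != 0 & N *m d = x *: delta_mx o1 0.
  by apply: line_mid => //; [rewrite N0; apply/(line_point Ld MP1)
                            |rewrite N2; apply/(line_point Ld MP2)].
have [y y0 N'd] : exists2 y, y != 0 & N' *m d = y *: delta_mx o1 0.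
  by apply: line_mid => //; [apply/(line_point Ld N'0)|apply/(line_point Ld N'2)].
pose U := N' *m invmx N.
have UN : U *m N = N' by rewrite /U -mulmxA mulVmx // mulmx1.
have Uu : U \in unitmx by rewrite unitmx_mul N'u unitmx_inv.
pose ka := y / x; have ka0 : ka != 0 by rewrite mulf_neq0 ?invr_eq0.
have Ue : U *m delta_mx o1 0 = ka *: (delta_mx o1 0 : 'cV_3).
  have : U *m (N *m d) = N' *m d by rewrite mulmxA UN.
  rewrite Nd N'd -scalemxAr => /(congr1 ( *:%R x^-1)).
  by rewrite !scalerA mulVf // scale1r mulrC.
have UE : gram (herm_mx k) U = (lam' / lam) *: herm_mx k.
  move: N'E; rewrite -UN (gramM char5) NE -scalemxAr -scalemxAl.
  move/(congr1 ( *:%R lam^-1)); rewrite !scalerA mulVf // scale1r => e.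
  by rewrite /gram e mulrC.
clearbody U.
have frobUe : frob U *m delta_mx o1 0 = ka ^+ 5 *: (delta_mx o1 0 : 'cV_3).
  by rewrite -{1}(frob_delta k) -(frobM char5 idfun) Ue frobZ frob_delta.
have Je : herm_mx k *m delta_mx o1 0 = (- 2%:R) *: (delta_mx o1 0 : 'cV_3).
  by apply/colP; elim/ord3_ind; rewrite !(mxE, sum3E) /=; ring.
(* The middle unit vector is an eigenvector of [U] and of [herm_mx], hence of [frob U]; unitarity up
   to a scalar transfers this to the transpose. *)
have rowU : U^T *m delta_mx o1 0 = (lam' / lam / ka ^+ 5) *: (delta_mx o1 0 : 'cV_3).
  have Fu : frob U \in unitmx by rewrite frob_unit.
  apply: (can_inj (mulKmx (herm_unit char5))); apply: (can_inj (mulKmx Fu)).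
  transitivity (gram (herm_mx k) U *m (delta_mx o1 0 : 'cV[k]_3)); first by rewrite /gram !mulmxA.
  rewrite UE -scalemxAl Je -!scalemxAr Je -!scalemxAr frobUe !scalerA.
  by congr (_ *: _); field; rewrite ?lam0 ?ka0.
(* Rescaling makes the middle entry 1, as [block_mx3] requires. *)
pose V := ka^-1 *: U.
have VN : V *m N = ka^-1 *: N' by rewrite -scalemxAl UN.
have col1 i : U i o1 = ka * (i == o1)%:R.
  by have /colP /(_ i) := Ue; rewrite -colE !mxE andbT.
have row1 i : U o1 i = lam' / lam / ka ^+ 5 * (i == o1)%:R.
  by have /colP /(_ i) := rowU; rewrite -colE !mxE andbT.
have Vblock : V = block_mx3 (V o0 o0) (V o0 o2) (V o2 o0) (V o2 o2).
  by by_coords; rewrite ?col1 ?row1 /= ?mulr0 ?mulr1 ?mulVf.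
have VE : gram (herm_mx k) V = herm_mx k.
  pose mu := ka^-1 ^+ 5 * ka^-1 * (lam' / lam).
  have VE : gram (herm_mx k) V = mu *: herm_mx k.
    rewrite /gram /V frobZ linearZ /= -!scalemxAl -scalemxAr.
    by rewrite -[frob U *m _ *m U^T]/(gram (herm_mx k) U) UE !scalerA.
  (* Once the middle entry of [V] is 1, the middle entries of the Gram matrices determine the
     multiplier. *)
  suff mu1 : mu = 1 by rewrite VE mu1 scale1r.
  have two0 := two_neq0 char5.
  have V10 : V o1 o0 = 0 by rewrite mxE row1 /= !mulr0.
  have V11 : V o1 o1 = 1 by rewrite mxE col1 /= mulr1 mulVf.
  have V12 : V o1 o2 = 0 by rewrite mxE row1 /= !mulr0.
  move: VE V10 V11 V12; clearbody V mu => /matrixP /(_ o1 o1) e V10 V11 V12.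
  move: e; rewrite !(mxE, sum3E) /= V10 V11 V12 => e.
  by apply: (mulIf (x := - 2%:R)); rewrite ?oppr_eq0 // -e; ring.
have VQ' : defines (frame_curve (V *m N) true) Q'.
  have su : ((ka^-1)%:M : 'M[k]_3) \in unitmx by rewrite unitmxE det_scalar unitfE expf_neq0 // invr_eq0.
  rewrite VN -mul_scalar_mx.
  apply: (frame_reparam char5 (c := ka^-1 ^+ 2)) => //.
    by rewrite expf_neq0 // invr_eq0.
  by rewrite tr_scalar_mx mul_scalar_mx mul_mx_scalar scalerA expr2.
have [e eQ'] := block_frame_classification hN NQ VE Vblock VQ' card4 card3.
by exists (w1, w2), e.
Qed.

Lemma frame_adjacent M (Q Q' : curve k 2) e : hframe M ->
  defines (frame_curve M true) Q -> defines (frame_curve (evm (nbr25 e) *m M) true) Q' ->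
  adjacent Gamma Q Q'.
Proof.
move=> hM MQ NQ'; have [Mu _] := hM.
have /and3P [/eqP gE /eqP common3 four] := nbr25_spec e.
have nE : gram (herm_mx k) (evm (nbr25 e)) = 1 *: herm_mx k.
  by rewrite -(evm_gram char5 r2) gE (evm_herm char5) scale1r.
have hN := similitude_frame char5 (oner_neq0 k) nE hM.
have card3 := card_common_secants char5 r2 GammaE hM hN MQ NQ'.
rewrite common3 in card3.
split=> //.
- exact: (hframe_totally_tangent char5 r2 GammaE hM MQ).
- exact: (hframe_totally_tangent char5 r2 GammaE hN NQ').
(* A conic shares 15 secants with itself, not three. *)
- move=> QQ'; rewrite -QQ' in card3.
  have M1 : evm unit25 *m M = M by rewrite evm_unit mul1mx.
  have := card_common_secants char5 r2 GammaE (U := unit25) hM _ MQ.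
  rewrite M1 => /(_ Q hM MQ); rewrite size_common_unit25.
  by move/card_esym/card_eq_trans => /(_ _ _ card3) /card_eq_II.
have det0 (a b c d : f25) : add25 (mul25 a d) (opp25 (mul25 b c)) != zero25 ->
    ev a * ev d - ev b * ev c != 0.
  by rewrite -!(evM char5 r2) -(evN char5) -(evD char5) (ev_eq0 char5 r2).
move: NQ' four {hN card3 gE common3 nE}; case: e => /= NQ'; rewrite four_roots25P => /andP [f1 f2].
  rewrite evm_block in NQ'.
  by apply: (block_conic_card4 (two_neq0 char5) _ Mu MQ NQ') => //; exact: det0.
rewrite evm_block in NQ'.
by apply: (block_conic_card4 (two_neq0 char5) _ Mu MQ NQ') => //; exact: det0.
Qed.

End Adjacency.

(** * Components *)

Lemma extend25_ind (R : mat25 -> Prop) s :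
  (forall A B, R A -> B \in neighbours25 A -> R B) ->
  (forall x, x \in s -> R x.1) -> forall x, x \in extend25 s -> R x.1.
Proof.
move=> stepR sR; rewrite /extend25.
have : forall A, A \in flatten [seq neighbours25 x.1 | x <- s] -> R A.
  by move=> A /flatten_mapP [x xs xA]; exact: stepR (sR x xs) xA.
move: (flatten _) => t; elim: t s sR {stepR} => //= A t IH s sR tR.
apply: IH => [x|B Bt]; last by apply: tR; rewrite inE Bt orbT.
case: ifP => _ //; first exact: sR.
by rewrite mem_rcons inE => /orP [/eqP ->|/sR //]; apply: tR; rewrite mem_head.
Qed.

(** Every frame in the list was produced from the identity by steps of [neighbours25], so its
    properties can be propagated without enumerating the list. *)
Lemma orbit25_ind (R : mat25 -> Prop) : R unit25 ->
  (forall A B, R A -> B \in neighbours25 A -> R B) ->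
  forall A, A \in orbit25 -> R A.
Proof.
move=> R1 stepR A /mapP [x xo ->]; move: x xo.
apply: (extend25_ind stepR); apply: (extend25_ind stepR).
by move=> x; rewrite inE => /eqP ->.
Qed.

Lemma mem_neighbours25 A w e : w \in ordered_pairs5 ->
  mul_mat25 (nbr25 e) (mul_mat25 (sym25 w) A) \in neighbours25 A.
Proof.
move=> w5; have e2 : e \in [:: true; false] by case: e.
exact: (allpairs_f (fun w e => mul_mat25 (nbr25 e) (mul_mat25 (sym25 w) A)) w5 e2).
Qed.

Section Component.
Variable k : closedFieldType.
Hypothesis char5 : 5%N \in [pchar k].
Variable r : k.
Hypothesis r2 : r ^+ 2 = 2%:R.
Local Notation ev := (ev r).
Local Notation evv := (evv r).
Local Notation evm := (evm r).
Variables (H : 'M[k]_3) (Gamma : curve k 6).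
Hypothesis H_unit : H \in unitmx.
Hypothesis GammaE : defines (hermitian_form H) Gamma.
Local Notation hframe := (hermitian_frame H).

Lemma frame_conic_exists (M : 'M[k]_3) : M \in unitmx ->
  exists Q : curve k 2, defines (frame_curve M true) Q.
Proof.
move=> Mu; apply: defines_exists; first exact: (frame_curve_homog M true).
have : eval (frame_curve M true) (delta_mx 0 o1 *m M) != 0.
  rewrite /frame_curve expr2 /eval mevalB !mevalM -!/(eval _ _) !eval_frame_form // !mxE /=.
  by rewrite mulr1 mul0r subr0 oner_eq0.
by apply: contraNneq => ->; rewrite /eval meval0.
Qed.

Lemma normal_conic25_scale A : exists2 c, ev c != 0 &
  normal_conic25 A = scale_mat25 c (conic25 A).
Proof.
rewrite /normal_conic25; set a := nth _ _ _; exists (inv25 a) => //.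
have : a != zero25.
  rewrite /a; set s := filter _ _; case: (posnP (size s)) => [/size0nil -> //|s0].
  by have := mem_nth one25 s0; rewrite mem_filter => /andP [].
by rewrite (ev_eq0 char5 r2); case: a; do 2!case.
Qed.

(** Equal normalised dual conics over F_25 remain proportional after the base change by [M], hence
    define the same curve. *)
Lemma same_conic25 A B M (Q : curve k 2) : evm A *m M \in unitmx -> evm B *m M \in unitmx ->
  normal_conic25 A = normal_conic25 B ->
  defines (frame_curve (evm A *m M) true) Q -> defines (frame_curve (evm B *m M) true) Q.
Proof.
move=> Au Bu; have [a a0 ->] := normal_conic25_scale A; have [b b0 ->] := normal_conic25_scale B.
move=> /(congr1 evm); rewrite !(evm_scale char5 r2) !(evm_conic char5 r2) => AB AQ.
have c0 : ev b / ev a != 0 by rewrite mulf_neq0 ?invr_eq0.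
have dualM C : (evm C *m M)^T *m dual_conic_mx k *m (evm C *m M) =
    M^T *m ((evm C)^T *m dual_conic_mx k *m evm C) *m M by rewrite trmx_mul !mulmxA.
have E : frame_curve (evm B *m M) true = (ev b / ev a) *: frame_curve (evm A *m M) true.
  apply: frame_curve_dual => //; first exact: two_neq0 char5.
  rewrite !dualM scalemxAl scalemxAr; congr (_ *m _ *m _).
  by apply: (can_inj (scalerK a0)); rewrite AB scalerA mulrCA divff // mulr1.
by rewrite E; apply/definesZ.
Qed.

Variables (M : 'M[k]_3) (Q0 : curve k 2).
Hypothesis hM : hframe M.
Hypothesis MQ0 : defines (frame_curve M true) Q0.
Let D : set (curve k 2) := [set Q | clos_refl_trans _ (adjacent Gamma) Q0 Q].
Local Notation conic_of A Q := (defines (frame_curve (evm A *m M) true) Q).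

Let Mu : M \in unitmx. Proof. by case: hM. Qed.

Lemma neighbour_adjacent A B Q Q' : hframe (evm A *m M) -> B \in neighbours25 A ->
  conic_of A Q -> hframe (evm B *m M) /\ (conic_of B Q' -> adjacent Gamma Q Q').
Proof.
move=> hA /allpairsP [[w e] /= [w5 _ ->]] AQ.
have [hS SQ _ _] := sym25_frame char5 r2 w5 hA AQ.
have BE : evm (mul_mat25 (nbr25 e) (mul_mat25 (sym25 w) A)) *m M =
    evm (nbr25 e) *m (evm (sym25 w) *m (evm A *m M)).
  by rewrite !(evm_mul char5 r2) !mulmxA.
rewrite BE; split; last exact: (frame_adjacent char5 r2 GammaE hS SQ).
have /and3P [/eqP gE _ _] := nbr25_spec e.
apply: (similitude_frame char5 (oner_neq0 k) _ hS).
by rewrite -(evm_gram char5 r2) gE (evm_herm char5) scale1r.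
Qed.

Lemma orbit_frame A : A \in orbit25 ->
  hframe (evm A *m M) /\ forall Q, conic_of A Q -> D Q.
Proof.
move: A; apply: orbit25_ind.
  rewrite evm_unit mul1mx; split=> // Q MQ.
  by rewrite (defines_uniq MQ MQ0); exact: rt_refl.
move=> A B [hA AD] AB; have [Au _] := hA; have [Q AQ] := frame_conic_exists Au.
split; first by have [] := neighbour_adjacent Q hA AB AQ.
move=> Q' BQ'; have [_ /(_ BQ') adj] := neighbour_adjacent Q' hA AB AQ.
by apply: rt_trans (AD Q AQ) _; exact: rt_step.
Qed.

(** Along an adjacency path, each step leads to a neighbour of a listed frame, and [orbit25_closed]
    replaces it by a listed frame of the same conic. *)
Lemma component_orbit Q : D Q -> exists2 A, A \in orbit25 & conic_of A Q.
Proof.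
have closed Q1 Q2 : adjacent Gamma Q1 Q2 ->
    (exists2 A, A \in orbit25 & conic_of A Q1) -> exists2 A, A \in orbit25 & conic_of A Q2.
  move=> adj [A Ao AQ1]; have [hA _] := orbit_frame Ao.
  have [w [e [w5 Q2E]]] := adjacent_frame char5 r2 H_unit GammaE hA AQ1 adj.
  pose B := mul_mat25 (nbr25 e) (mul_mat25 (sym25 w) A).
  have BE : evm B *m M = evm (nbr25 e) *m (evm (sym25 w) *m (evm A *m M)).
    by rewrite !(evm_mul char5 r2) !mulmxA.
  have AB : B \in neighbours25 A.
    exact: mem_neighbours25.
  have [hB _] := neighbour_adjacent Q2 hA AB AQ1.
  have /hasP [_ /mapP [A' A'o ->] /eqP BA'] := allP (allP orbit25_closed _ Ao) _ AB.
  have [[A'u _] [Bu _]] := ((orbit_frame A'o).1, hB).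
  exists A'; first exact: A'o.
  apply: same_conic25 Bu A'u BA' _; rewrite BE; exact: Q2E.
rewrite /D /= => QD; suff : forall Q1 Q2, clos_refl_trans _ (adjacent Gamma) Q1 Q2 ->
    (exists2 A, A \in orbit25 & conic_of A Q1) -> exists2 A, A \in orbit25 & conic_of A Q2.
  by move/(_ _ _ QD); apply; exists unit25; [exact: unit25_orbit25|rewrite evm_unit mul1mx].
by move=> Q1 Q2; elim=> // Q3 Q4 Q5 _ IH1 _ IH2 /IH1.
Qed.

(** Noncollinearity over F_25 survives the invertible base change by [M], so a point determines both
    its conic and its parameter. *)
Lemma flag_inj A A' w w' P : A \in orbit25 -> A' \in orbit25 ->
  w \in line5 -> w' \in line5 ->
  spans (evv (veronese25 w) *m (evm A *m M)) P ->
  spans (evv (veronese25 w') *m (evm A' *m M)) P -> (A, w) = (A', w').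
Proof.
move=> Ao A'o w5 w'5; rewrite !mulmxA -!(evv_vecmul char5 r2) => Pw Pw'.
apply: (pairwise_collinear char5 r2 flags25_noncollinear).
- exact: (allpairs_f (fun A p => (A, p)) Ao w5).
- exact: (allpairs_f (fun A p => (A, p)) A'o w'5).
exact: (spans_collinear char5 r2 Mu Pw Pw').
Qed.

Lemma component_point Q P : D Q -> (points Q `&` points Gamma) P ->
  exists A w, [/\ A \in orbit25, w \in line5, conic_of A Q &
    spans (evv (veronese25 w) *m (evm A *m M)) P].
Proof.
move=> /component_orbit [A Ao AQ] QP; have [hA _] := orbit_frame Ao.
have [w w5 wP] := proj1 (conic_gamma_points char5 r2 GammaE _ hA AQ) QP.
exists A, w; split; [exact: Ao|exact: w5|exact: AQ|exact: wP].
Qed.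

Lemma component_disjoint Q Q' P : D Q -> D Q' ->
  (points Q `&` points Gamma) P -> (points Q' `&` points Gamma) P -> Q = Q'.
Proof.
move=> /component_point dQ /component_point dQ' /dQ [A [w [Ao w5 AQ wP]]].
move=> /dQ' [A' [w' [A'o w'5 A'Q' w'P]]].
have [AA' _] := flag_inj Ao A'o w5 w'5 wP w'P.
by rewrite -AA' in A'Q'; exact: defines_uniq AQ A'Q'.
Qed.

Lemma card_component : D #= `I_21.
Proof.
rewrite -size_orbit25; apply: (@card_eq_II_rel _ _ _ orbit25 (fun A Q => conic_of A Q)).
- exact: uniq_orbit25.
- move=> A Ao; have [hA AD] := orbit_frame Ao; have [Au _] := hA.
  have [Q AQ] := frame_conic_exists Au; exists Q; [exact: AD|exact: AQ].
- by move=> Q /component_orbit.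
(* Two frames of one conic share a contact point, and the flag of that point determines the
   frame. *)
- move=> A A' Q Ao A'o AQ A'Q; have [hA _] := orbit_frame Ao; have [hA' _] := orbit_frame A'o.
  have [f fQ _] := card_eq_II_fun (card_conic_gamma char5 r2 GammaE hA AQ).
  have [w w5 wP] := proj1 (conic_gamma_points char5 r2 GammaE _ hA AQ) (fQ ord0).
  have [w' w'5 w'P] := proj1 (conic_gamma_points char5 r2 GammaE _ hA' A'Q) (fQ ord0).
  by have [-> _] := flag_inj Ao A'o w5 w'5 wP w'P.
- by move=> A Q Q'; exact: defines_uniq.
Qed.

Lemma flag_weierstrass x : x \in flags25 -> exists Q P, [/\ D Q,
  (points Q `&` points Gamma) P, weierstrass Gamma P & spans (evv (flag_point25 x) *m M) P].
Proof.
move=> /allpairsP [[A w] /= [Ao w5 ->]]; have [hA AD] := orbit_frame Ao.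
have [Au _] := hA; have [Q AQ] := frame_conic_exists Au.
have [|P wP] := @spans_exists _ _ (evv (veronese25 w) *m (evm A *m M)).
  exact: (ev_row_neq0 char5 r2 Au (veronese25_neq0 w5)).
have QP : (points Q `&` points Gamma) P.
  by apply/(conic_gamma_points char5 r2 GammaE _ hA AQ); exists w.
exists Q, P; split; [exact: AD|exact: QP| |].
  exact: (conic_gamma_weierstrass char5 r2 GammaE hA AQ).
rewrite (evv_vecmul char5 r2) -mulmxA; exact: wP.
Qed.

Lemma weierstrass_flag P : weierstrass Gamma P ->
  exists2 x, x \in flags25 & spans (evv (flag_point25 x) *m M) P.
Proof.
move=> /(weierstrass_rational char5 r2 H_unit GammaE hM) [u [u25 fu uP]].
have := allP flags25_complete _ u25; rewrite fu eqxx => /hasP [_ /mapP [x xf ->] ux].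
exists x; first exact: xf.
move: ux; rewrite (collinear25P char5 r2) => /eqP.
have u0 : evv u != 0.
  by apply: contraNneq (spans_neq0 uP) => ->; rewrite mul0mx.
move=> /(cross_eq0 u0) [c cE].
have c0 : c != 0.
  have [Q [P' [_ _ _ /spans_neq0]]] := flag_weierstrass xf.
  by rewrite cE; apply: contraNneq => ->; rewrite scale0r mul0mx.
by rewrite cE -scalemxAl; apply/spansZ.
Qed.

Lemma card_weierstrass : weierstrass Gamma #= `I_(21 * 6)%N.
Proof.
rewrite -size_flags25.
apply: (@card_eq_II_rel _ _ _ flags25 (fun x P => spans (evv (flag_point25 x) *m M) P)).
- exact: uniq_flags25.
- move=> x /flag_weierstrass [Q [P [_ _ WP xP]]]; exists P; [exact: WP|exact: xP].
- by move=> P /weierstrass_flag.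
- move=> x y P xf yf xP yP; apply: (pairwise_collinear char5 r2 flags25_noncollinear xf yf).
  exact: (spans_collinear char5 r2 Mu xP yP).
- by move=> x P P'; exact: spans_uniq.
Qed.

Lemma component_decomposition :
  (forall Q Q' : curve k 2, D Q -> D Q' -> Q <> Q' ->
     points Q `&` points Q' `&` points Gamma #= `I_0) /\
  [/\ D #= `I_21,
      weierstrass Gamma #= `I_(21 * 6)%N,
      (forall Q, D Q -> points Q `&` points Gamma #= `I_6) &
      partition D (fun Q => points Q `&` points Gamma) (weierstrass Gamma)].
Proof.
have card6 Q : D Q -> points Q `&` points Gamma #= `I_6.
  move=> /component_orbit [A Ao AQ]; have [hA _] := orbit_frame Ao.
  exact: (card_conic_gamma char5 r2 GammaE hA AQ).
split.
  move=> Q Q' DQ DQ' QQ'; rewrite II0 card_eq0; apply/eqP; rewrite -subset0.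
  by move=> P [[QP Q'P] GP]; apply: QQ'; exact: component_disjoint DQ DQ' (conj QP GP) (conj Q'P GP).
split=> //.
- exact: card_component.
- exact: card_weierstrass.
split.
- apply/seteqP; split=> [P [Q /component_orbit [A Ao AQ] QP]|P /weierstrass_flag [x xf xP]].
    have [hA _] := orbit_frame Ao.
    exact: (conic_gamma_weierstrass char5 r2 GammaE hA AQ).
  have [Q [P' [DQ QP' _ xP']]] := flag_weierstrass xf.
  exists Q; [exact: DQ|rewrite (spans_uniq xP xP'); exact: QP'].
- by move=> Q Q' DQ DQ' [P [QP Q'P]]; exact: component_disjoint DQ DQ' QP Q'P.
- move=> Q /card6 /card_eq_II_fun [f fQ _]; exists (f ord0); exact: fQ.
Qed.

End Component.

Theorem proposition1p4 (k : closedFieldType) (char5 : 5%N \in [pchar k])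
    (Gamma : curve k 6) (hGamma : hermitian_curve Gamma)
    (D : set (curve k 2)) (hD : component Gamma D) :
  (forall Q Q' : curve k 2, D Q -> D Q' -> Q <> Q' ->
     points Q `&` points Q' `&` points Gamma #= `I_0) /\
  [/\ D #= `I_21,
      weierstrass Gamma #= `I_(21 * 6)%N,
      (forall Q, D Q -> points Q `&` points Gamma #= `I_6) &
      partition D (fun Q => points Q `&` points Gamma) (weierstrass Gamma)].
Proof.
have [H H_unit GammaE] := hermitian_curveP char5 hGamma.
have [r r2] := sqr_exists (2%:R : k).
have [Q0 tgQ0 ->] := hD; have [_ card6 _] := tgQ0.
have [f fQ f_inj] := card_eq_II_fun card6.
(* Two contact points of [Q0] serve as the ends of the base frame in which the whole component is
   described. *)
have f01 : f ord0 <> f ord_max by move/f_inj.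
have [M [hM MQ0 _ _]] := totally_tangent_frame char5 H_unit GammaE tgQ0 (fQ _) (fQ _) f01.
exact: (component_decomposition char5 r2 H_unit GammaE hM MQ0).
Qed.
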